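(* There exists a unique pair of $\mathbf{C}\langle\langle X_0,X_1\rangle\rangle$-valued functions $F^{(0)}(z)$, $F^{(1)}(z)$ ($z\in\mathbf{D}_0\cap\mathbf{D}_1$) of the form $$F^{(0)}(z)=(1-z)^{-X_1}\,\tilde F^{(0)}(z)\,z^{X_0},\qquad \tilde F^{(0)}(z)=\sum_{w\in S}\tilde f^{(0)}(\mathrm{reg}^{10}(w);z)\,W,$$ $$F^{(1)}(z)=z^{X_0}\,\tilde F^{(1)}(z)\,(1-z)^{-X_1},\qquad \tilde F^{(1)}(z)=\sum_{w\in S}\tilde f^{(1)}(\mathrm{reg}^{10}(w);z)\,W,$$ where $\tilde f^{(i)}(\bullet;z):S^{10}\to\mathbf{C}$ are linear maps, such that $F^{(0)}(z)$ and $F^{(1)}(z)$ are grouplike and satisfy the following conditions: (i) $\left(F^{(1)}(z)\right)^{-1}F^{(0)}(z)=\varPhi_{\rm KZ}$ for $z\in\mathbf{D}_0\cap\mathbf{D}_1$. (ii) $\tilde F^{(0)}(z)$ and $\tilde F^{(1)}(z)$ are holomorphic on $\mathbf{D}_0$ and $\mathbf{D}_1$ respectively, and satisfy, for $i=0,1$, the asymptotic condition $$\frac{d}{dz}\tilde F^{(i)}(z)\to 0\qquad(z\to\infty,\ z\in\mathbf{D}_i).$$ (iii) $\tilde F^{(0)}(0)=\mathbf{I}$. Moreover, these functions $F^{(0)}(z)$ and $F^{(1)}(z)$ are the fundamental solutions of the KZ equation of one variable $$\frac{dG}{dz}=\left(\frac{X_0}{z}+\frac{X_1}{1-z}\right)G$$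 normalized at $z=0$ and at $z=1$ respectively.
   Context: Domains: $\mathbf{D}_0=\mathbf{C}\setminus\{x\in\mathbf{R}: x\ge 1\}$, $\mathbf{D}_1=\mathbf{C}\setminus\{x\in\mathbf{R}: x\le 0\}$. $\log z$ denotes the principal branch on $\mathbf{D}_1$, and $\log(1-z)$ the principal branch on $\mathbf{D}_0$. Hopf algebra: $\mathcal{U}=\mathbf{C}\langle X_0,X_1\rangle$ is the non-commutative polynomial algebra (universal enveloping algebra of the free Lie algebra on $X_0,X_1$) with unit $\mathbf{I}$, coproduct the algebra morphism $\Delta$ with $\Delta(X_i)=\mathbf{I}\otimes X_i+X_i\otimes\mathbf{I}$, counit $\varepsilon(X_i)=0$. Its completion for the grading by word length is the non-commutative formal power series algebra $\mathbf{C}\langle\langle X_0,X_1\rangle\rangle$. An element $F$ of it is grouplike if $\varepsilon(F)=1$ and $\Delta(F)=F\,\widehat\otimes\,F$; a function is grouplike if its values are. Holomorphy, derivatives and limits of $\mathbf{C}\langle\langle X_0,X_1\rangle\rangle$-valued functions are understood coefficientwise; ''holomorphic on $\mathbf{D}_i$'' means that the function extends holomorphically to $\mathbf{D}_i$, and conditions at $z\to\infty$ and $z=0$ refer to this extension. $z^{X_0}=\sum_{n\ge0}\frac{\log^n z}{n!}X_0^n$ and $(1-z)^{-X_1}=\sum_{n\ge0}\frac{(-\log(1-z))^n}{n!}X_1^n$. Shuffle algebra: $\xi_0=\frac{dz}{z}$, $\xi_1=\frac{dz}{1-z}$. $S=S(\xi_0,\xi_1)$ is the vector space $\mathbf{C}\langle\xi_0,\xi_1\rangle$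 of non-commutative polynomials in the letters $\xi_0,\xi_1$ (with basis the words; the empty word is denoted $\mathbf{1}$), equipped with the shuffle product ⧢, the bilinear product defined recursively by $w$ ⧢ $\mathbf{1}=\mathbf{1}$ ⧢ $w=w$ and $(\xi_{i}w_1)$ ⧢ $(\xi_{j}w_2)=\xi_{i}\big(w_1$ ⧢ $(\xi_{j}w_2)\big)+\xi_{j}\big((\xi_{i}w_1)$ ⧢ $w_2\big)$. Juxtaposition and powers such as $\xi_0^j$ denote concatenation. $\sum_{w\in S}$ denotes the sum over all words $w$ in $\xi_0,\xi_1$ (including the empty one), and for $w=\xi_{i_1}\cdots\xi_{i_r}$ the capital letter $W$ denotes $X_{i_1}\cdots X_{i_r}$ (with $W=\mathbf{I}$ for $w=\mathbf{1}$). Let $S^0=\mathbf{C}\mathbf{1}+S\xi_1$ and $S^{10}=\mathbf{C}\mathbf{1}+\xi_0S\xi_1$. Every $w\in S$ can be written uniquely as $w=\sum_{i,j}\xi_1^i$ ⧢ $w_{ij}$ ⧢ $\xi_0^j$ with $w_{ij}\in S^{10}$ (finite sum). The regularizing map $\mathrm{reg}^{10}:S\to S^{10}$ is defined by $\mathrm{reg}^{10}(w)=w_{00}$. Multiple zeta values: $\zeta:S^{10}\to\mathbf{C}$ is the linear map with $\zeta(\mathbf{1})=1$ and $\zeta(\xi_0^{k_1-1}\xi_1\cdots\xi_0^{k_r-1}\xi_1)=\sum_{n_1>\cdots>n_r>0}\frac{1}{n_1^{k_1}\cdots n_r^{k_r}}$ for $k_1\ge2$, $k_2,\dots,k_r\ge1$.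 The Drinfel'd associator is $$\varPhi_{\rm KZ}=\sum_{w\in S}\zeta(\mathrm{reg}^{10}(w))\,W\in\mathbf{C}\langle\langle X_0,X_1\rangle\rangle.$$ Fundamental solutions: the fundamental solution of the KZ equation normalized at $z=0$ is the unique $\mathbf{C}\langle\langle X_0,X_1\rangle\rangle$-valued solution of the form $\mathcal{L}^{(0)}(z)=\widehat{\mathcal{L}}^{(0)}(z)z^{X_0}$ with $\widehat{\mathcal{L}}^{(0)}$ holomorphic at $z=0$ and $\widehat{\mathcal{L}}^{(0)}(0)=\mathbf{I}$; the one normalized at $z=1$ is the unique solution of the form $\mathcal{L}^{(1)}(z)=\widehat{\mathcal{L}}^{(1)}(z)(1-z)^{-X_1}$ with $\widehat{\mathcal{L}}^{(1)}$ holomorphic at $z=1$ and $\widehat{\mathcal{L}}^{(1)}(1)=\mathbf{I}$. *)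

(* Defs.v *)
From Stdlib Require Import Reals List Arith ClassicalEpsilon.
From Coquelicot Require Import Coquelicot.
Import ListNotations.

Local Open Scope C_scope.

(* x0 stands for X_0 as well as xi_0, and x1 for X_1 as well as xi_1, so that
   w and the associated W are the same word. *)
Inductive letter : Set := x0 | x1.

Definition word := list letter.

Definition letter_eq_dec : forall a b : letter, {a = b} + {a <> b}.
Proof. decide equality. Defined.

Definition word_eq_dec : forall u v : word, {u = v} + {u <> v} :=
  list_eq_dec letter_eq_dec.

(* [F w] is the coefficient of the word [w] in the series [F]. *)
Definition series := word -> C.

(* Polynomials are the series of bounded degree, over a finite alphabet. *)
Definition degree_le (p : series) (n : nat) : Prop :=
  forall w : word, (n < length w)%nat -> p w = 0.
Definition is_poly (p : series) : Prop := exists n : nat, degree_le p n.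

Definition mono (v : word) : series :=
  fun w => if word_eq_dec w v then 1 else 0.
Definition nc_one : series := mono [].
Definition nc_zero : series := fun _ => 0.
Definition nc_add (F G : series) : series := fun w => F w + G w.
Definition nc_scale (a : C) (F : series) : series := fun w => a * F w.
Definition nc_mul (F G : series) : series :=
  fun w => sum_n (fun k => F (firstn k w) * G (skipn k w)) (length w).

Declare Scope nc_scope.
Delimit Scope nc_scope with nc.
Infix "+" := nc_add : nc_scope.
Infix "*" := nc_mul : nc_scope.
Infix "*:" := nc_scale (at level 40) : nc_scope.

Fixpoint nc_pow (F : series) (n : nat) : series :=
  match n with
  | O => nc_one
  | S n' => (F * nc_pow F n')%nc
  end.

(* With c = F [], the inverse is c^-1 * sum_k (1 - F / c)^k; the k-th power has
   no term of degree < k, so k <= |w| suffices for the coefficient of w. *)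
Definition nc_inv (F : series) : series := fun w =>
  / F [] *
  sum_n (fun k => nc_pow (nc_one + (- / F []) *: F)%nc k w) (length w).

Fixpoint words (n : nat) : list word :=
  match n with
  | O => [[]]
  | S n' => map (cons x0) (words n') ++ map (cons x1) (words n')
  end.

Definition sum_words (n : nat) (g : word -> C) : C :=
  fold_right Cplus 0 (map g (words n)).

(* Completed tensor square: [A u v] is the coefficient of u (x) v. *)
Definition tseries := word -> word -> C.

Definition tens (F G : series) : tseries := fun u v => F u * G v.
Definition tens_add (A B : tseries) : tseries := fun u v => A u v + B u v.
Definition tens_mul (A B : tseries) : tseries := fun u v =>
  sum_n (fun k => sum_n (fun l =>
    A (firstn k u) (firstn l v) * B (skipn k u) (skipn l v)) (length v))
  (length u).

Fixpoint coprod_word (w : word) : tseries :=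
  match w with
  | [] => tens nc_one nc_one
  | i :: w' =>
      tens_mul (tens_add (tens nc_one (mono [i])) (tens (mono [i]) nc_one))
               (coprod_word w')
  end.

(* Delta W is homogeneous of total degree |w|, so only the words of length
   |u| + |v| contribute to the coefficient of u (x) v. *)
Definition coprod (F : series) : tseries := fun u v =>
  sum_words (length u + length v) (fun w => F w * coprod_word w u v).

Definition counit (F : series) : C := F [].

Definition grouplike (F : series) : Prop :=
  counit F = 1 /\ coprod F = tens F F.

(* The words of the shuffle of two words, listed with multiplicity. *)
Fixpoint shuffle_word (u : word) : word -> list word :=
  fix shuffle_u (v : word) : list word :=
    match u, v with
    | [], _ => [v]
    | _, [] => [u]
    | i :: u', j :: v' =>
        map (cons i) (shuffle_word u' v) ++ map (cons j) (shuffle_u v')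
    end.

(* Bilinear extension; the words of a shuffle of u and v have length
   |u| + |v|. *)
Definition shuffle (p q : series) : series := fun w =>
  sum_n (fun k =>
    sum_words k (fun u =>
      sum_words (length w - k) (fun v =>
        p u * q v * INR (count_occ word_eq_dec (shuffle_word u v) w))))
  (length w).

Definition in_S10 (p : series) : Prop :=
  exists (c : C) (q : series),
    is_poly q /\ p = (c *: nc_one + mono [x0] * q * mono [x1])%nc.

(* Linearity of the restriction of [f] to S^10; the values of [f] outside
   S^10 are irrelevant. *)
Definition linear_on_S10 (f : series -> C) : Prop :=
  forall (a : C) (p q : series), in_S10 p -> in_S10 q ->
    f (a *: p + q)%nc = a * f p + f q.

(* p = sum_{i,j <= N} xi_1^i sh c_ij sh xi_0^j with all c_ij in S^10 *)
Definition reg_decomposition (p : series) (N : nat)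
    (c : nat -> nat -> series) : Prop :=
  (forall i j, in_S10 (c i j)) /\
  forall w, p w =
    sum_n (fun i => sum_n (fun j =>
      shuffle (shuffle (mono (repeat x1 i)) (c i j)) (mono (repeat x0 j)) w)
    N) N.

(* Every polynomial has such a decomposition, and its c_00 is unique, so this
   choice is forced for every polynomial p. *)
Definition reg10 (p : series) : series :=
  epsilon (inhabits nc_zero)
    (fun r => exists N c, reg_decomposition p N c /\ r = c O O).

Definition reg_series (f : series -> C) : series :=
  fun w => f (reg10 (mono w)).

(* xi_0^(k_1 - 1) xi_1 ... xi_0^(k_r - 1) xi_1 |-> [k_1; ...; k_r], where [k]
   counts the letters xi_0 read since the last xi_1. *)
Fixpoint word_index_from (k : nat) (w : word) : list nat :=
  match w with
  | [] => []
  | x0 :: w' => word_index_from (S k) w'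
  | x1 :: w' => S k :: word_index_from 0 w'
  end.
Definition word_index (w : word) : list nat := word_index_from 0 w.

(* sum over N >= n_1 > ... > n_r > 0 of 1 / (n_1^k_1 ... n_r^k_r) *)
Fixpoint mzv_partial (ks : list nat) (N : nat) : R :=
  match ks with
  | [] => 1%R
  | k :: ks' =>
      sum_n_m (fun n => (/ INR n ^ k * mzv_partial ks' (n - 1))%R) 1 N
  end.

Definition mzv (ks : list nat) : R := real (Lim_seq (mzv_partial ks)).

(* Linear extension of mzv from the words: an arbitrary degree bound is used
   for the finite sum, which does not depend on it. Words outside S^10 get a
   meaningless value but do not occur in elements of S^10. *)
Definition degree_bound (p : series) : nat :=
  epsilon (inhabits O) (degree_le p).
Definition zeta (p : series) : C :=
  sum_n (fun n => sum_words n (fun w => p w * mzv (word_index w)))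
    (degree_bound p).

Definition Phi_KZ : series := reg_series zeta.

Definition D0 (z : C) : Prop := ~ (Im z = 0%R /\ (1 <= Re z)%R).
Definition D1 (z : C) : Prop := ~ (Im z = 0%R /\ (Re z <= 0)%R).
Definition D01 (z : C) : Prop := D0 z /\ D1 z.

(* On D1, arg z = 2 arctan (Im z / (|z| + Re z)) lies in (-pi, pi) by the
   half-angle formula. *)
Definition Clog (z : C) : C :=
  (ln (Cmod z), (2 * atan (Im z / (Cmod z + Re z)))%R).

(* exp (t X_i) = sum_n t^n / n! X_i^n *)
Definition exp_letter (i : letter) (t : C) : series := fun w =>
  if word_eq_dec w (repeat i (length w))
  then t ^ length w / INR (fact (length w)) else 0.

Definition z_pow_X0 (z : C) : series := exp_letter x0 (Clog z).
Definition one_minus_z_pow_mX1 (z : C) : series :=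
  exp_letter x1 (- Clog (1 - z)).

Definition holomorphic_on (D : C -> Prop) (F : C -> series) : Prop :=
  forall (w : word) (z : C), D z -> ex_derive (fun t : C => F t w) z.

Definition holomorphic_at (a : C) (F : C -> series) : Prop :=
  forall w : word, locally a (fun z : C => ex_derive (fun t : C => F t w) z).

Definition C_infty (P : C -> Prop) : Prop :=
  exists M : R, forall z : C, (M < Cmod z)%R -> P z.

Definition derivative_vanishes_at_infty (D : C -> Prop) (F : C -> series) :
    Prop :=
  forall w : word,
    filterlim (fun z : C => C_derive (fun t : C => F t w) z)
      (within D C_infty) (locally (RtoC 0)).

Definition KZ_solution (G : C -> series) : Prop :=
  forall (w : word) (z : C), D01 z ->
    is_derive (fun t : C => G t w) z
      (((/ z *: mono [x0] + / (1 - z) *: mono [x1]) * G z)%nc w).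

(* The function on D01 underlying [Lhat] is L(z) z^{-X0}; [Lhat] itself also
   carries the values of its extension near 0, and similarly near 1 below. *)
Definition normalized_at_0 (L : C -> series) : Prop :=
  KZ_solution L /\
  exists Lhat : C -> series,
    holomorphic_at 0 Lhat /\ Lhat 0 = nc_one /\
    forall z, D01 z -> L z = (Lhat z * z_pow_X0 z)%nc.

Definition normalized_at_1 (L : C -> series) : Prop :=
  KZ_solution L /\
  exists Lhat : C -> series,
    holomorphic_at 1 Lhat /\ Lhat 1 = nc_one /\
    forall z, D01 z -> L z = (Lhat z * one_minus_z_pow_mX1 z)%nc.

(* Functions on D01 are total functions on C considered on D01 only. *)
Definition eq_on_D01 (F G : C -> series) : Prop :=
  forall z : C, D01 z -> F z = G z.

Definition fundamental_solution_at_0 (L : C -> series) : Prop :=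
  normalized_at_0 L /\ forall G, normalized_at_0 G -> eq_on_D01 G L.

Definition fundamental_solution_at_1 (L : C -> series) : Prop :=
  normalized_at_1 L /\ forall G, normalized_at_1 G -> eq_on_D01 G L.

(* On D01, [Ft] is sum_w f(reg10(w); z) W for linear maps f(-; z) on S^10. *)
Definition regular_form (Ft : C -> series) : Prop :=
  exists f : C -> series -> C, forall z, D01 z ->
    linear_on_S10 (f z) /\ Ft z = reg_series (f z).

(* The form of F_i is imposed on D01 only; outside D01, [Ft0] and [Ft1] carry
   the values of the holomorphic extensions to D0 and D1. *)
Definition riemann_hilbert_solution (F0 F1 : C -> series) : Prop :=
  (forall z, D01 z -> grouplike (F0 z) /\ grouplike (F1 z)) /\
  (forall z, D01 z -> (nc_inv (F1 z) * F0 z)%nc = Phi_KZ) /\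
  exists Ft0 Ft1 : C -> series,
    regular_form Ft0 /\ regular_form Ft1 /\
    (forall z, D01 z ->
      F0 z = (one_minus_z_pow_mX1 z * Ft0 z * z_pow_X0 z)%nc) /\
    (forall z, D01 z ->
      F1 z = (z_pow_X0 z * Ft1 z * one_minus_z_pow_mX1 z)%nc) /\
    holomorphic_on D0 Ft0 /\ holomorphic_on D1 Ft1 /\
    derivative_vanishes_at_infty D0 Ft0 /\
    derivative_vanishes_at_infty D1 Ft1 /\
    Ft0 0 = nc_one.

(* Main.v *)
(* Put u = log (1 - z), which maps D0 onto the strip |Im u| < pi. There the
   holomorphic factor Lhat of L^(0) = Lhat z^{X_0} is built word by word: each
   coefficient is a primitive of earlier ones times dz/z or dz/(1-z), and Goursat
   provides primitives in the strip. In this coordinate all derivatives grow at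
   most polynomially, so that d/dz = - e^{-u} d/du gives condition (ii). The
   coefficients are characters of the shuffle algebra because the shuffle defect
   solves a linear equation with zero data; a grouplike series comes from
   reg^{10} exactly when its coefficients at X_0 and X_1 vanish. The symmetry
   z -> 1 - z, X_0 <-> - X_1 produces L^(1) from L^(0), and L^(0) = L^(1) Phi
   for a constant Phi, which is the limit of (1-z)^{X_1} L^(0)(z) as z -> 1;
   Abel's theorem for the power series of multiple polylogarithms identifies
   Phi with the associator.

   For uniqueness, if two solutions agree on shorter words then by (i) the
   differences of the coefficients of Ftilde^(0) and of Ftilde^(1) at a word
   coincide on the intersection of D0 and D1; they glue to an entire function
   whose derivative tends to 0, which is constant by Liouville and 0 by (iii). *)
From Stdlib Require Import Reals List Arith Lia Lra ClassicalEpsilon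
  FunctionalExtensionality ssreflect.
From Stdlib Require FinFun.
From Coquelicot Require Import Coquelicot.
Require Import Defs.
Import ListNotations.
Local Open Scope general_if_scope.
Local Open Scope C_scope.

(** The strip makes the analysis elementary: a primitive is an integral along a horizontal and then
    a vertical segment, so that Goursat's theorem on rectangles suffices. The only singular
    coefficient in the strip is that of dz/z, with a simple pole at u = 0. Splitting off z^{X_0}
    makes it multiply the commutator of X_0 with Lhat, whose coefficients vanish at u = 0 because
    Lhat = 1 there. The integrand therefore extends continuously to 0, which is what Goursat's
    theorem with one exceptional point asks for.

    All estimates have the form |f(u)| <= K (1 + |u|)^k m(u) with a weight m: |u| where the pole
    must be compensated, 1 for derivatives, |e^u| = |1 - z| for the convergence to the associator as
    z -> 1. Integration turns the weight 1 into |u|, and powers of logarithms only change k.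

    The equation at a word involves shorter words only, and outer factors with constant term 1 do
    not affect the first discrepancy of two series. Existence, growth, the character property and
    uniqueness are therefore all inductions on length. *)

Definition csum (f : nat -> C) (n : nat) : C := sum_n f n.

(* [ring] reads the carrier off the type of the atoms, and [sum_n] lives in
   [AbelianMonoid.sort C_AbelianMonoid]. *)
Ltac C_ring :=
  rewrite ?/plus /=; change (@sum_n C_AbelianMonoid) with csum;
  match goal with |- @eq _ ?a ?b => change (@eq C a b) end; ring.

(** * The algebra of non-commutative series *)

Lemma sum_n_Sl (f : nat -> C) (n : nat) :
  sum_n f (S n) = f O + sum_n (fun k => f (S k)) n.
Proof.
elim: n => [|n IH].
  by rewrite sum_Sn !sum_O.
by rewrite sum_Sn IH sum_Sn /plus /=; ring.
Qed.

(** Quotients by a first or a last letter. Through [nc_mul_cons] and [nc_mul_rcons] they turn the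
    sum over all cuts of a word into a recursion on the word, in which form products are handled
    from here on. *)
Definition shift (i : letter) (F : series) : series := fun w => F (i :: w).
Definition rshift (i : letter) (F : series) : series := fun w => F (w ++ [i]).

Lemma nc_mul_nil (F G : series) : (F * G)%nc [] = F [] * G [].
Proof. by rewrite /nc_mul /= sum_O. Qed.

Lemma nc_mul_cons (F G : series) (i : letter) (w : word) :
  (F * G)%nc (i :: w) = F [] * G (i :: w) + (shift i F * G)%nc w.
Proof. by rewrite /nc_mul /= sum_n_Sl. Qed.

Lemma series_ext (F G : series) : (forall w, F w = G w) -> F = G.
Proof. exact: functional_extensionality. Qed.

Lemma shift_mul (F G : series) (i : letter) :
  shift i (F * G)%nc = (F [] *: shift i G + shift i F * G)%nc.
Proof. by apply: series_ext => w; rewrite /shift nc_mul_cons. Qed.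

Lemma nc_mul_plus_l (F G H : series) (w : word) :
  ((F + G) * H)%nc w = (F * H)%nc w + (G * H)%nc w.
Proof.
elim: w F G => [|i w IH] F G; first by rewrite !nc_mul_nil /nc_add; ring.
rewrite !nc_mul_cons (_ : shift i (F + G)%nc = (shift i F + shift i G)%nc) //.
by rewrite IH /nc_add; ring.
Qed.

Lemma nc_mul_plus_r (F G H : series) (w : word) :
  (F * (G + H))%nc w = (F * G)%nc w + (F * H)%nc w.
Proof.
elim: w F => [|i w IH] F; first by rewrite !nc_mul_nil /nc_add; ring.
by rewrite !nc_mul_cons IH /nc_add; ring.
Qed.

Lemma nc_mul_scale_l (a : C) (F G : series) (w : word) :
  (a *: F * G)%nc w = a * (F * G)%nc w.
Proof.
elim: w F => [|i w IH] F; first by rewrite !nc_mul_nil /nc_scale; ring.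
rewrite !nc_mul_cons (_ : shift i (a *: F)%nc = (a *: shift i F)%nc) //.
by rewrite IH /nc_scale; ring.
Qed.

Lemma nc_mul_scale_r (a : C) (F G : series) (w : word) :
  (F * (a *: G))%nc w = a * (F * G)%nc w.
Proof.
elim: w F => [|i w IH] F; first by rewrite !nc_mul_nil /nc_scale; ring.
by rewrite !nc_mul_cons IH /nc_scale; ring.
Qed.

Lemma nc_mul_assoc (F G H : series) : (F * (G * H) = F * G * H)%nc.
Proof.
apply: series_ext => w.
elim: w F G => [|i w IH] F G; first by rewrite !nc_mul_nil; ring.
rewrite !nc_mul_cons IH shift_mul nc_mul_plus_l nc_mul_scale_l nc_mul_nil.
ring.
Qed.

Lemma shift_zero_mul (F G : series) (w : word) :
  (forall v, F v = 0) -> (F * G)%nc w = 0.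
Proof.
elim: w F => [|i w IH] F F0; first by rewrite nc_mul_nil F0; ring.
by rewrite nc_mul_cons F0 IH; [ring|move=> v; apply: F0].
Qed.

Lemma nc_mul_1_l (F : series) : (nc_one * F = F)%nc.
Proof.
apply: series_ext => -[|i w].
  by rewrite nc_mul_nil /nc_one /mono /=; ring.
by rewrite nc_mul_cons shift_zero_mul // /nc_one /mono /=; ring.
Qed.

Lemma nc_one_cons (i : letter) (w : word) : nc_one (i :: w) = 0.
Proof. by []. Qed.

Lemma nc_mul_1_r (F : series) : (F * nc_one = F)%nc.
Proof.
apply: series_ext => w.
elim: w F => [|i w IH] F; first by rewrite nc_mul_nil /nc_one /mono /=; ring.
by rewrite nc_mul_cons IH nc_one_cons /shift; ring.
Qed.

Lemma nc_mul_rcons (F G : series) (i : letter) (w : word) :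
  (F * G)%nc (w ++ [i]) = F (w ++ [i]) * G [] + (F * rshift i G)%nc w.
Proof.
elim: w F => [|j w IH] F.
  by rewrite /= nc_mul_cons !nc_mul_nil /shift /rshift /=; ring.
by rewrite /= !nc_mul_cons IH /rshift /shift /=; ring.
Qed.

Lemma mono_letter_mul_nil (i : letter) (F : series) :
  (mono [i] * F)%nc [] = 0.
Proof. by rewrite nc_mul_nil /mono /=; ring. Qed.

Lemma mono_letter_mul_cons (i j : letter) (F : series) (w : word) :
  (mono [i] * F)%nc (j :: w) = if letter_eq_dec j i then F w else 0.
Proof.
rewrite nc_mul_cons.
case: letter_eq_dec => [->|ne].
  rewrite (_ : shift i (mono [i]) = nc_one) ?nc_mul_1_l.
    by rewrite /mono /=; ring.
  apply: series_ext => v; rewrite /shift /mono /nc_one /mono.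
  by case: word_eq_dec => [[]|ne]; case: word_eq_dec => // ev; case: ne; rewrite ev.
rewrite shift_zero_mul; first by rewrite /mono /=; ring.
by move=> v; rewrite /shift /mono; case: word_eq_dec => // -[].
Qed.

Lemma mul_mono_letter_nil (i : letter) (F : series) :
  (F * mono [i])%nc [] = 0.
Proof. by rewrite nc_mul_nil /mono /=; ring. Qed.

Lemma mul_mono_letter_rcons (i j : letter) (F : series) (w : word) :
  (F * mono [i])%nc (w ++ [j]) = if letter_eq_dec j i then F w else 0.
Proof.
rewrite nc_mul_rcons.
have rz : forall H : series, (forall v, H v = 0) -> (F * H)%nc w = 0.
  move=> H H0; elim: w F => [|k w IH] F; first by rewrite nc_mul_nil H0; ring.
  by rewrite nc_mul_cons H0 IH; ring.
case: letter_eq_dec => [->|ne].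
  rewrite (_ : rshift i (mono [i]) = nc_one) ?nc_mul_1_r.
    by rewrite /mono /=; ring.
  apply: series_ext => v; rewrite /rshift /mono /nc_one /mono.
  case: word_eq_dec => e; case: word_eq_dec => // ev.
    by move: (f_equal (@length _) e); rewrite length_app /=; case: v ev {e} => //= a v _; lia.
  by case: e; rewrite ev.
rewrite rz; first by rewrite /mono /=; ring.
move=> v; rewrite /rshift /mono; case: word_eq_dec => // e.
by have [_ e2] := app_inj_tail v [] j i e; case: ne.
Qed.

(** Every cut of [w] except the last one pairs with a shorter prefix, where [D] vanishes. *)
Lemma nc_mul_low_l (F D : series) (w : word) :
  (forall v, (length v < length w)%nat -> D v = 0) ->
  (D * F)%nc w = D w * F [].
Proof.
elim: w D => [|i w IH] D H; first by rewrite nc_mul_nil.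
rewrite nc_mul_cons (H []) /=; last lia.
rewrite IH /shift; first ring.
by move=> v vl; apply: H => /=; lia.
Qed.

Lemma nc_mul_ext (F F' G G' : series) (w : word) :
  (forall v, (length v <= length w)%nat -> F v = F' v) ->
  (forall v, (length v <= length w)%nat -> G v = G' v) ->
  (F * G)%nc w = (F' * G')%nc w.
Proof.
elim: w F F' => [|i w IH] F F' H K; first by rewrite !nc_mul_nil H ?K.
rewrite !nc_mul_cons H ?K /=; [|lia..].
congr (_ + _); apply: IH => v vl; rewrite /shift.
  by apply: H => /=; lia.
by apply: K => /=; lia.
Qed.

Lemma nc_mul_low_r (F D : series) (w : word) :
  (forall v, (length v < length w)%nat -> D v = 0) ->
  (F * D)%nc w = F [] * D w.
Proof.
case: w F => [|i w] F H; first by rewrite nc_mul_nil.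
rewrite nc_mul_cons.
suff -> : (shift i F * D)%nc w = 0 by ring.
have -> : (shift i F * D)%nc w = (shift i F * nc_zero)%nc w.
  by apply: nc_mul_ext => // v vl; apply: H => /=; lia.
elim: w (shift i F) {H} => [|k w IH] G; first by rewrite nc_mul_nil /nc_zero; ring.
by rewrite nc_mul_cons IH /nc_zero; ring.
Qed.

(** Factors with constant term 1 act as the identity on the lowest-degree part of [A - B]. This
    drives all uniqueness arguments: at the first word where two products may differ, they differ by
    as much as their middle factors. *)
Lemma nc_minus_low (F A B H : series) (w : word) :
  F [] = 1 -> H [] = 1 ->
  (forall v, (length v < length w)%nat -> A v = B v) ->
  (F * A * H)%nc w - (F * B * H)%nc w = A w - B w.
Proof.
move=> F1 H1 AB.
pose D := (A + (-1) *: B)%nc.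
have D0 v : (length v < length w)%nat -> D v = 0.
  by move=> vl; rewrite /D /nc_add /nc_scale AB //; ring.
have FD v : (length v <= length w)%nat -> (F * D)%nc v = D v.
  move=> vl; rewrite nc_mul_low_r ?F1; first ring.
  by move=> u ul; apply: D0; lia.
have e : (F * D * H)%nc w = D w.
  rewrite nc_mul_low_l; first by rewrite FD // H1; ring.
  by move=> v vl; rewrite FD ?D0 //; lia.
have e2 : (F * D * H)%nc w = (F * A * H)%nc w - (F * B * H)%nc w.
  rewrite -!nc_mul_assoc.
  have -> : (D * H = (A * H) + (-1) *: (B * H))%nc.
    apply: series_ext => v.
    by rewrite nc_mul_plus_l nc_mul_scale_l.
  by rewrite nc_mul_plus_r nc_mul_scale_r; ring.
by rewrite -e2 e /D /nc_add /nc_scale; ring.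
Qed.

Lemma nc_pow_low (N : series) (k : nat) (w : word) :
  N [] = 0 -> (length w < k)%nat -> nc_pow N k w = 0.
Proof.
move=> N0; elim: k w => [|k IH] w wk; first lia.
rewrite /=; case: w wk => [|i w] /= wk; first by rewrite nc_mul_nil N0; ring.
rewrite nc_mul_cons N0 (nc_mul_ext _ (shift i N) _ nc_zero) //.
  rewrite nc_mul_low_r //; rewrite /nc_zero; ring.
by move=> v vl; apply: IH; lia.
Qed.

Lemma nc_mul_inv_r (F : series) : F [] = 1 -> (F * nc_inv F = nc_one)%nc.
Proof.
move=> F1; apply: series_ext => w.
pose N := (nc_one + (- / F []) *: F)%nc.
have N0 : N [] = 0.
  by rewrite /N /nc_add /nc_scale F1 /nc_one /mono /=; field.
have FN : F = (nc_one + (-1) *: N)%nc.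
  apply: series_ext => v.
  by rewrite /N /nc_add /nc_scale F1; field.
pose S n : series := fun v => sum_n (fun k => nc_pow N k v) n.
(* The truncation at [length v] may be replaced by any longer one, since N^k has no term of degree
   below k. One partial sum thus serves all the short words occurring in the product. *)
have invE v n : (length v <= n)%nat -> nc_inv F v = S n v.
  move=> vn; rewrite /nc_inv -/N F1 /S.
  have -> : / 1 * sum_n (fun k => nc_pow N k v) (length v)
     = sum_n (fun k => nc_pow N k v) (length v) by field.
  elim: n vn => [|n IH] vn; first by have -> : length v = O by lia.
  have [vn'|->] : (length v <= n)%nat \/ length v = Datatypes.S n by lia.
    rewrite sum_Sn -IH // nc_pow_low //; last lia.
    by C_ring.
  by [].
(* Telescoping of the geometric series: N (1 + ... + N^n) = (1 + ... + N^(n+1)) - 1. *)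
have NS n v : (N * S n)%nc v = S (Datatypes.S n) v - nc_one v.
  elim: n v => [|n IH] v.
    rewrite /S sum_Sn !sum_O /= /plus /=.
    rewrite (nc_mul_ext N N (fun v0 => sum_n (fun k => nc_pow N k v0) 0) nc_one) //.
      ring.
    by move=> u _; rewrite sum_O.
  have -> : S (Datatypes.S n) = (S n + nc_pow N (Datatypes.S n))%nc.
    by apply: series_ext => u; rewrite /S sum_Sn.
  rewrite nc_mul_plus_r IH.
  rewrite /S (sum_Sn (fun k => nc_pow N k v) (Datatypes.S n)).
  C_ring.
rewrite (nc_mul_ext F F (nc_inv F) (S (length w))) //; last by move=> v; apply: invE.
rewrite FN nc_mul_plus_l nc_mul_scale_l nc_mul_1_l NS.
have -> : S (Datatypes.S (length w)) w = S (length w) w.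
  by rewrite -!invE //; lia.
ring.
Qed.

Lemma nc_inv_nil (F : series) : F [] = 1 -> nc_inv F [] = 1.
Proof.
move=> F1; have := f_equal (fun G => G []) (nc_mul_inv_r F F1).
by rewrite nc_mul_nil F1 /nc_one /mono /= => <-; ring.
Qed.

(** The right inverse of [nc_inv F] is [nc_inv (nc_inv F)], and associativity identifies it with
    [F]. *)
Lemma nc_mul_inv_l (F : series) : F [] = 1 -> (nc_inv F * F = nc_one)%nc.
Proof.
move=> F1.
have e := nc_mul_inv_r F F1.
have e2 := nc_mul_inv_r (nc_inv F) (nc_inv_nil F F1).
have e3 : nc_inv (nc_inv F) = F.
  by rewrite -{2}(nc_mul_1_r F) -e2 nc_mul_assoc e nc_mul_1_l.
by rewrite -{2}e3.
Qed.

(** * Characters of the shuffle algebra *)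

(** Words of a given length and shuffles are both lists, with multiplicity; one sum over lists and
    one exchange lemma [lsum_swap] serve for both. *)
Definition lsum {A : Type} (l : list A) (f : A -> C) : C :=
  fold_right Cplus 0 (map f l).

Lemma lsum_cons {A} (a : A) l f : lsum (a :: l) f = f a + lsum l f.
Proof. by []. Qed.

Lemma lsum_app {A} (l m : list A) f : lsum (l ++ m) f = lsum l f + lsum m f.
Proof.
elim: l => [|a l IH]; first by rewrite /lsum /=; ring.
by rewrite -app_comm_cons !lsum_cons IH; ring.
Qed.

Lemma lsum_map {A B} (g : A -> B) l f : lsum (map g l) f = lsum l (fun a => f (g a)).
Proof. by rewrite /lsum map_map. Qed.

Lemma lsum_ext_in {A} (l : list A) (f g : A -> C) :
  (forall a, In a l -> f a = g a) -> lsum l f = lsum l g.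
Proof. by move=> H; rewrite /lsum (map_ext_in _ _ _ H). Qed.

Lemma lsum_ext {A} (l : list A) (f g : A -> C) :
  (forall a, f a = g a) -> lsum l f = lsum l g.
Proof. by move=> H; apply: lsum_ext_in. Qed.

Lemma lsum_0 {A} (l : list A) (f : A -> C) : (forall a, In a l -> f a = 0) -> lsum l f = 0.
Proof.
elim: l => [|a l IH] H //; rewrite lsum_cons H ?IH; [ring| |by left].
by move=> b bl; apply: H; right.
Qed.

Lemma lsum_plus {A} (l : list A) (f g : A -> C) :
  lsum l (fun a => f a + g a) = lsum l f + lsum l g.
Proof.
elim: l => [|a l IH]; first by rewrite /lsum /=; ring.
by rewrite !lsum_cons IH; ring.
Qed.

Lemma lsum_scal {A} (l : list A) (c : C) (f : A -> C) : lsum l (fun a => c * f a) = c * lsum l f.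
Proof.
elim: l => [|a l IH]; first by rewrite /lsum /=; ring.
by rewrite !lsum_cons IH; ring.
Qed.

Lemma lsum_scal_r {A} (l : list A) (c : C) (f : A -> C) : lsum l (fun a => f a * c) = lsum l f * c.
Proof.
by rewrite -(Cmult_comm c) -lsum_scal; apply: lsum_ext => a; ring.
Qed.

Lemma lsum_swap {A B} (l : list A) (m : list B) (f : A -> B -> C) :
  lsum l (fun a => lsum m (f a)) = lsum m (fun b => lsum l (fun a => f a b)).
Proof.
elim: l => [|a l IH]; first by rewrite [RHS]lsum_0.
by rewrite lsum_cons IH -lsum_plus.
Qed.

Lemma sum_wordsE n g : sum_words n g = lsum (words n) g.
Proof. by []. Qed.

Lemma sum_words_S n g :
  sum_words (S n) g =
  sum_words n (fun w => g (x0 :: w)) + sum_words n (fun w => g (x1 :: w)).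
Proof. by rewrite !sum_wordsE /= lsum_app !lsum_map. Qed.

(** The value at the shuffle of [u] and [v] of [F] regarded as a linear form on words; by [coprodE]
    this is the coefficient of [u (x) v] in the coproduct of [F]. *)
Definition shf (F : series) (u v : word) : C := lsum (shuffle_word u v) F.

Lemma shuffle_word_nil_l v : shuffle_word [] v = [v].
Proof. by case: v. Qed.

Lemma shuffle_word_nil_r u : shuffle_word u [] = [u].
Proof. by case: u. Qed.

Lemma shf_nil_l F v : shf F [] v = F v.
Proof. by rewrite /shf shuffle_word_nil_l /lsum /=; ring. Qed.

Lemma shf_nil_r F u : shf F u [] = F u.
Proof. by rewrite /shf shuffle_word_nil_r /lsum /=; ring. Qed.

Lemma shf_cons F i s j t :
  shf F (i :: s) (j :: t) =
  shf (shift i F) s (j :: t) + shf (shift j F) (i :: s) t.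
Proof. by rewrite /shf /= lsum_app !lsum_map. Qed.

Lemma shf_plus F G s t : shf (F + G)%nc s t = shf F s t + shf G s t.
Proof. exact: lsum_plus. Qed.

Lemma shf_scale a F s t : shf (a *: F)%nc s t = a * shf F s t.
Proof. exact: lsum_scal. Qed.

(** The shuffle product is symmetric under reversal of words, although its recursion reads first
    letters. The form for last letters is needed because the equation of [Lhat] also multiplies by
    X_0 on the right. *)
Lemma shf_rcons F i s j t :
  shf F (s ++ [i]) (t ++ [j]) =
  shf (rshift i F) s (t ++ [j]) + shf (rshift j F) (s ++ [i]) t.
Proof.
elim: s t F => [|i' s IHs]; elim=> [|j' t IHt] F /=.
- by rewrite shf_cons !(shf_nil_l, shf_nil_r); rewrite /shift /rshift /=; ring.
- rewrite shf_cons IHt !(shf_nil_l, shf_nil_r) (shf_cons _ i [] j' t) !shf_nil_l.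
  by rewrite /shift /rshift /=; ring.
- rewrite shf_cons (IHs []) !(shf_nil_l, shf_nil_r) (shf_cons _ i' s j []) !shf_nil_r.
  by rewrite /shift /rshift /=; ring.
- rewrite shf_cons (IHs (j' :: t)) IHt (shf_cons _ i' s j' (t ++ [j])).
  rewrite (shf_cons _ i' (s ++ [i]) j' t).
  by rewrite /shift /rshift /=; ring.
Qed.

(** The grouplike condition in dual form ([grouplikeE]), free of sums over words. *)
Definition character (F : series) : Prop :=
  F [] = 1 /\ forall s t, shf F s t = F s * F t.

Lemma tens_mul_nil_l A B t : tens_mul A B [] t = nc_mul (A []) (B []) t.
Proof. by rewrite /tens_mul sum_O. Qed.

Lemma tens_mul_cons_l A B i s t :
  tens_mul A B (i :: s) t =
  nc_mul (A []) (B (i :: s)) t + tens_mul (fun u => A (i :: u)) B s t.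
Proof. by rewrite /tens_mul sum_n_Sl. Qed.

Lemma tens_mul_nil_r A B s :
  tens_mul A B s [] = nc_mul (fun u => A u []) (fun u => B u []) s.
Proof.
elim: s A => [|i s IH] A; first by rewrite tens_mul_nil_l !nc_mul_nil.
by rewrite tens_mul_cons_l nc_mul_nil nc_mul_cons IH.
Qed.

Lemma tens_mul_cons_r A B s j t :
  tens_mul A B s (j :: t) =
  nc_mul (fun u => A u []) (fun u => B u (j :: t)) s +
  tens_mul (fun u v => A u (j :: v)) B s t.
Proof.
elim: s A => [|i s IH] A.
  by rewrite !tens_mul_nil_l nc_mul_cons nc_mul_nil.
rewrite !tens_mul_cons_l IH !nc_mul_cons /shift; ring.
Qed.

Lemma tens_mul_plus_l A A' B s t :
  tens_mul (tens_add A A') B s t =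
  tens_mul A B s t + tens_mul A' B s t.
Proof.
elim: s A A' => [|i s IH] A A'.
  by rewrite !tens_mul_nil_l -nc_mul_plus_l.
rewrite !tens_mul_cons_l -[tens_add A A' []]/(nc_add (A []) (A' [])) nc_mul_plus_l.
by rewrite (IH (fun u => A (i :: u)) (fun u => A' (i :: u))); ring.
Qed.

Lemma tens_mul_tens F G B s t :
  tens_mul (tens F G) B s t = nc_mul F (fun u => nc_mul G (B u) t) s.
Proof.
elim: s F => [|i s IH] F.
  rewrite tens_mul_nil_l nc_mul_nil -nc_mul_scale_l //.
rewrite tens_mul_cons_l nc_mul_cons -nc_mul_scale_l; congr (_ + _).
exact: (IH (shift i F)).
Qed.

Opaque nc_mul tens_mul.

(** Multiplicativity of the coproduct, read through [coprodE]. Both sides obey the same recursion in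
    the first letters of [s] and [t], because [shift] satisfies a Leibniz rule twisted by the
    constant term ([shift_mul]). *)
Lemma shf_mul F G s t :
  shf (F * G)%nc s t = tens_mul (shf F) (shf G) s t.
Proof.
have nl H : shf H [] = H.
  by apply: series_ext => v; rewrite shf_nil_l.
elim: s t F => [|i s IHs]; first by move=> t F; rewrite shf_nil_l tens_mul_nil_l !nl.
elim=> [|j t IHt] F.
  rewrite shf_nil_r tens_mul_nil_r; apply: nc_mul_ext => v _; by rewrite shf_nil_r.
rewrite shf_cons !shift_mul 2!shf_plus !shf_scale IHs IHt. 
rewrite (tens_mul_cons_l (shf F)) nl nc_mul_cons shf_cons.
rewrite !(tens_mul_cons_r _ _ _ j t).
rewrite (tens_mul_cons_l (shf (shift j F))) nl.
have -> : (fun (u : word) (v : word) => shf F (i :: u) (j :: v)) =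
          tens_add (fun (u : word) (v : word) => shf (shift i F) u (j :: v))
            (fun u : word => shf (shift j F) (i :: u)).
  by apply functional_extensionality => u; apply: series_ext => v;
     rewrite /tens_add shf_cons.
rewrite tens_mul_plus_l.
have -> : (fun u : word => shf F (i :: u) []) = (fun u : word => shf (shift i F) u []).
  by apply: series_ext => u; rewrite !shf_nil_r.
move: (nc_mul _ _ s) (nc_mul _ _ t) (tens_mul _ _ s t) (tens_mul _ _ s t).
by move: (shf _ s (j :: t)) (shf _ (i :: s) t) => *; ring.
Qed.

Lemma character_mul F G : character F -> character G -> character (F * G)%nc.
Proof.
move=> [F1 Fs] [G1 Gs]; split; first by rewrite nc_mul_nil F1 G1; ring.
move=> s t; rewrite shf_mul.
have E H : (forall s t, shf H s t = H s * H t) -> shf H = tens H H.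
  by move=> Hs; apply functional_extensionality => u;
     apply: series_ext => v.
rewrite (E F Fs) (E G Gs) tens_mul_tens.
rewrite (nc_mul_ext _ F _ ((F * G)%nc t *: G)%nc) //.
  by rewrite nc_mul_scale_r; ring.
move=> v _; rewrite /nc_scale Cmult_comm -nc_mul_scale_r //.
Qed.

(** Since X_i is primitive, the first letter of the word becomes the first letter of exactly one of
    the two tensor factors. *)
Lemma coprod_word_cons i w u v :
  coprod_word (i :: w) u v =
  match u with
  | [] => 0
  | k :: u' => if letter_eq_dec k i then coprod_word w u' v else 0
  end +
  match v with
  | [] => 0
  | k :: v' => if letter_eq_dec k i then coprod_word w u v' else 0
  end.
Proof.
rewrite /= /tens_add tens_mul_plus_l !tens_mul_tens nc_mul_1_l Cplus_comm.
congr (_ + _).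
  rewrite (nc_mul_ext _ (mono [i]) _ (fun u => coprod_word w u v)) //; last first.
    by move=> u' _; rewrite nc_mul_1_l.
  by case: u => [|k u]; rewrite ?mono_letter_mul_nil ?mono_letter_mul_cons.
by case: v => [|k v]; rewrite ?mono_letter_mul_nil ?mono_letter_mul_cons.
Qed.

Lemma sum_words_ext n (f g : word -> C) : (forall w, f w = g w) -> sum_words n f = sum_words n g.
Proof. exact: lsum_ext. Qed.

Lemma sum_words_plus n (f g : word -> C) :
  sum_words n (fun w => f w + g w) = sum_words n f + sum_words n g.
Proof. exact: lsum_plus. Qed.

Lemma sum_words_0 n (f : word -> C) : (forall w, f w = 0) -> sum_words n f = 0.
Proof. by move=> H; apply: lsum_0. Qed.

Lemma sum_words_cons_match n i (F : series) (K : word -> C) :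
  sum_words n (fun w => F (x0 :: w) * (if letter_eq_dec i x0 then K w else 0)) +
  sum_words n (fun w => F (x1 :: w) * (if letter_eq_dec i x1 then K w else 0)) =
  sum_words n (fun w => shift i F w * K w).
Proof.
rewrite -sum_words_plus; apply: sum_words_ext => w.
by case: i; rewrite /shift /=; ring.
Qed.

Lemma Cplus_interchange (a b c d : C) : a + b + (c + d) = a + c + (b + d).
Proof. ring. Qed.

(** Duality of coproduct and shuffle product: both recursions hand the first letter of the word to
    one of the two factors. *)
Lemma coprodE F u v : coprod F u v = shf F u v.
Proof.
elim: u v F => [|i u IHu]; elim=> [|j v IHv] F; rewrite /coprod.
- by rewrite shf_nil_l /sum_words /= /tens /nc_one /mono /=; ring.
- rewrite /= sum_words_S.
  rewrite (sum_words_ext _ _ (fun w => F (x0 :: w) *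
    (if letter_eq_dec j x0 then coprod_word w [] v else 0))); last first.
    by move=> w; rewrite coprod_word_cons; ring.
  rewrite (sum_words_ext _ (fun w => F (x1 :: w) * _) (fun w => F (x1 :: w) *
    (if letter_eq_dec j x1 then coprod_word w [] v else 0))); last first.
    by move=> w; rewrite coprod_word_cons; ring.
  rewrite sum_words_cons_match -[sum_words _ _]/(coprod (shift j F) [] v) IHv.
  by rewrite !shf_nil_l.
- rewrite /= sum_words_S.
  rewrite (sum_words_ext _ _ (fun w => F (x0 :: w) *
    (if letter_eq_dec i x0 then coprod_word w u [] else 0))); last first.
    by move=> w; rewrite coprod_word_cons; ring.
  rewrite (sum_words_ext _ (fun w => F (x1 :: w) * _) (fun w => F (x1 :: w) *
    (if letter_eq_dec i x1 then coprod_word w u [] else 0))); last first.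
    by move=> w; rewrite coprod_word_cons; ring.
  rewrite sum_words_cons_match -[sum_words _ _]/(coprod (shift i F) u []) IHu.
  by rewrite !shf_nil_r.
- rewrite /= sum_words_S.
  rewrite (sum_words_ext _ _ (fun w =>
    F (x0 :: w) * (if letter_eq_dec i x0 then coprod_word w u (j :: v) else 0) +
    F (x0 :: w) * (if letter_eq_dec j x0 then coprod_word w (i :: u) v else 0)));
    last by move=> w; rewrite coprod_word_cons; ring.
  rewrite (sum_words_ext _ (fun w => F (x1 :: w) * _) (fun w =>
    F (x1 :: w) * (if letter_eq_dec i x1 then coprod_word w u (j :: v) else 0) +
    F (x1 :: w) * (if letter_eq_dec j x1 then coprod_word w (i :: u) v else 0)));
    last by move=> w; rewrite coprod_word_cons; ring.
  rewrite !sum_words_plus.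
  transitivity (coprod (shift i F) u (j :: v) + coprod (shift j F) (i :: u) v).
    rewrite Cplus_interchange !sum_words_cons_match /coprod /=.
    by rewrite (_ : (length u + S (length v) = S (length u + length v))%nat) //; lia.
  by rewrite IHu IHv shf_cons.
Qed.

Lemma grouplikeE F : grouplike F <-> character F.
Proof.
rewrite /grouplike /counit /character; split=> -[F1 H]; split=> //.
  by move=> s t; rewrite -coprodE H.
by apply functional_extensionality => u; apply: series_ext => v;
  rewrite coprodE H.
Qed.

(** * Pairing series with polynomials *)

Lemma sum_n_lsum (f : nat -> C) (n : nat) : sum_n f n = lsum (seq 0 (S n)) f.
Proof.
elim: n f => [|n IH] f; first by rewrite sum_O /lsum /=; ring.
by rewrite sum_n_Sl IH -[seq 0 (S (S n))]/(0%nat :: seq 1 (S n)) lsum_cons -seq_shift lsum_map.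
Qed.

Lemma lsum_delta (A : Type) (dec : forall a b : A, {a = b} + {a <> b})
    (l : list A) (a : A) (g : A -> C) :
  NoDup l -> In a l -> lsum l (fun b => if dec b a then g b else 0) = g a.
Proof.
elim: l => [|b l IH] // nd; move: (NoDup_cons_iff b l) => -[/(_ nd) [bl nl] _].
rewrite lsum_cons => -[e|al].
  subst b; case: (dec a a) => // _.
  rewrite lsum_0; first ring.
  by move=> c cl; case: (dec c a) => // e; move: bl; rewrite -e.
case: (dec b a) => [e|_]; first by case: bl; rewrite e.
by rewrite IH //; ring.
Qed.

Lemma in_words (w : word) (n : nat) : In w (words n) <-> length w = n.
Proof.
elim: n w => [|n IH] w /=.
  by split=> [[<-|] //|]; case: w => //; left.
rewrite in_app_iff !in_map_iff; split.
  by case=> -[v [<- /IH /= ->]].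
case: w => [|[] w] //= [e]; [left|right]; exists w; split=> //; exact/IH.
Qed.

Lemma sum_words_ext_len n (f g : word -> C) :
  (forall w, length w = n -> f w = g w) -> sum_words n f = sum_words n g.
Proof. by move=> H; apply: lsum_ext_in => w /in_words; apply: H. Qed.

Lemma NoDup_words n : NoDup (words n).
Proof.
elim: n => [|n IH] /=; first by constructor; [case|constructor].
have inj i : FinFun.Injective (@cons letter i) by move=> u v [].
apply: NoDup_app; try exact: (FinFun.Injective_map_NoDup (inj _) IH).
by move=> w; rewrite !in_map_iff => -[u [<- _]] [v [[]]].
Qed.

Lemma sum_words_delta n v (g : word -> C) :
  length v = n ->
  sum_words n (fun w => if word_eq_dec w v then g w else 0) = g v.
Proof.
by move=> vn; apply: lsum_delta; [apply: NoDup_words|apply/in_words].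
Qed.

Lemma shuffle_word_length u v w :
  In w (shuffle_word u v) -> length w = (length u + length v)%nat.
Proof.
elim: u v w => [|i u IHu] v w; first by rewrite shuffle_word_nil_l => -[<-|].
elim: v w => [|j v IHv] w; first by move=> [<-|] //=; lia.
rewrite [shuffle_word _ _]/= in_app_iff !in_map_iff => -[] [w' [<- H]] /=.
  by rewrite (IHu _ _ H) /=; lia.
by rewrite (IHv _ H) /=; lia.
Qed.

Lemma sum_words_count F d L :
  (forall x, In x L -> length x = d) ->
  sum_words d (fun w => F w * INR (count_occ word_eq_dec L w)) = lsum L F.
Proof.
elim: L => [|x L IH] H.
  by rewrite sum_words_0 // => w /=; ring.
rewrite lsum_cons -IH; last by move=> y yL; apply: H; right.
rewrite -(sum_words_delta d x F); last by apply: H; left.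
rewrite -sum_words_plus; apply: sum_words_ext => w.
rewrite [count_occ _ _ _]/=; case: word_eq_dec => [e|ne]; case: word_eq_dec => [e'|ne'].
- by rewrite S_INR RtoC_plus; ring.
- by case: ne'.
- by case: ne.
- ring.
Qed.

(* [zeta] is the case F w = mzv (word_index w). *)
Definition pairing (F : series) (p : series) : C :=
  sum_n (fun n => sum_words n (fun w => p w * F w)) (degree_bound p).

Lemma degree_le_sum F p n m : degree_le p n -> (n <= m)%nat ->
  sum_n (fun k => sum_words k (fun w => p w * F w)) m =
  sum_n (fun k => sum_words k (fun w => p w * F w)) n.
Proof.
move=> pn; elim: m => [|m IH] nm; first by have -> : n = O by lia.
have [nm'|->//] : (n <= m)%nat \/ n = S m by lia.
rewrite sum_Sn IH // (sum_words_ext_len _ _ (fun _ => 0)) ?sum_words_0 //.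
  by rewrite /plus /= Cplus_0_r.
by move=> w wm; rewrite pn ?wm; [ring|lia].
Qed.

Lemma pairing_degree F p n : degree_le p n ->
  pairing F p = sum_n (fun k => sum_words k (fun w => p w * F w)) n.
Proof.
move=> pn; rewrite /pairing.
have bp : degree_le p (degree_bound p) by apply: epsilon_spec; exists n.
case: (Nat.le_ge_cases n (degree_bound p)) => h.
  exact: degree_le_sum.
by rewrite (degree_le_sum _ _ _ _ bp h).
Qed.

Lemma degree_le_mono_le p n m : degree_le p n -> (n <= m)%nat -> degree_le p m.
Proof. by move=> pn nm w wm; apply: pn; lia. Qed.

Lemma degree_le_lin a p q n :
  degree_le p n -> degree_le q n -> degree_le (a *: p + q)%nc n.
Proof. by move=> pn qn w wn; rewrite /nc_add /nc_scale pn // qn //; ring. Qed.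

Lemma is_poly_lin a p q : is_poly p -> is_poly q -> is_poly (a *: p + q)%nc.
Proof.
move=> [n pn] [m qm]; exists (n + m)%nat; apply: degree_le_lin.
  by apply: degree_le_mono_le pn _; lia.
by apply: degree_le_mono_le qm _; lia.
Qed.

Lemma pairing_lin F a p q : is_poly p -> is_poly q ->
  pairing F (a *: p + q)%nc = a * pairing F p + pairing F q.
Proof.
move=> [n pn] [m qm].
have pN := degree_le_mono_le _ _ (n + m) pn ltac:(lia).
have qN := degree_le_mono_le _ _ (n + m) qm ltac:(lia).
rewrite (pairing_degree _ _ _ pN) (pairing_degree _ _ _ qN).
rewrite (pairing_degree _ _ _ (degree_le_lin a _ _ _ pN qN)) !sum_n_lsum.
rewrite -lsum_scal -lsum_plus; apply: lsum_ext => k.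
rewrite -lsum_scal -lsum_plus; apply: lsum_ext => w.
by rewrite /nc_add /nc_scale; ring.
Qed.

Lemma degree_le_mono v : degree_le (mono v) (length v).
Proof. by move=> w wv; rewrite /mono; case: word_eq_dec => // e; subst; lia. Qed.

Lemma is_poly_mono v : is_poly (mono v).
Proof. by eexists; apply: degree_le_mono. Qed.

Lemma is_poly_zero : is_poly nc_zero.
Proof. by exists O. Qed.

Lemma pairing_mono F v : pairing F (mono v) = F v.
Proof.
rewrite (pairing_degree _ _ _ (degree_le_mono v)) sum_n_lsum.
rewrite -[RHS](lsum_delta nat Nat.eq_dec (seq 0 (S (length v))) (length v) (fun _ => F v)).
- apply: lsum_ext => k; case: Nat.eq_dec => [->|ne].
    rewrite -(sum_words_delta (length v) v F) //; apply: sum_words_ext => w.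
    by rewrite /mono; case: word_eq_dec => _; ring.
  rewrite (sum_words_ext_len _ _ (fun _ => 0)) ?sum_words_0 // => w wk.
  by rewrite /mono; case: word_eq_dec => [e|_]; [subst; case: ne|ring].
- exact: seq_NoDup.
- by apply/in_seq; lia.
Qed.

Lemma pairing_ext F G p : is_poly p ->
  (forall w, p w <> 0 -> F w = G w) -> pairing F p = pairing G p.
Proof.
move=> [n pn] H; rewrite !(pairing_degree _ _ _ pn).
apply: sum_n_ext => k; apply: sum_words_ext => w.
case: (excluded_middle_informative (p w = 0)) => [->|/H -> //]; ring.
Qed.

Lemma sum_n_triangle (G : nat -> nat -> C) N :
  sum_n (fun d => sum_n (fun k => G k (d - k)%nat) d) N =
  sum_n (fun k => sum_n (fun l => G k l) (N - k)) N.
Proof.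
elim: N => [|N IH]; first by rewrite !sum_O.
rewrite sum_Sn IH [RHS]sum_Sn Nat.sub_diag sum_O sum_Sn Nat.sub_diag.
rewrite plus_assoc; congr plus; rewrite -sum_n_plus.
apply: sum_n_ext_loc => k kN.
by rewrite (_ : (S N - k = S (N - k))%nat); [rewrite sum_Sn|lia].
Qed.

Lemma sum_n_tail_0 (f : nat -> C) n m : (n <= m)%nat ->
  (forall k, (n < k)%nat -> f k = 0) -> sum_n f m = sum_n f n.
Proof.
move=> nm f0; elim: m nm => [|m IH] nm; first by have -> : n = O by lia.
have [nm'|->//] : (n <= m)%nat \/ n = S m by lia.
by rewrite sum_Sn IH // f0 ?/plus /= ?Cplus_0_r //; lia.
Qed.

Lemma degree_le_shuffle p q n m :
  degree_le p n -> degree_le q m -> degree_le (shuffle p q) (n + m).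
Proof.
move=> pn qm w wl; rewrite /shuffle sum_n_lsum lsum_0 // => k _.
apply: lsum_0 => u /in_words uk; apply: lsum_0 => v /in_words vk.
have [nu|mv] : (n < length u)%nat \/ (m < length v)%nat by lia.
  by rewrite pn //; ring.
by rewrite qm //; ring.
Qed.

Lemma is_poly_shuffle p q : is_poly p -> is_poly q -> is_poly (shuffle p q).
Proof. by move=> [n pn] [m qm]; eexists; apply: degree_le_shuffle pn qm. Qed.

(** Summing the multiplicities in the shuffle over all words gives [shf F u v], which factors
    because [F] is a character; what remains is a Cauchy product of two finite sums. *)
Lemma pairing_shuffle F p q : character F -> is_poly p -> is_poly q ->
  pairing F (shuffle p q) = pairing F p * pairing F q.
Proof.
move=> [_ Fs] [n pn] [m qm].
rewrite (pairing_degree _ _ _ pn) (pairing_degree _ _ _ qm).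
rewrite (pairing_degree _ _ _ (degree_le_shuffle _ _ _ _ pn qm)).
pose P k := sum_words k (fun w => p w * F w).
pose Q k := sum_words k (fun w => q w * F w).
transitivity (sum_n (fun d => sum_n (fun k => P k * Q (d - k)%nat) d) (n + m)).
  apply: sum_n_ext => d.
  transitivity (sum_words d (fun w => lsum (seq 0 (S d)) (fun k =>
    sum_words k (fun u => sum_words (d - k) (fun v =>
     p u * q v * INR (count_occ word_eq_dec (shuffle_word u v) w) * F w))))).
    apply: sum_words_ext_len => w wd; rewrite /shuffle sum_n_lsum wd -lsum_scal_r.
    apply: lsum_ext => k; rewrite -lsum_scal_r; apply: lsum_ext => u.
    by rewrite -lsum_scal_r.
  rewrite sum_n_lsum [LHS]lsum_swap; apply: lsum_ext_in => k /in_seq kd.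
  rewrite lsum_swap [RHS]Cmult_comm -lsum_scal; apply: lsum_ext_in => u /in_words ul.
  rewrite lsum_swap Cmult_comm -lsum_scal; apply: lsum_ext_in => v /in_words vl.
  transitivity (p u * q v * sum_words d (fun w =>
     F w * INR (count_occ word_eq_dec (shuffle_word u v) w))).
    by rewrite -lsum_scal; apply: lsum_ext => w; ring.
  rewrite sum_words_count; first by rewrite -[lsum _ _]/(shf F u v) Fs; ring.
  by move=> x /shuffle_word_length ->; lia.
(* Reindexed by the degrees of both factors, the sum runs over a triangle; as the terms vanish
   beyond [n] and [m], it is the sum over a rectangle. *)
rewrite (sum_n_triangle (fun k l => P k * Q l)).
have P0 k : (n < k)%nat -> P k = 0.
  move=> nk; apply: lsum_0 => w /in_words wk; rewrite pn; [ring|lia].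
have Q0 k : (m < k)%nat -> Q k = 0.
  move=> nk; apply: lsum_0 => w /in_words wk; rewrite qm; [ring|lia].
rewrite (sum_n_tail_0 _ n); [|lia|]; last first.
  by move=> k nk; rewrite sum_n_lsum lsum_0 // => l _; rewrite P0 //; ring.
rewrite (sum_n_ext_loc _ (fun k => P k * sum_n Q m)); last first.
  move=> k kn; rewrite (sum_n_tail_0 _ m); [|lia|]; last first.
    by move=> l ml; rewrite Q0 //; ring.
  by rewrite !sum_n_lsum lsum_scal.
by rewrite !sum_n_lsum lsum_scal_r.
Qed.

(** * The regularizing map *)

Definition S10_word (v : word) : Prop := v = [] \/ exists u, v = x0 :: u ++ [x1].

Lemma in_S10_poly p : in_S10 p -> is_poly p.
Proof.
move=> [c [q [[n qn] ->]]].
exists (S (S n)) => w wn; rewrite /nc_add /nc_scale.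
case: w wn => [|i w] /= wn; first lia.
rewrite nc_one_cons.
have -> : (mono [x0] * q * mono [x1])%nc (i :: w) = 0; last ring.
case: (@exists_last _ (i :: w)) => // v [j e]; rewrite e.
rewrite mul_mono_letter_rcons; case: letter_eq_dec => // _.
case: v e => [|k v] e; first by rewrite mono_letter_mul_nil.
rewrite mono_letter_mul_cons; case: letter_eq_dec => // _; apply: qn.
by move: (f_equal (@length _) e); rewrite /= length_app /=; lia.
Qed.

Lemma in_S10_support p w : in_S10 p -> p w <> 0 -> S10_word w.
Proof.
move=> [c [q [_ ->]]]; rewrite /nc_add /nc_scale.
case: w => [|i w]; first by left.
rewrite nc_one_cons => H; right; case: (@exists_last _ (i :: w)) => // v [j e].
move: H; rewrite e mul_mono_letter_rcons.
case: letter_eq_dec => [->|_]; last by case; ring.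
case: v e => [|k v] e; first by rewrite mono_letter_mul_nil; case; ring.
rewrite mono_letter_mul_cons; case: letter_eq_dec => [->|_]; last by case; ring.
by move=> _; exists v.
Qed.

Lemma in_S10_lin a p q : in_S10 p -> in_S10 q -> in_S10 (a *: p + q)%nc.
Proof.
move=> [c [r [rp ->]]] [d [s [sp ->]]]; exists (a * c + d), (a *: r + s)%nc.
split; first exact: is_poly_lin.
have -> : (mono [x0] * (a *: r + s) =
           a *: (mono [x0] * r) + mono [x0] * s)%nc.
  by apply: series_ext => w; rewrite nc_mul_plus_r nc_mul_scale_r.
apply: series_ext => w.
rewrite /nc_add /nc_scale
  -[fun w => _]/(nc_add (nc_scale a (nc_mul (mono [x0]) r)) (nc_mul (mono [x0]) s)).
by rewrite nc_mul_plus_l nc_mul_scale_l; ring.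
Qed.

Lemma in_S10_zero : in_S10 nc_zero.
Proof.
exists 0, nc_zero; split; first exact: is_poly_zero.
have z w : (mono [x0] * nc_zero)%nc w = 0.
  by rewrite nc_mul_low_r //; rewrite /nc_zero; ring.
apply: series_ext => w.
rewrite /nc_add /nc_scale shift_zero_mul //; rewrite /nc_zero; ring.
Qed.

Lemma in_S10_mono v0 : S10_word v0 -> in_S10 (mono v0).
Proof.
move=> [->|[u ->]].
  exists 1, nc_zero; split; first exact: is_poly_zero.
  have z w : (mono [x0] * nc_zero)%nc w = 0.
    by rewrite nc_mul_low_r //; rewrite /nc_zero; ring.
  apply: series_ext => w.
  by rewrite /nc_add /nc_scale shift_zero_mul // /nc_one; ring.
exists 0, (mono u); split; first exact: is_poly_mono.
apply: series_ext => w; rewrite /nc_add /nc_scale.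
case: w => [|i w]; first by rewrite mul_mono_letter_nil /mono /=; ring.
case: (@exists_last _ (i :: w)) => // v [j e]; rewrite e mul_mono_letter_rcons.
have monoE (a b a' b' : letter) (v' : word) :
    mono (a :: u ++ [b]) (a' :: v' ++ [b']) =
    if letter_eq_dec b' b then if letter_eq_dec a' a then mono u v' else 0 else 0.
  rewrite /mono; case: letter_eq_dec => [<-|ne]; last first.
    case: word_eq_dec => // e'; case: ne.
    by have [] := app_inj_tail (a' :: v') (a :: u) b' b e'.
  case: letter_eq_dec => [<-|ne]; last by case: word_eq_dec => // -[].
  case: word_eq_dec => [e'|ne]; case: word_eq_dec => // ne'.
    by have [[/ne']] := app_inj_tail (a' :: v') (a' :: u) b' b' e'.
  by case: ne; rewrite ne'.
case: v e => [|k v] e.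
  rewrite mono_letter_mul_nil /mono; case: word_eq_dec => [|_].
    by case: (u) => [|??].
  by case: letter_eq_dec => _; ring.
rewrite -app_comm_cons monoE mono_letter_mul_cons.
case: letter_eq_dec => _; last ring.
by case: letter_eq_dec => _; ring.
Qed.

(* [shf3 F i v j] is the value of [F] on xi_1^i sh v sh xi_0^j. *)
Definition shf3 (F : series) (i : nat) (v : word) (j : nat) : C :=
  lsum (shuffle_word (repeat x1 i) v) (fun u => shf F u (repeat x0 j)).

Record term := Term
  { coef : C; deg1 : nat; core : word; deg0 : nat }.

(* Identities between polynomials are expressed by evaluating all series, which
   here are arbitrary linear forms on polynomials. *)
Definition decomposable (phi : series -> C) : Prop :=
  exists l : list term, (forall e, In e l -> S10_word (core e)) /\
  forall F, phi F =
    lsum l (fun e => coef e * shf3 F (deg1 e) (core e) (deg0 e)).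

(** With [a = 0] this also serves as extensionality for decomposable forms. *)
Lemma decomposable_lin a phi psi chi :
  decomposable phi -> decomposable psi ->
  (forall F, chi F = phi F + a * psi F) -> decomposable chi.
Proof.
move=> [l [lS Hl]] [m [mS Hm]] H.
exists (l ++ map (fun e => Term (a * coef e) (deg1 e) (core e) (deg0 e)) m).
split=> [e /in_app_iff [/lS //|/in_map_iff [e' [<- /mS //]]]|F].
rewrite H lsum_app lsum_map Hl Hm -lsum_scal; congr (_ + _).
by apply: lsum_ext => e /=; ring.
Qed.

Lemma decomposable_lsum {A} (l : list A) (phi : A -> series -> C) :
  (forall a, In a l -> decomposable (phi a)) ->
  decomposable (fun F => lsum l (fun a => phi a F)).
Proof.
elim: l => [|a l IH] H; first by exists []; split.
apply: (decomposable_lin 1 (phi a) _ _ (H a (or_introl eq_refl)) (IH _)).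
  by move=> b bl; apply: H; right.
by move=> F; rewrite lsum_cons; ring.
Qed.

Lemma decomposable_single i v j : S10_word v ->
  decomposable (fun F => shf3 F i v j).
Proof.
move=> vS; exists [Term 1 i v j]; split=> [e [<- //|//]|F].
by rewrite /lsum /=; ring.
Qed.

(** The last letter of a shuffle is the last letter of one of its factors, and here both end in xi_1
    unless the power is empty. *)
Lemma shuffle_word_last w m y : (exists v, w = v ++ [x1]) ->
  In y (shuffle_word (repeat x1 m) w) -> exists v, y = v ++ [x1].
Proof.
move=> [v ->]; elim: m v y => [|m IHm] v y.
  by rewrite shuffle_word_nil_l => -[<-|//]; exists v.
elim: v y => [|i v IHv] y; rewrite [shuffle_word _ _]/= in_app_iff !in_map_iff.
  move=> -[[u [<- uin]]|[<-|//]].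
    by have [u' ->] := IHm [] u uin; exists (x1 :: u').
  by exists (x1 :: repeat x1 m); rewrite /= -repeat_cons.
move=> -[] [u [<- uin]].
  by have [u' ->] := IHm (i :: v) u uin; exists (x1 :: u').
by have [u' ->] := IHv u uin; exists (i :: u').
Qed.

(** Leading letters xi_1 are moved into the shuffle one at a time, by xi_1 (xi_1^m sh xi_0 s) =
    xi_1^(m+1) sh xi_0 s - xi_0 (xi_1^(m+1) sh s). Both terms on the right have one leading xi_1
    less, and [a = 0] is a term of the required shape. *)
Lemma decomposable_x1_power j a m s : (exists v, s = v ++ [x1]) ->
  decomposable (fun F => lsum (shuffle_word (repeat x1 m) (x0 :: s))
    (fun y => shf F (repeat x1 a ++ y) (repeat x0 j))).
Proof.
elim: a m s => [|a IH] m s sE.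
  by case: sE => v ->; apply: decomposable_single; right; exists v.
apply: (decomposable_lin (-1)
  (fun F => lsum (shuffle_word (repeat x1 (S m)) (x0 :: s))
    (fun y => shf F (repeat x1 a ++ y) (repeat x0 j)))
  (fun F => lsum (shuffle_word (repeat x1 (S m)) s)
    (fun y => lsum (shuffle_word (repeat x1 0) (x0 :: y))
      (fun y => shf F (repeat x1 a ++ y) (repeat x0 j))))).
- exact: IH.
- apply: decomposable_lsum => y yin; apply: IH.
  exact: shuffle_word_last sE yin.
move=> F.
have -> : shuffle_word (repeat x1 (S m)) (x0 :: s) =
  map (cons x1) (shuffle_word (repeat x1 m) (x0 :: s)) ++
  map (cons x0) (shuffle_word (repeat x1 (S m)) s) by [].
rewrite lsum_app !lsum_map.
rewrite (lsum_ext _ (fun y => shf F (repeat x1 (S a) ++ y) _)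
   (fun y => shf F (repeat x1 a ++ x1 :: y) (repeat x0 j))); last first.
  move=> y; congr shf.
  by rewrite -[repeat x1 (S a)]/(x1 :: repeat x1 a) repeat_cons -app_assoc.
rewrite (lsum_ext (shuffle_word _ s) (fun y => lsum _ _)
   (fun y => shf F (repeat x1 a ++ x0 :: y) (repeat x0 j))); last first.
  by move=> y; rewrite /lsum /=; ring.
rewrite /word; ring.
Qed.

Lemma decomposable_ends_x1 s j : (exists v, s = v ++ [x1]) ->
  decomposable (fun F => shf F s (repeat x0 j)).
Proof.
move=> sE.
have [[a e]|[a [t [e tE]]]] : (exists a, s = repeat x1 a) \/
    exists a t, s = repeat x1 a ++ x0 :: t /\ exists v, t = v ++ [x1].
  case: sE => v ->; elim: v => [|[] v [[a e]|[a [t [e tE]]]]].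
  - by left; exists 1%nat.
  - by right; exists O, (v ++ [x1]); split=> //; exists v.
  - by right; exists O, (v ++ [x1]); split=> //; exists v.
  - by left; exists (S a); rewrite /= e.
  - by right; exists (S a), t; rewrite /= e.
- apply: (decomposable_lin 0 _ _ _ (decomposable_single a [] j (or_introl eq_refl))
    (decomposable_single a [] j (or_introl eq_refl))) => F.
  by rewrite /shf3 shuffle_word_nil_r e /lsum /=; ring.
- have H := decomposable_x1_power j a 0 t tE.
  by apply: (decomposable_lin 0 _ _ _ H H) => F; rewrite e /lsum /=; ring.
Qed.

(** The mirror image for trailing letters xi_0: with s = s' xi_1, (s sh xi_0^m) xi_0 = s sh
    xi_0^(m+1) - (s' sh xi_0^(m+1)) xi_1. The words of the last term again end in xi_1, and [n] has
    decreased; [n = 0] leaves the leading letters xi_1 to be treated. *)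
Lemma decomposable_x0_power n m s : (exists v, s = v ++ [x1]) ->
  decomposable (fun F => lsum (shuffle_word s (repeat x0 m))
    (fun y => F (y ++ repeat x0 n))).
Proof.
elim: n m s => [|n IH] m s sE.
  have H := decomposable_ends_x1 s m sE.
  apply: (decomposable_lin 0 _ _ _ H H) => F.
  rewrite (lsum_ext _ _ F) ?/shf; first ring.
  by move=> y; rewrite app_nil_r.
case: sE => s' sE.
apply: (decomposable_lin (-1)
  (fun F => lsum (shuffle_word s (repeat x0 (S m))) (fun y => F (y ++ repeat x0 n)))
  (fun F => lsum (shuffle_word s' (repeat x0 (S m))) (fun y =>
     lsum (shuffle_word (y ++ [x1]) (repeat x0 0))
       (fun y => F (y ++ repeat x0 n))))).
- by apply: IH; exists s'.
- by apply: decomposable_lsum => y _; apply: IH; exists y.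
move=> F.
have -> : lsum (shuffle_word s (repeat x0 (S m))) (fun y => F (y ++ repeat x0 n)) =
   shf (fun y => F (y ++ repeat x0 n)) (s' ++ [x1]) (repeat x0 m ++ [x0]).
  by rewrite /shf sE; congr (lsum (shuffle_word _ _)); exact: repeat_cons.
rewrite shf_rcons.
rewrite -[repeat x0 m ++ [x0]]repeat_cons -sE.
rewrite (lsum_ext (shuffle_word s (repeat x0 m)) _
  (rshift x0 (fun y => F (y ++ repeat x0 n)))); last first.
  by move=> y; rewrite /rshift -app_assoc.
rewrite (lsum_ext (shuffle_word s' _) _
  (rshift x1 (fun y => F (y ++ repeat x0 n)))); last first.
  by move=> y; rewrite /rshift shuffle_word_nil_r /lsum /=; ring.
rewrite /shf -[x0 :: repeat x0 m]/(repeat x0 (S m)); ring.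
Qed.

Lemma decomposable_word w : decomposable (fun F => F w).
Proof.
have [n [s [e sE]]] : exists n s, w = s ++ repeat x0 n /\
    (s = [] \/ exists v, s = v ++ [x1]).
  elim/rev_ind: w => [|[] w [n [s [-> sE]]]].
  - by exists O, []; split=> //; left.
  - exists (S n), s; split=> //.
    by rewrite -app_assoc -[repeat x0 (S n)]/(x0 :: repeat x0 n) repeat_cons.
  - exists O, (s ++ repeat x0 n ++ [x1]); split; first by rewrite app_nil_r app_assoc.
    by right; exists (s ++ repeat x0 n); rewrite app_assoc.
case: sE => [se|sE].
  have H := decomposable_single 0 [] n (or_introl eq_refl).
  apply: (decomposable_lin 0 _ _ _ H H) => F.
  by rewrite /shf3 e se /= /lsum /= shf_nil_l; ring.
have H := decomposable_x0_power n 0 s sE.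
apply: (decomposable_lin 0 _ _ _ H H) => F.
by rewrite shuffle_word_nil_r /lsum /= e; ring.
Qed.

Lemma shuffle_lsum_l {A} (l : list A) (a : A -> C) (P : A -> series) q w :
  shuffle (fun v => lsum l (fun e => a e * P e v)) q w =
  lsum l (fun e => a e * shuffle (P e) q w).
Proof.
rewrite /shuffle sum_n_lsum.
transitivity (lsum l (fun e => lsum (seq 0 (S (length w))) (fun k =>
  lsum (words k) (fun u => lsum (words (length w - k)) (fun v =>
   a e * (P e u * q v * INR (count_occ word_eq_dec (shuffle_word u v) w))))))).
  rewrite lsum_swap; apply: lsum_ext => k.
  rewrite lsum_swap; apply: lsum_ext => u.
  rewrite lsum_swap; apply: lsum_ext => v.
  by rewrite -lsum_scal_r -lsum_scal_r; apply: lsum_ext => e; ring.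
apply: lsum_ext => e; rewrite sum_n_lsum -lsum_scal; apply: lsum_ext => k.
by rewrite -lsum_scal; apply: lsum_ext => u; rewrite -lsum_scal.
Qed.

Lemma shuffle_lsum_r {A} (l : list A) (a : A -> C) p (Q : A -> series) w :
  shuffle p (fun v => lsum l (fun e => a e * Q e v)) w =
  lsum l (fun e => a e * shuffle p (Q e) w).
Proof.
rewrite /shuffle sum_n_lsum.
transitivity (lsum l (fun e => lsum (seq 0 (S (length w))) (fun k =>
  lsum (words k) (fun u => lsum (words (length w - k)) (fun v =>
   a e * (p u * Q e v * INR (count_occ word_eq_dec (shuffle_word u v) w))))))).
  rewrite lsum_swap; apply: lsum_ext => k.
  rewrite lsum_swap; apply: lsum_ext => u.
  rewrite lsum_swap; apply: lsum_ext => v.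
  by rewrite -lsum_scal -lsum_scal_r; apply: lsum_ext => e; ring.
apply: lsum_ext => e; rewrite sum_n_lsum -lsum_scal; apply: lsum_ext => k.
by rewrite -lsum_scal; apply: lsum_ext => u; rewrite -lsum_scal.
Qed.

Lemma count_lsum (l : list word) w :
  INR (count_occ word_eq_dec l w) = lsum l (fun x => mono x w) :> C.
Proof.
elim: l => [|x l IH] //; rewrite lsum_cons -IH [count_occ _ _ _]/= /mono.
case: word_eq_dec => [e|ne]; case: word_eq_dec => [e'|ne'].
- by rewrite S_INR RtoC_plus; ring.
- by case: ne'.
- by case: ne.
- ring.
Qed.

Lemma sum_words_mono n v (g : word -> C) : length v = n ->
  sum_words n (fun w => mono v w * g w) = g v.
Proof.
move=> vn; rewrite -(sum_words_delta n v g vn); apply: sum_words_ext => w.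
by rewrite /mono; case: word_eq_dec => _; ring.
Qed.

Lemma sum_words_mono_ne n v (g : word -> C) : length v <> n ->
  sum_words n (fun w => mono v w * g w) = 0.
Proof.
move=> vn; apply: lsum_0 => w /in_words wn.
by rewrite /mono; case: word_eq_dec => [e|_]; [subst|ring].
Qed.

(** In the sum defining [shuffle], the monomials select the degree [length u] and the words [u] and
    [v]; if the lengths do not match, the multiplicity is 0 as well. *)
Lemma shuffle_mono u v w :
  shuffle (mono u) (mono v) w = lsum (shuffle_word u v) (fun x => mono x w).
Proof.
rewrite -count_lsum /shuffle sum_n_lsum.
pose c := RtoC (INR (count_occ word_eq_dec (shuffle_word u v) w)).
rewrite (lsum_ext _ _ (fun k =>
   if Nat.eq_dec k (length u) then
     (if Nat.eq_dec (length v) (length w - length u) then c else 0) else 0)); last first.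
  move=> k.
  rewrite (sum_words_ext _ _ (fun u' => mono u u' * sum_words (length w - k)
    (fun v' => mono v v' * INR (count_occ word_eq_dec (shuffle_word u' v') w)))); last first.
    move=> u'; rewrite -lsum_scal; apply: lsum_ext => v'; ring.
  case: Nat.eq_dec => [->|ne]; last by rewrite sum_words_mono_ne //; lia.
  rewrite sum_words_mono //; case: Nat.eq_dec => e.
    by rewrite sum_words_mono.
  by rewrite sum_words_mono_ne.
have c0 : (length w <> length u + length v)%nat -> c = 0.
  move=> ne; rewrite /c (proj1 (count_occ_not_In word_eq_dec _ _)) //.
  by move=> /shuffle_word_length.
rewrite -/c; case: (le_lt_dec (length u) (length w)) => h.
  rewrite (lsum_delta nat Nat.eq_dec _ _
    (fun _ => if Nat.eq_dec (length v) (length w - length u) then c else 0)).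
  - case: Nat.eq_dec => e //; rewrite c0 //; lia.
  - exact: seq_NoDup.
  - by apply/in_seq; lia.
rewrite c0; last lia.
apply: lsum_0 => k /in_seq kl; case: Nat.eq_dec => // e; lia.
Qed.

Lemma shuffle3_mono i v j w :
  shuffle (shuffle (mono (repeat x1 i)) (mono v)) (mono (repeat x0 j)) w =
  shf3 (fun u => mono u w) i v j.
Proof.
have -> : shuffle (mono (repeat x1 i)) (mono v) =
   fun u => lsum (shuffle_word (repeat x1 i) v) (fun x => 1 * mono x u).
  apply: series_ext => u; rewrite shuffle_mono.
  by apply: lsum_ext => x; ring.
rewrite shuffle_lsum_l /shf3; apply: lsum_ext => x.
by rewrite shuffle_mono /shf; ring.
Qed.

Lemma lsum_seq_delta (N i : nat) (g : nat -> C) : (i <= N)%nat ->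
  lsum (seq 0 (S N)) (fun k => if Nat.eq_dec k i then g k else 0) = g i.
Proof.
move=> iN; apply: lsum_delta; first exact: seq_NoDup.
by apply/in_seq; lia.
Qed.

Lemma in_S10_lsum {A} (l : list A) (a : A -> C) (P : A -> series) :
  (forall e, In e l -> in_S10 (P e)) ->
  in_S10 (fun v => lsum l (fun e => a e * P e v)).
Proof.
elim: l => [|e l IH] H; first exact: in_S10_zero.
apply: (in_S10_lin (a e) (P e) (fun v => lsum l (fun e => a e * P e v))).
  by apply: H; left.
by apply: IH => e' el; apply: H; right.
Qed.

(** Evaluated at the coordinate forms [fun u => mono u w'], the decomposition of the word becomes an
    equation of coefficients. The polynomial [c i j] collects the cores of the terms with exponents
    [i] and [j]. *)
Lemma reg_decomposition_exists w :
  exists N c, reg_decomposition (mono w) N c.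
Proof.
have [l [lS Hl]] := decomposable_word w.
have [N HN] : exists N, forall e, In e l -> (deg1 e <= N /\ deg0 e <= N)%nat.
  elim: l {lS Hl} => [|e l [N HN]]; first by exists O.
  exists (deg1 e + deg0 e + N)%nat => e' [<-|/HN]; lia.
pose a i j e := if Nat.eq_dec i (deg1 e) then
   if Nat.eq_dec j (deg0 e) then coef e else 0 else 0.
exists N, (fun i j v => lsum l (fun e => a i j e * mono (core e) v)).
split=> [i j|w'].
  by apply: (in_S10_lsum l (a i j)) => e el; apply/in_S10_mono/lS.
transitivity (lsum l (fun e => coef e * shf3 (fun u => mono u w') (deg1 e) (core e) (deg0 e))).
  exact: (Hl (fun u => mono u w')).
rewrite sum_n_lsum.
transitivity (lsum (seq 0 (S N)) (fun i => lsum (seq 0 (S N)) (fun j =>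
   lsum l (fun e => a i j e * shf3 (fun u => mono u w') i (core e) j)))).
  transitivity (lsum (seq 0 (S N)) (fun i => lsum l (fun e => lsum (seq 0 (S N)) (fun j =>
    a i j e * shf3 (fun u => mono u w') i (core e) j)))); last first.
    by apply: lsum_ext => i; rewrite lsum_swap.
  rewrite lsum_swap; apply: lsum_ext_in => e /HN [e1 e0].
  rewrite -[LHS](lsum_seq_delta N (deg1 e)
    (fun i => coef e * shf3 (fun u => mono u w') i (core e) (deg0 e)) e1).
  apply: lsum_ext => i; rewrite /a; case: Nat.eq_dec => // _; last first.
    by rewrite lsum_0 // => j _; ring.
  rewrite -(lsum_seq_delta N (deg0 e)
    (fun j => coef e * shf3 (fun u => mono u w') i (core e) j) e0).
  by apply: lsum_ext => j; case: Nat.eq_dec => // _; ring.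
apply: lsum_ext => i; rewrite sum_n_lsum; apply: lsum_ext => j.
have -> : shuffle (mono (repeat x1 i)) (fun v => lsum l (fun e => a i j e * mono (core e) v)) =
  fun v => lsum l (fun e => a i j e * shuffle (mono (repeat x1 i)) (mono (core e)) v).
  by apply: series_ext => v; rewrite shuffle_lsum_r.
rewrite shuffle_lsum_l; apply: lsum_ext => e.
by rewrite shuffle3_mono.
Qed.

Lemma reg10_spec w : exists N c,
  reg_decomposition (mono w) N c /\ reg10 (mono w) = c O O.
Proof.
apply: (epsilon_spec (inhabits nc_zero)
  (fun r => exists N c, reg_decomposition (mono w) N c /\ r = c O O)).
by have [N [c H]] := reg_decomposition_exists w; exists (c O O), N, c.
Qed.

Lemma shf_letter_power F i n :
  shf F [i] (repeat i n) = INR (S n) * F (repeat i (S n)).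
Proof.
elim: n F => [|n IH] F; first by rewrite shf_nil_r /=; ring.
rewrite [repeat i (S n)]/= shf_cons shf_nil_l IH.
by rewrite (S_INR (S n)) RtoC_plus /shift /=; ring.
Qed.

Lemma Cmult_integral (a b : C) : a * b = 0 -> a = 0 \/ b = 0.
Proof.
move=> ab; case: (excluded_middle_informative (a = 0)) => [|a0]; first by left.
by right; rewrite -(Cmult_1_l b) -(Cinv_l a a0) -Cmult_assoc ab; ring.
Qed.

Lemma character_power_0 F i n : character F -> F [i] = 0 ->
  F (repeat i (S n)) = 0.
Proof.
move=> [_ Fs] F0; have := Fs [i] (repeat i n).
rewrite F0 shf_letter_power Cmult_0_l => /Cmult_integral [|//] e.
by have := RtoC_inj _ _ e; move: (pos_INR n); rewrite S_INR; lra.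
Qed.

Lemma is_poly_sum_n (P : nat -> series) N :
  (forall i, is_poly (P i)) -> is_poly (fun w => sum_n (fun i => P i w) N).
Proof.
move=> H; elim: N => [|N IH].
  have -> : (fun w => sum_n (fun i => P i w) 0) = P O; last exact: H.
  by apply: series_ext => w; rewrite sum_O.
have -> : (fun w => sum_n (fun i => P i w) (S N)) =
   (1 *: (fun w => sum_n (fun i => P i w) N) + P (S N))%nc; last exact: is_poly_lin.
apply: series_ext => w; rewrite sum_Sn /nc_add /nc_scale.
by C_ring.
Qed.

Lemma pairing_sum_n F (P : nat -> series) N : (forall i, is_poly (P i)) ->
  pairing F (fun w => sum_n (fun i => P i w) N) = sum_n (fun i => pairing F (P i)) N.
Proof.
move=> H; elim: N => [|N IH].
  rewrite sum_O; congr pairing.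
  by apply: series_ext => w; rewrite sum_O.
have -> : (fun w => sum_n (fun i => P i w) (S N)) =
   (1 *: (fun w => sum_n (fun i => P i w) N) + P (S N))%nc.
  apply: series_ext => w; rewrite sum_Sn /nc_add /nc_scale.
  by C_ring.
rewrite pairing_lin //; last exact: is_poly_sum_n.
rewrite IH sum_Sn; C_ring.
Qed.

Lemma reg10_in_S10 w : in_S10 (reg10 (mono w)).
Proof. by have [N [c [[H _] ->]]] := reg10_spec w. Qed.

(** A character maps the decomposition to the sum of F(xi_1^i) F(c_ij) F(xi_0^j). It kills all
    positive powers of a letter on which it vanishes, so that only c_00 contributes. *)
Lemma pairing_reg10 F w : character F -> F [x0] = 0 -> F [x1] = 0 ->
  pairing F (reg10 (mono w)) = F w.
Proof.
move=> Fc F0 F1; have [N [c [[cS H] ->]]] := reg10_spec w.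
have cp i j := in_S10_poly _ (cS i j).
have sp i j : is_poly (shuffle (shuffle (mono (repeat x1 i)) (c i j)) (mono (repeat x0 j))).
  by do ! apply: is_poly_shuffle => //; apply: is_poly_mono.
rewrite -(pairing_mono F w) (functional_extensionality _ _ H).
rewrite pairing_sum_n; last by move=> i; apply: is_poly_sum_n.
pose g i j : C := F (repeat x1 i) * pairing F (c i j) * F (repeat x0 j).
have gE i j :
    pairing F (shuffle (shuffle (mono (repeat x1 i)) (c i j)) (mono (repeat x0 j))) = g i j.
  rewrite !pairing_shuffle // ?pairing_mono //; try exact: is_poly_mono.
  by apply: is_poly_shuffle => //; apply: is_poly_mono.
have g1 i j : g (S i) j = 0.
  by rewrite /g character_power_0 //; ring.
have g0 i j : g i (S j) = 0.
  by rewrite /g (character_power_0 F x0) //; ring.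
rewrite (sum_n_tail_0 _ 0); [|lia|]; last first.
  move=> [|i] ip; first lia.
  by rewrite pairing_sum_n // sum_n_lsum lsum_0 // => j _; rewrite gE.
rewrite sum_O pairing_sum_n // (sum_n_tail_0 _ 0); [|lia|]; last first.
  by move=> [|j] jp; [lia|rewrite gE].
case: Fc => Fe _.
by rewrite sum_O gE /g /= Fe; ring.
Qed.

(** The required linear map is the pairing with [F] itself. *)
Lemma regular_seriesE F : character F -> F [x0] = 0 -> F [x1] = 0 ->
  linear_on_S10 (pairing F) /\ F = reg_series (pairing F).
Proof.
move=> Fc F0 F1; split.
  by move=> a p q /in_S10_poly pp /in_S10_poly qp; apply: pairing_lin.
by apply: series_ext => w; rewrite /reg_series pairing_reg10.
Qed.

(** Characterizes the associator among characters: regularized words are supported on words of S^10,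
    so a character without linear terms is determined by its values there. *)
Lemma Phi_KZE F : character F -> F [x0] = 0 -> F [x1] = 0 ->
  (forall w, S10_word w -> F w = RtoC (mzv (word_index w))) -> F = Phi_KZ.
Proof.
move=> Fc F0 F1 H; apply: series_ext => w.
rewrite -[LHS](pairing_reg10 F w) //.
rewrite /Phi_KZ /reg_series -[zeta]/(pairing (fun w => RtoC (mzv (word_index w)))).
have rS := reg10_in_S10 w.
apply: pairing_ext; first exact: in_S10_poly.
by move=> v /(in_S10_support _ _ rS) /H.
Qed.

(** * Cauchy theory *)

Notation is_Cderive f z l :=
  (@is_derive C_AbsRing C_NormedModule f z l).
Notation ex_Cderive f z := (@ex_derive C_AbsRing C_NormedModule f z).

Lemma is_Cderive_eps (f : C -> C) (z l : C) :
  is_Cderive f z l <->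
  forall eps : R, (0 < eps)%R -> exists d : R, (0 < d)%R /\ forall w : C,
    (Cmod (w - z) < d)%R ->
    (Cmod (f w - f z - (w - z) * l) <= eps * Cmod (w - z))%R.
Proof.
split.
  move=> [_ H] eps e0.
  have [d Hd] := H z (fun P HP => HP) (mkposreal eps e0).
  exists d; split; first exact: cond_pos.
  move=> w wd; exact: Hd.
move=> H; split; first exact: is_linear_scal_l.
move=> x xz.
have -> : x = z by symmetry; apply: is_filter_lim_locally_unique.
move=> eps; have [d [d0 Hd]] := H eps (cond_pos eps).
exists (mkposreal d d0) => w wd; exact: Hd.
Qed.

Lemma is_Cderive_ext_val (f : C -> C) (z l l' : C) :
  is_Cderive f z l -> l = l' -> is_Cderive f z l'.
Proof. by move=> H <-. Qed.

(** Translates between the two normed-module structures on [C]: as a module over itself, where the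
    product and chain rules are stated, and [C_NormedModule]. *)
Lemma is_Cderive_absring (f : C -> C) (z l : C) :
  @is_derive C_AbsRing (AbsRing_NormedModule C_AbsRing) f z l <->
  is_Cderive f z l.
Proof. by split=> -[_ H]; split=> //; apply: is_linear_scal_l. Qed.

Lemma is_Cderive_mult (f g : C -> C) (z l m : C) :
  is_Cderive f z l -> is_Cderive g z m ->
  is_Cderive (fun t => f t * g t) z (l * g z + f z * m).
Proof.
move=> /is_Cderive_absring Hf /is_Cderive_absring Hg; apply/is_Cderive_absring.
exact: (is_derive_mult (K := C_AbsRing) f g z l m Hf Hg Cmult_comm).
Qed.

Lemma is_Cderive_comp (f g : C -> C) (z l m : C) :
  is_Cderive f (g z) l -> is_Cderive g z m ->
  is_Cderive (fun t => f (g t)) z (m * l).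
Proof.
move=> Hf /is_Cderive_absring Hg.
exact: (is_derive_comp (K := C_AbsRing) f g z l m Hf Hg).
Qed.

Lemma is_Cderive_id (z : C) : is_Cderive (fun t => t) z (RtoC 1).
Proof. apply/is_Cderive_absring; exact: (is_derive_id (K := C_AbsRing)). Qed.

Lemma is_Cderive_const (a z : C) : is_Cderive (fun _ => a) z (RtoC 0).
Proof. exact: (is_derive_const (K := C_AbsRing) (V := C_NormedModule)). Qed.

Lemma is_Cderive_plus (f g : C -> C) (z l m : C) :
  is_Cderive f z l -> is_Cderive g z m ->
  is_Cderive (fun t => f t + g t) z (l + m).
Proof. exact: is_derive_plus. Qed.

Lemma is_Cderive_minus (f g : C -> C) (z l m : C) :
  is_Cderive f z l -> is_Cderive g z m ->
  is_Cderive (fun t => f t - g t) z (l - m).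
Proof. exact: is_derive_minus. Qed.

Lemma is_Cderive_inv (z : C) : z <> 0 -> is_Cderive Cinv z (- / (z * z)).
Proof.
move=> z0; apply/is_Cderive_eps => eps e0.
have m0 : (0 < Cmod z)%R by apply/Cmod_gt_0.
have m3 : (0 < Cmod z ^ 3)%R by apply: pow_lt.
(* The first bound keeps |w| >= |z| / 2; with it, the second gives |w - z| <= eps |z|^2 |w|. *)
exists (Rmin (Cmod z / 2) (eps * Cmod z ^ 3 / 2)); split.
  by apply: Rmin_pos; [lra|apply: Rdiv_lt_0_compat; [apply: Rmult_lt_0_compat|lra]].
move=> w wd.
have [wd1 wd2] := Rmin_Rgt_l _ _ _ wd.
have wz : (Cmod z / 2 <= Cmod w)%R.
  have := Cmod_triangle (z - w) w; rewrite (_ : z - w + w = z); last ring.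
  by rewrite -(Cmod_opp (z - w)) (_ : - (z - w) = w - z); [lra|ring].
have w0 : w <> 0 by apply/Cmod_gt_0; lra.
have -> : / w - / z - (w - z) * - / (z * z) =
  (w - z) * ((w - z) * / (z * z * w)) by field.
rewrite Cmod_mult Rmult_comm; apply: Rmult_le_compat_r; first exact: Cmod_ge_0.
rewrite Cmod_mult Cmod_inv; last by do ! apply: Cmult_neq_0.
rewrite !Cmod_mult.
apply: (Rmult_le_reg_r (Cmod z * Cmod z * Cmod w)).
  by do ! apply: Rmult_lt_0_compat => //; lra.
rewrite Rmult_assoc Rinv_l ?Rmult_1_r; last first.
  by apply: Rgt_not_eq; do ! apply: Rmult_lt_0_compat => //; lra.
apply: Rle_trans (Rlt_le _ _ wd2) _.
have -> : (eps * Cmod z ^ 3 / 2 = eps * (Cmod z * Cmod z * (Cmod z / 2)))%R by field.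
apply: Rmult_le_compat_l; first lra.
by apply: Rmult_le_compat_l => //; apply: Rlt_le; apply: Rmult_lt_0_compat.
Qed.

Lemma is_Cderive_uniq (f : C -> C) (z l m : C) :
  is_Cderive f z l -> is_Cderive f z m -> l = m.
Proof. by move=> /is_C_derive_unique <- /is_C_derive_unique. Qed.

Definition Ccont (f : C -> C) (z : C) : Prop :=
  forall eps : R, (0 < eps)%R -> exists d : R, (0 < d)%R /\ forall w : C,
    (Cmod (w - z) < d)%R -> (Cmod (f w - f z) < eps)%R.

Lemma ex_Cderive_Ccont (f : C -> C) (z : C) : ex_Cderive f z -> Ccont f z.
Proof.
move=> [l /is_Cderive_eps H] eps e0.
have [d [d0 Hd]] := H 1%R Rlt_0_1.
have l0 := Cmod_ge_0 l.
exists (Rmin d (eps / (2 + Cmod l))); split.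
  by apply: Rmin_pos => //; apply: Rdiv_lt_0_compat; lra.
move=> w wd.
have [wd1 wd2] := Rmin_Rgt_l _ _ _ wd.
have := Hd w wd1 => H1.
have -> : f w - f z = (f w - f z - (w - z) * l) + (w - z) * l by ring.
apply: Rle_lt_trans (Cmod_triangle _ _) _; rewrite (Cmod_mult (w - z)).
have w0 := Cmod_ge_0 (w - z).
apply: Rle_lt_trans (_ : ((1 + Cmod l) * Cmod (w - z) < eps)%R).
  by rewrite Rmult_plus_distr_r (Rmult_comm (Cmod l)); lra.
apply: Rle_lt_trans (_ : ((1 + Cmod l) * (eps / (2 + Cmod l)) < eps)%R).
  by apply: Rmult_le_compat_l; lra.
have -> : ((1 + Cmod l) * (eps / (2 + Cmod l)) = eps - eps / (2 + Cmod l))%R.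
  by field; lra.
have : (0 < eps / (2 + Cmod l))%R by apply: Rdiv_lt_0_compat; lra.
lra.
Qed.

Lemma Cmod_le_abs (z : C) : (Cmod z <= Rabs (fst z) + Rabs (snd z))%R.
Proof.
have e : z = RtoC (fst z) + Ci * RtoC (snd z).
  by case: z => x y; rewrite /RtoC /Ci /Cmult /Cplus /=; congr pair; ring.
rewrite {1}e; apply: Rle_trans (Cmod_triangle _ _) _.
by rewrite Cmod_mult Cmod_Ci !Cmod_R; lra.
Qed.

Lemma fst_le_Cmod (z : C) : (Rabs (fst z) <= Cmod z)%R.
Proof. exact: Rle_trans (Rmax_l _ _) (Rmax_Cmod z). Qed.

Lemma snd_le_Cmod (z : C) : (Rabs (snd z) <= Cmod z)%R.
Proof. exact: Rle_trans (Rmax_r _ _) (Rmax_Cmod z). Qed.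

Lemma is_derive_eps (f : R -> R) (x l : R) :
  (forall eps : R, 0 < eps -> exists d : R, 0 < d /\ forall y : R,
    Rabs (y - x) < d -> Rabs (f y - f x - (y - x) * l) <= eps * Rabs (y - x))%R ->
  is_derive f x l.
Proof.
move=> H; split; first exact: is_linear_scal_l.
move=> z xz.
have -> : z = x by symmetry; apply: is_filter_lim_locally_unique.
move=> eps; have [d [d0 Hd]] := H eps (cond_pos eps).
exists (mkposreal d d0) => w wd; exact: Hd.
Qed.

(** The factor [c] selects a real component: [1] the real part, [- Ci] the imaginary part, a
    conjugate the component in a given direction. *)
Lemma is_derive_Re_line (f : C -> C) (c a d l : C) (t : R) :
  is_Cderive f (a + t * d) l ->
  is_derive (fun s : R => Re (c * f (a + s * d))) t (Re (c * (d * l))).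
Proof.
move=> /is_Cderive_eps H; apply: is_derive_eps => eps e0.
have c0 := Cmod_ge_0 c; have d0 := Cmod_ge_0 d.
have k0 : (0 < (1 + Cmod c) * (1 + Cmod d))%R by apply: Rmult_lt_0_compat; lra.
have [r [r0 Hr]] := H (eps / ((1 + Cmod c) * (1 + Cmod d)))%R
   ltac:(apply: Rdiv_lt_0_compat; lra).
exists (r / (1 + Cmod d))%R; split; first by apply: Rdiv_lt_0_compat; lra.
move=> s sr.
have e1 : a + s * d - (a + t * d) = RtoC (s - t) * d by rewrite RtoC_minus; ring.
have m1 : (Cmod (a + s * d - (a + t * d)) <= Rabs (s - t) * (1 + Cmod d))%R.
  rewrite e1 Cmod_mult Cmod_R; apply: Rmult_le_compat_l; first exact: Rabs_pos.
  lra.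
have m2 : (Cmod (a + s * d - (a + t * d)) < r)%R.
  apply: Rle_lt_trans m1 _; apply: (Rlt_le_trans _ (r / (1 + Cmod d) * (1 + Cmod d))).
    by apply: Rmult_lt_compat_r => //; lra.
  by apply: Req_le; field; lra.
have := Hr _ m2; rewrite e1 => H2.
have -> : (Re (c * f (a + s * d))%C - Re (c * f (a + t * d))%C - (s - t) * Re (c * (d * l))%C =
  Re (c * (f (a + s * d) - f (a + t * d) - RtoC (s - t) * d * l))%C)%R.
  by rewrite /Re /= /Cminus; ring.
apply: Rle_trans (fst_le_Cmod _) _; rewrite Cmod_mult.
apply: Rle_trans (_ : Cmod c * (eps / ((1 + Cmod c) * (1 + Cmod d)) *
   (Rabs (s - t) * (1 + Cmod d))) <= _)%R.
  apply: Rmult_le_compat_l => //; apply: Rle_trans H2 _.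
  apply: Rmult_le_compat_l; first by apply: Rlt_le; apply: Rdiv_lt_0_compat; lra.
  by rewrite -e1.
have -> : (Cmod c * (eps / ((1 + Cmod c) * (1 + Cmod d)) * (Rabs (s - t) * (1 + Cmod d)))
  = (eps * Rabs (s - t)) * (Cmod c / (1 + Cmod c)))%R by field; lra.
rewrite -[X in (_ <= X)%R]Rmult_1_r; apply: Rmult_le_compat_l.
  by apply: Rmult_le_pos; [lra|apply: Rabs_pos].
apply: (Rmult_le_reg_r (1 + Cmod c)); first lra.
by rewrite /Rdiv Rmult_assoc Rinv_l; lra.
Qed.

Lemma Re_conj_mult (z : C) : Re (Cconj z * z) = (Cmod z * Cmod z)%R.
Proof.
have := Cmod2_alt z; rewrite /Re /Im /Cconj /Cmult /= => e.
have -> : (Cmod z * Cmod z = Cmod z * (Cmod z * 1))%R by ring.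
by rewrite e; ring.
Qed.

(* By the real mean value theorem for the component of [f] in the direction of
   [f b - f a]. *)
Lemma mean_value_le (f : C -> C) (a b : C) (K : R) :
  (forall t : R, (0 <= t <= 1)%R -> ex_Cderive f (a + t * (b - a))) ->
  (forall t l, (0 < t < 1)%R -> is_Cderive f (a + t * (b - a)) l -> (Cmod l <= K)%R) ->
  (Cmod (f b - f a) <= K * Cmod (b - a))%R.
Proof.
move=> Hf HK; set w := f b - f a.
pose phi (t : R) := Re (Cconj w * f (a + t * (b - a))).
pose dphi (t : R) := Re (Cconj w * ((b - a) * C_derive f (a + t * (b - a)))).
have dP (t : R) : (0 <= t <= 1)%R -> is_Cderive f (a + t * (b - a)) (C_derive f (a + t * (b - a))).
  by move=> /Hf Ht; apply: (C_derive_correct _ _ 0).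
have [t [e t01]] : exists c, (phi 1 - phi 0 = dphi c * (1 - 0) /\ 0 < c < 1)%R.
  apply: (MVT_cor2 phi dphi); first lra.
  by move=> t /dP /(is_derive_Re_line f (Cconj w)) /is_derive_Reals.
have l1 : (Cmod (C_derive f (a + t * (b - a))) <= K)%R.
  by apply: (HK t) => //; apply: dP; lra.
have e1 : (phi 1 - phi 0 = Cmod w * Cmod w)%R.
  rewrite -Re_conj_mult /phi.
  rewrite (_ : a + 1%R * (b - a) = b); last ring.
  rewrite (_ : a + 0%R * (b - a) = a); last ring.
  by rewrite /w /Re /= /Cminus; ring.
case: (Rle_lt_or_eq_dec _ _ (Cmod_ge_0 w)) => [w0|<-]; last first.
  apply: Rmult_le_pos (Cmod_ge_0 _); exact: Rle_trans (Cmod_ge_0 _) l1.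
apply: (Rmult_le_reg_l (Cmod w)) => //.
rewrite -e1 e /dphi Rminus_0_r Rmult_1_r.
apply: Rle_trans (Rle_abs _) _; apply: Rle_trans (fst_le_Cmod _) _.
rewrite !Cmod_mult Cmod_conj; apply: Rmult_le_compat_l; first lra.
rewrite Rmult_comm; apply: Rmult_le_compat_r => //; exact: Cmod_ge_0.
Qed.

Lemma derivative_zero_const (f : C -> C) (a b : C) :
  (forall t : R, (0 <= t <= 1)%R -> ex_Cderive f (a + t * (b - a))) ->
  (forall t, (0 < t < 1)%R -> is_Cderive f (a + t * (b - a)) (RtoC 0)) ->
  f b = f a.
Proof.
move=> Hf H0.
have : (Cmod (f b - f a) <= 0 * Cmod (b - a))%R.
  apply: mean_value_le => // t l t01 /(is_Cderive_uniq _ _ _ _ (H0 t t01)) <-.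
  by rewrite Cmod_0; lra.
rewrite Rmult_0_l => h.
have e : f b - f a = 0 by apply: Cmod_eq_0; apply: Rle_antisym h (Cmod_ge_0 _).
by rewrite -(Cplus_0_r (f a)) -e; ring.
Qed.

(** Componentwise, so that the theory of the real integral applies; the price is the factor 2 in
    [CInt_le]. *)
Definition CInt (phi : R -> C) (a b : R) : C :=
  (RInt (fun t => fst (phi t)) a b, RInt (fun t => snd (phi t)) a b).

Definition pcont (phi : R -> C) (t : R) : Prop :=
  continuous (fun s => fst (phi s)) t /\ continuous (fun s => snd (phi s)) t.

Definition pcont_on (phi : R -> C) (a b : R) : Prop :=
  forall t, (Rmin a b <= t <= Rmax a b)%R -> pcont phi t.

Lemma pcont_ex_RInt phi a b : pcont_on phi a b ->
  ex_RInt (fun t => fst (phi t)) a b /\ ex_RInt (fun t => snd (phi t)) a b.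
Proof.
move=> H; split; apply: (ex_RInt_continuous (V := R_CompleteNormedModule));
  by move=> t /H [].
Qed.

Lemma continuous_eps (f : R -> R) (x : R) :
  (forall eps : R, 0 < eps -> exists d : R, 0 < d /\ forall y : R,
    Rabs (y - x) < d -> Rabs (f y - f x) < eps)%R ->
  continuous f x.
Proof.
move=> H; apply/filterlim_locally => eps.
have [d [d0 Hd]] := H eps (cond_pos eps).
exists (mkposreal d d0) => y yd; exact: Hd.
Qed.

Lemma pcont_eps (phi : R -> C) (t : R) :
  (forall eps : R, 0 < eps -> exists d : R, 0 < d /\ forall s : R,
    Rabs (s - t) < d -> Cmod (phi s - phi t) < eps)%R -> pcont phi t.
Proof.
move=> H; split; apply: continuous_eps => eps /H [d [d0 Hd]]; exists d; split=> //;
  move=> s /Hd; apply: Rle_lt_trans; [exact: (fst_le_Cmod (phi s - phi t))|].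
exact: (snd_le_Cmod (phi s - phi t)).
Qed.

Lemma pcont_line (f : C -> C) (c a d : C) (t : R) :
  Ccont f (a + t * d) -> pcont (fun s : R => c * f (a + s * d)) t.
Proof.
move=> H; apply: pcont_eps => eps e0.
have c0 := Cmod_ge_0 c; have d0 := Cmod_ge_0 d.
have [r [r0 Hr]] := H (eps / (1 + Cmod c))%R ltac:(apply: Rdiv_lt_0_compat; lra).
exists (r / (1 + Cmod d))%R; split; first by apply: Rdiv_lt_0_compat; lra.
move=> s sr.
have e1 : a + s * d - (a + t * d) = RtoC (s - t) * d by rewrite RtoC_minus; ring.
have m2 : (Cmod (a + s * d - (a + t * d)) < r)%R.
  rewrite e1 Cmod_mult Cmod_R.
  apply: (Rle_lt_trans _ (Rabs (s - t) * (1 + Cmod d))).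
    by apply: Rmult_le_compat_l; [exact: Rabs_pos|lra].
  apply: (Rlt_le_trans _ (r / (1 + Cmod d) * (1 + Cmod d))).
    by apply: Rmult_lt_compat_r => //; lra.
  by apply: Req_le; field; lra.
have -> : c * f (a + s * d) - c * f (a + t * d) =
  c * (f (a + s * d) - f (a + t * d)) by ring.
rewrite Cmod_mult; apply: (Rle_lt_trans _ (Cmod c * (eps / (1 + Cmod c)))).
  by apply: Rmult_le_compat_l => //; apply: Rlt_le; apply: Hr.
have -> : (Cmod c * (eps / (1 + Cmod c)) = eps - eps / (1 + Cmod c))%R by field; lra.
have : (0 < eps / (1 + Cmod c))%R by apply: Rdiv_lt_0_compat; lra.
lra.
Qed.

Lemma CInt_ext phi psi a b :
  (forall t, (Rmin a b < t < Rmax a b)%R -> phi t = psi t) ->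
  CInt phi a b = CInt psi a b.
Proof. by move=> H; congr pair; apply: RInt_ext => t /H ->. Qed.

Lemma CInt_minus phi psi a b : pcont_on phi a b -> pcont_on psi a b ->
  CInt (fun t => phi t - psi t) a b = CInt phi a b - CInt psi a b.
Proof.
move=> /pcont_ex_RInt [p1 p2] /pcont_ex_RInt [q1 q2].
rewrite /CInt /Cminus /Cplus /Copp /=; congr pair.
  exact: (RInt_minus (fun t => fst (phi t)) (fun t => fst (psi t)) a b p1 q1).
exact: (RInt_minus (fun t => snd (phi t)) (fun t => snd (psi t)) a b p2 q2).
Qed.

Lemma CInt_Chasles phi a b c : pcont_on phi a b -> pcont_on phi b c ->
  CInt phi a b + CInt phi b c = CInt phi a c.
Proof.
move=> /pcont_ex_RInt [p1 p2] /pcont_ex_RInt [q1 q2].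
rewrite /CInt /Cplus /=; congr pair.
  exact: (RInt_Chasles (fun t => fst (phi t)) a b c p1 q1).
exact: (RInt_Chasles (fun t => snd (phi t)) a b c p2 q2).
Qed.

Lemma CInt_point phi a : CInt phi a a = 0.
Proof. by rewrite /CInt !RInt_point. Qed.

Lemma CInt_swap phi a b : pcont_on phi a b -> CInt phi b a = - CInt phi a b.
Proof.
move=> /pcont_ex_RInt [p1 p2]; rewrite /CInt /Copp /=; congr pair.
  by rewrite -(opp_RInt_swap _ _ _ p1).
by rewrite -(opp_RInt_swap _ _ _ p2).
Qed.

Lemma CInt_le phi a b M : (a <= b)%R -> pcont_on phi a b ->
  (forall t, (a <= t <= b)%R -> (Cmod (phi t) <= M)%R) ->
  (Cmod (CInt phi a b) <= 2 * ((b - a) * M))%R.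
Proof.
move=> ab /pcont_ex_RInt [p1 p2] H.
apply: Rle_trans (Cmod_le_abs _) _; rewrite /CInt /=.
have b1 := norm_RInt_le_const (V := R_NormedModule) _ a b _ M ab
  (fun t h => Rle_trans _ _ _ (fst_le_Cmod _) (H t h)) (RInt_correct _ _ _ p1).
have b2 := norm_RInt_le_const (V := R_NormedModule) _ a b _ M ab
  (fun t h => Rle_trans _ _ _ (snd_le_Cmod _) (H t h)) (RInt_correct _ _ _ p2).
rewrite /norm /= /abs /= in b1 b2; lra.
Qed.

Lemma CInt_le_abs phi a b M : pcont_on phi a b ->
  (forall t, (Rmin a b <= t <= Rmax a b)%R -> (Cmod (phi t) <= M)%R) ->
  (Cmod (CInt phi a b) <= 2 * (Rabs (b - a) * M))%R.
Proof.
move=> p H; case: (Rle_dec a b) => ab.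
  rewrite Rabs_pos_eq; last lra.
  apply: CInt_le => // t tab; apply: H; rewrite Rmin_left ?Rmax_right //; lra.
rewrite Rabs_left; last lra.
have p' : pcont_on phi b a by move=> t; rewrite Rmin_comm Rmax_comm; apply: p.
rewrite CInt_swap // Cmod_opp.
apply: Rle_trans (CInt_le phi b a M _ _ _) _ => //; try lra.
by move=> t tab; apply: H; rewrite Rmin_right ?Rmax_left //; lra.
Qed.

Lemma CInt_derive (Q q : C -> C) (a d : C) (s t : R) :
  (forall u : R, (Rmin s t <= u <= Rmax s t)%R -> is_Cderive Q (a + u * d) (q (a + u * d))) ->
  (forall u : R, (Rmin s t <= u <= Rmax s t)%R -> Ccont q (a + u * d)) ->
  CInt (fun u : R => d * q (a + u * d)) s t = Q (a + t * d) - Q (a + s * d).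
Proof.
move=> HQ Hq.
have p u := fun h => pcont_line q d a d u (Hq u h).
rewrite /CInt /Cminus /Cplus /Copp /=; congr pair.
  have := is_RInt_derive (V := R_CompleteNormedModule)
    (fun u : R => fst (Q (a + u * d))) (fun u : R => fst (d * q (a + u * d))) s t.
  move=> /(_ _ _) H; apply: is_RInt_unique; apply: H => u h; last by case: (p u h).
  have := is_derive_Re_line Q 1 a d _ u (HQ u h).
  rewrite Cmult_1_l; apply: is_derive_ext => v; rewrite Cmult_1_l //.
have := is_RInt_derive (V := R_CompleteNormedModule)
    (fun u : R => snd (Q (a + u * d))) (fun u : R => snd (d * q (a + u * d))) s t.
move=> /(_ _ _) H; apply: is_RInt_unique; apply: H => u h; last by case: (p u h).
have ReE z : Re (- Ci * z) = snd z by rewrite /Re /Ci /=; ring.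
have := is_derive_Re_line Q (- Ci) a d _ u (HQ u h).
rewrite ReE; apply: is_derive_ext => v; exact: ReE.
Qed.

(** Integrals of f dz along horizontal and vertical segments, where dz is dt and i dt; [rectI] runs
    counterclockwise. *)
Definition Hint (f : C -> C) (y a b : R) : C := CInt (fun t => f (t, y)) a b.
Definition Vint (f : C -> C) (x c d : R) : C := CInt (fun t => Ci * f (x, t)) c d.
Definition rectI (f : C -> C) (a b c d : R) : C :=
  Hint f c a b + Vint f b c d - Hint f d a b - Vint f a c d.

Lemma hline (t y : R) : (t, y) = (0%R, y) + t * 1 :> C.
Proof. by rewrite /RtoC /Cplus /Cmult /=; congr pair; ring. Qed.

Lemma vline (x t : R) : (x, t) = (x, 0%R) + t * Ci :> C.
Proof. by rewrite /RtoC /Ci /Cplus /Cmult /=; congr pair; ring. Qed.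

Lemma pcont_h (f : C -> C) (t y : R) : Ccont f (t, y) -> pcont (fun s => f (s, y)) t.
Proof.
rewrite hline => /(pcont_line f 1) [h1 h2]; split.
  by apply: continuous_ext h1 => s; rewrite Cmult_1_l -hline.
by apply: continuous_ext h2 => s; rewrite Cmult_1_l -hline.
Qed.

Lemma pcont_v (f : C -> C) (x t : R) : Ccont f (x, t) -> pcont (fun s => Ci * f (x, s)) t.
Proof.
rewrite vline => /(pcont_line f Ci) [h1 h2]; split.
  by apply: continuous_ext h1 => s; rewrite -vline.
by apply: continuous_ext h2 => s; rewrite -vline.
Qed.

Lemma Hint_derive (Q q : C -> C) (y a b : R) :
  (forall x, (Rmin a b <= x <= Rmax a b)%R -> is_Cderive Q (x, y) (q (x, y))) ->
  (forall x, (Rmin a b <= x <= Rmax a b)%R -> Ccont q (x, y)) ->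
  Hint q y a b = Q (b, y) - Q (a, y).
Proof.
move=> HQ Hq; rewrite /Hint (hline a) (hline b).
rewrite -(CInt_derive Q q); [|by move=> u h; rewrite -hline; auto..].
by apply: CInt_ext => t _; rewrite -hline Cmult_1_l.
Qed.

Lemma Vint_derive (Q q : C -> C) (x c d : R) :
  (forall y, (Rmin c d <= y <= Rmax c d)%R -> is_Cderive Q (x, y) (q (x, y))) ->
  (forall y, (Rmin c d <= y <= Rmax c d)%R -> Ccont q (x, y)) ->
  Vint q x c d = Q (x, d) - Q (x, c).
Proof.
move=> HQ Hq; rewrite /Vint (vline x d) (vline x c).
rewrite -(CInt_derive Q q); [|by move=> u h; rewrite -vline; auto..].
by apply: CInt_ext => t _; rewrite -vline.
Qed.

Definition in_rect (a b c d : R) (z : C) : Prop :=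
  (a <= fst z <= b)%R /\ (c <= snd z <= d)%R.

Definition cont_rect (f : C -> C) (a b c d : R) : Prop :=
  forall z, in_rect a b c d z -> Ccont f z.

Lemma cont_rect_h f a b c d y s t : cont_rect f a b c d -> (c <= y <= d)%R ->
  (a <= s <= b)%R -> (a <= t <= b)%R -> pcont_on (fun x => f (x, y)) s t.
Proof.
move=> H yd [? ?] [? ?] x [x1 x2]; apply: pcont_h; apply: H; split=> //=; split.
  by apply: Rle_trans x1; apply: Rmin_glb.
by apply: Rle_trans x2 _; apply: Rmax_lub.
Qed.

Lemma cont_rect_v f a b c d x s t : cont_rect f a b c d -> (a <= x <= b)%R ->
  (c <= s <= d)%R -> (c <= t <= d)%R -> pcont_on (fun y => Ci * f (x, y)) s t.
Proof.
move=> H xb [? ?] [? ?] y [y1 y2]; apply: pcont_v; apply: H; split=> //=; split.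
  by apply: Rle_trans y1; apply: Rmin_glb.
by apply: Rle_trans y2 _; apply: Rmax_lub.
Qed.

Lemma rectI_split_h f a m b c d : (a <= m <= b)%R -> (c <= d)%R ->
  cont_rect f a b c d ->
  rectI f a b c d = rectI f a m c d + rectI f m b c d.
Proof.
move=> mab cd H; rewrite /rectI /Hint /Vint.
rewrite -(CInt_Chasles (fun t => f (t, c)) a m b);
  [|by apply: (cont_rect_h _ _ _ _ _ _ _ _ H); lra..].
rewrite -(CInt_Chasles (fun t => f (t, d)) a m b);
  [|by apply: (cont_rect_h _ _ _ _ _ _ _ _ H); lra..].
ring.
Qed.

Lemma rectI_split_v f a b c m d : (c <= m <= d)%R -> (a <= b)%R ->
  cont_rect f a b c d ->
  rectI f a b c d = rectI f a b c m + rectI f a b m d.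
Proof.
move=> mab cd H; rewrite /rectI /Hint /Vint.
rewrite -(CInt_Chasles (fun t => Ci * f (a, t)) c m d);
  [|by apply: (cont_rect_v _ _ _ _ _ _ _ _ H); lra..].
rewrite -(CInt_Chasles (fun t => Ci * f (b, t)) c m d);
  [|by apply: (cont_rect_v _ _ _ _ _ _ _ _ H); lra..].
ring.
Qed.

Lemma Ccont_minus f g z : Ccont f z -> Ccont g z -> Ccont (fun w => f w - g w) z.
Proof.
move=> Hf Hg eps e0.
have [d1 [d10 H1]] := Hf (eps / 2)%R ltac:(lra).
have [d2 [d20 H2]] := Hg (eps / 2)%R ltac:(lra).
exists (Rmin d1 d2); split; first exact: Rmin_pos.
move=> w wd.
have h1 := H1 w (Rlt_le_trans _ _ _ wd (Rmin_l _ _)).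
have h2 := H2 w (Rlt_le_trans _ _ _ wd (Rmin_r _ _)).
have -> : f w - g w - (f z - g z) = (f w - f z) + - (g w - g z) by ring.
by apply: Rle_lt_trans (Cmod_triangle _ _) _; rewrite Cmod_opp; lra.
Qed.

Lemma rectI_minus f g a b c d : (a <= b)%R -> (c <= d)%R ->
  cont_rect f a b c d -> cont_rect g a b c d ->
  rectI (fun z => f z - g z) a b c d = rectI f a b c d - rectI g a b c d.
Proof.
move=> ab cd Hf Hg.
have h y : (c <= y <= d)%R ->
    Hint (fun z => f z - g z) y a b = Hint f y a b - Hint g y a b.
  by move=> yd; apply: CInt_minus; apply: (cont_rect_h _ a b c d) => //; lra.
have v x : (a <= x <= b)%R ->
    Vint (fun z => f z - g z) x c d = Vint f x c d - Vint g x c d.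
  move=> xb; rewrite -CInt_minus; try (by apply: (cont_rect_v _ a b c d) => //; lra).
  by apply: CInt_ext => t _; ring.
by rewrite /rectI !h ?v; try lra; ring.
Qed.

Lemma rectI_primitive (Q q : C -> C) a b c d : (a <= b)%R -> (c <= d)%R ->
  (forall z, in_rect a b c d z -> is_Cderive Q z (q z)) ->
  cont_rect q a b c d -> rectI q a b c d = 0.
Proof.
move=> ab cd HQ Hq.
have h : forall y, (c <= y <= d)%R -> Hint q y a b = Q (b, y) - Q (a, y).
  move=> y yd; apply: Hint_derive; rewrite Rmin_left // Rmax_right // => x xab.
    by apply: HQ; split.
  by apply: Hq; split.
have v : forall x, (a <= x <= b)%R -> Vint q x c d = Q (x, d) - Q (x, c).
  move=> x xd; apply: Vint_derive; rewrite Rmin_left // Rmax_right // => y yab.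
    by apply: HQ; split.
  by apply: Hq; split.
rewrite /rectI !h ?v; try lra; ring.
Qed.

Lemma rectI_le f a b c d M : (a <= b)%R -> (c <= d)%R -> cont_rect f a b c d ->
  (forall z, in_rect a b c d z -> (Cmod (f z) <= M)%R) ->
  (Cmod (rectI f a b c d) <= 4 * ((b - a + (d - c)) * M))%R.
Proof.
move=> ab cd Hf HM.
have h y : (c <= y <= d)%R -> (Cmod (Hint f y a b) <= 2 * ((b - a) * M))%R.
  move=> yd; apply: CInt_le => //.
    by apply: (cont_rect_h _ a b c d) => //; lra.
  by move=> x xab; apply: HM; split.
have v x : (a <= x <= b)%R -> (Cmod (Vint f x c d) <= 2 * ((d - c) * M))%R.
  move=> xd; apply: CInt_le => //.
    by apply: (cont_rect_v _ a b c d) => //; lra.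
  by move=> y yab; rewrite Cmod_mult Cmod_Ci Rmult_1_l; apply: HM; split.
have h1 := h c ltac:(lra); have h2 := h d ltac:(lra).
have v1 := v a ltac:(lra); have v2 := v b ltac:(lra).
rewrite /rectI /Cminus.
apply: Rle_trans (Cmod_triangle _ _) _; rewrite Cmod_opp.
apply: Rle_trans (Rplus_le_compat_r _ _ _ (Cmod_triangle _ _)) _; rewrite Cmod_opp.
have := Cmod_triangle (Hint f c a b) (Vint f b c d); lra.
Qed.

(** The affine part of [f] at [p] has a primitive and integrates to 0. The remainder is at most
    [eps] times the sum of the side lengths, which also bounds the length of the path up to a
    constant. *)
Lemma rectI_local f a b c d p l eps : (a <= b)%R -> (c <= d)%R -> (0 <= eps)%R ->
  cont_rect f a b c d -> in_rect a b c d p ->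
  (forall z, in_rect a b c d z ->
    (Cmod (f z - f p - (z - p) * l) <= eps * Cmod (z - p))%R) ->
  (Cmod (rectI f a b c d) <= 4 * eps * (b - a + (d - c)) ^ 2)%R.
Proof.
move=> ab cd e0 Hf [[p1 p2] [p3 p4]] H.
pose g z := f p + (z - p) * l.
pose Q z := f p * z + l * ((z - p) * (z - p) * (/ 2)).
have dQ z : is_Cderive Q z (g z).
  have dz : is_Cderive (fun z => z - p) z (RtoC 1 - 0).
    exact: is_Cderive_minus (is_Cderive_id z) (is_Cderive_const p z).
  have := is_Cderive_plus _ _ z _ _
    (is_Cderive_mult _ _ z _ _ (is_Cderive_const (f p) z) (is_Cderive_id z))
    (is_Cderive_mult _ _ z _ _ (is_Cderive_const l z)
       (is_Cderive_mult _ _ z _ _ (is_Cderive_mult _ _ z _ _ dz dz)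
          (is_Cderive_const (/ 2) z))).
  move=> H'; apply: is_Cderive_ext_val H' _; rewrite /g; field.
have dg z : is_Cderive g z l.
  have := is_Cderive_plus _ _ z _ _ (is_Cderive_const (f p) z)
    (is_Cderive_mult _ _ z _ _ (is_Cderive_minus _ _ z _ _ (is_Cderive_id z)
      (is_Cderive_const p z)) (is_Cderive_const l z)).
  move=> H'; apply: is_Cderive_ext_val H' _; ring.
have cg z : Ccont g z by apply: ex_Cderive_Ccont; exists l.
have g0 : rectI g a b c d = 0.
  by apply: (rectI_primitive Q g) => //.
have -> : rectI f a b c d = rectI (fun z => f z - g z) a b c d.
  by rewrite (rectI_minus f g) // g0; ring.
apply: Rle_trans (rectI_le _ _ _ _ _ (eps * (b - a + (d - c))) _ _ _ _) _ => //.
- by move=> z zr; apply: Ccont_minus; [apply: Hf|apply: cg].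
- move=> z zr.
  rewrite (_ : f z - g z = f z - f p - (z - p) * l); last by rewrite /g; ring.
  apply: Rle_trans (H z zr) _; apply: Rmult_le_compat_l => //.
  case: zr => -[z1 z2] [z3 z4].
  apply: Rle_trans (Cmod_le_abs _) _; rewrite /Cminus /Cplus /Copp /=.
  by apply: Rplus_le_compat; apply: Rabs_le; lra.
- by apply: Req_le; ring.
Qed.

(** Each left end lies below each right end, so the supremum of the left ends belongs to all the
    intervals. *)
Lemma lub_nested (x : nat -> R) (r : nat -> R) :
  (forall n, x n <= x (S n))%R -> (forall n, x (S n) + r (S n) <= x n + r n)%R ->
  (forall n, 0 <= r n)%R ->
  exists l : R, forall n, (x n <= l <= x n + r n)%R.
Proof.
move=> inc dec r0.
have up n m : (n <= m)%nat -> (x n <= x m /\ x m + r m <= x n + r n)%R.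
  elim: m => [|m IH] nm; first by (have -> : n = O by lia); lra.
  case: (Nat.eq_dec n (S m)) => [->|ne]; first lra.
  have nm' : (n <= m)%nat by lia.
  by have := IH nm'; have := inc m; have := dec m; lra.
have ub n m : (x m <= x n + r n)%R.
  case: (Nat.le_ge_cases n m) => h; have := up _ _ h; have := r0 m; have := r0 n; lra.
have [l [l1 l2]] := completeness (fun y => exists n, y = x n)
  ltac:(exists (x O + r O)%R => y [n ->]; apply: ub)
  ltac:(exists (x O); exists O; reflexivity).
exists l => n; split; first by apply: l1; exists n.
by apply: l2 => y [m ->].
Qed.

Lemma half_pow_lt (A eps : R) : (0 < eps)%R -> exists n, (A * (/ 2) ^ n < eps)%R.
Proof.
move=> e0.
have [N HN] := pow_lt_1_zero (/ 2) ltac:(rewrite Rabs_pos_eq; lra) (eps / (1 + Rabs A))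
   ltac:(apply: Rdiv_lt_0_compat; have := Rabs_pos A; lra).
exists N; have := HN N (Nat.le_refl N).
have p0 : (0 < (/ 2) ^ N)%R by apply: pow_lt; lra.
rewrite Rabs_pos_eq; last lra.
move=> h; have A0 := Rabs_pos A.
apply: Rle_lt_trans (_ : (1 + Rabs A) * (/ 2) ^ N < eps)%R.
  by apply: Rmult_le_compat_r; [lra|have := Rle_abs A; lra].
apply: (Rmult_lt_reg_l (/ (1 + Rabs A))); first by apply: Rinv_0_lt_compat; lra.
by rewrite -Rmult_assoc Rinv_l ?Rmult_1_l; [rewrite Rmult_comm|lra].
Qed.

(* Goursat: if |rectI| exceeds eps, bisection yields nested rectangles on which
   it exceeds eps / 4^n, contradicting differentiability at their common point. *)
Theorem Goursat (f : C -> C) (a b c d : R) : (a <= b)%R -> (c <= d)%R ->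
  (forall z, in_rect a b c d z -> ex_Cderive f z) -> rectI f a b c d = 0.
Proof.
move=> ab cd Hf.
have Hc : cont_rect f a b c d by move=> z /Hf; apply: ex_Cderive_Ccont.
apply: Cmod_eq_0; apply: Rle_antisym (Cmod_ge_0 _); apply: Rnot_lt_le => pos.
set E := Cmod (rectI f a b c d) in pos.
pose A n := ((b - a) * (/ 2) ^ n)%R; pose B n := ((d - c) * (/ 2) ^ n)%R.
have pw n : (0 < (/ 2) ^ n)%R by apply: pow_lt; lra.
have A0 n : (0 <= A n)%R by apply: Rmult_le_pos; [lra|have := pw n; lra].
have B0 n : (0 <= B n)%R by apply: Rmult_le_pos; [lra|have := pw n; lra].
have AS n : (A n = 2 * A (S n))%R by rewrite /A /=; field.
have BS n : (B n = 2 * B (S n))%R by rewrite /B /=; field.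
(* A rectangle is recorded by its lower left corner; at stage [n] its sides are [A n] and [B n]. *)
pose bad n (p : R * R) :=
  (a <= fst p)%R /\ (fst p + A n <= b)%R /\ (c <= snd p)%R /\ (snd p + B n <= d)%R /\
  (E * (/ 4) ^ n <= Cmod (rectI f (fst p) (fst p + A n) (snd p) (snd p + B n)))%R.
pose step n (p q : R * R) := bad (S n) q /\
  (fst p <= fst q)%R /\ (fst q + A (S n) <= fst p + A n)%R /\
  (snd p <= snd q)%R /\ (snd q + B (S n) <= snd p + B n)%R.
have next n p : bad n p -> exists q, step n p q.
  case: p => x y [/= x1 [x2 [y1 [y2 h]]]].
  have sub u u' v v' : (a <= u)%R -> (u' <= b)%R -> (c <= v)%R -> (v' <= d)%R ->
      cont_rect f u u' v v'.
    by move=> ? ? ? ? z [? ?]; apply: Hc; split; lra.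
  have A1 := A0 (S n); have B1 := B0 (S n); have A2 := AS n; have B2 := BS n.
  rewrite (rectI_split_h f x (x + A (S n))) in h; [|lra|lra|by apply: sub; lra].
  rewrite (rectI_split_v f x (x + A (S n)) y (y + B (S n))) in h;
    [|lra|lra|by apply: sub; lra].
  rewrite (rectI_split_v f (x + A (S n)) (x + A n) y (y + B (S n))) in h;
    [|lra|lra|by apply: sub; lra].
  have ex : (x + A n = x + A (S n) + A (S n))%R by lra.
  have ey : (y + B n = y + B (S n) + B (S n))%R by lra.
  rewrite ex ey in h.
  set r1 := rectI f x _ y _ in h; set r2 := rectI f x _ (y + _) _ in h.
  set r3 := rectI f (x + _) _ y _ in h; set r4 := rectI f (x + _) _ (y + _) _ in h.
  have t1 := Cmod_triangle (r1 + r2) (r3 + r4).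
  have t2 := Cmod_triangle r1 r2; have t3 := Cmod_triangle r3 r4.
  have p4 : ((/ 4) ^ n = 4 * (/ 4) ^ (S n))%R by rewrite /=; field.
  rewrite p4 in h; set e := (E * (/ 4) ^ S n)%R.
  have h' : (4 * e <= Cmod r1 + Cmod r2 + Cmod r3 + Cmod r4)%R by rewrite /e; lra.
  case: (Rle_dec e (Cmod r1)) => k1.
    by exists (x, y); rewrite /step /bad /= -/e; repeat split=> //; lra.
  case: (Rle_dec e (Cmod r2)) => k2.
    by exists (x, y + B (S n))%R; rewrite /step /bad /= -/e; repeat split=> //; lra.
  case: (Rle_dec e (Cmod r3)) => k3.
    by exists (x + A (S n), y)%R; rewrite /step /bad /= -/e; repeat split=> //; lra.
  exists (x + A (S n), y + B (S n))%R; rewrite /step /bad /= -/e -/r4.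
  by repeat split=> //; lra.
pose nx n p := epsilon (inhabits (0%R, 0%R)) (step n p).
pose P := fix P n := match n with O => (a, c) | S m => nx m (P m) end.
have Pbad n : bad n (P n).
  elim: n => [|n IH].
    rewrite /bad /A /B /= !Rmult_1_r.
    have -> : (a + (b - a) = b)%R by ring.
    have -> : (c + (d - c) = d)%R by ring.
    by repeat split; try lra; rewrite -/E; lra.
  by have [] := epsilon_spec (inhabits (0%R, 0%R)) (step n (P n)) (next n _ IH).
have Pstep n : step n (P n) (P (S n)).
  exact: epsilon_spec (inhabits (0%R, 0%R)) (step n (P n)) (next n _ (Pbad n)).
have [x Hx] := lub_nested (fun n => fst (P n)) A
  ltac:(by move=> n; case: (Pstep n) => _ [? _])
  ltac:(by move=> n; case: (Pstep n) => _ [_ [? _]]) A0.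
have [y Hy] := lub_nested (fun n => snd (P n)) B
  ltac:(by move=> n; case: (Pstep n) => _ [_ [_ [? _]]])
  ltac:(by move=> n; case: (Pstep n) => _ [_ [_ [_ ?]]]) B0.
have xy n : in_rect (fst (P n)) (fst (P n) + A n) (snd (P n)) (snd (P n) + B n) (x, y).
  by split=> /=; [apply: Hx|apply: Hy].
have [l /is_Cderive_eps Hl] : ex_Cderive f (x, y).
  apply: Hf; have [[? ?] [? ?]] := xy O; have [? [? [? [? _]]]] := Pbad O.
  by split=> /=; simpl in *; lra.
set L := (b - a + (d - c))%R.
have L0 : (0 <= L)%R by rewrite /L; lra.
(* The local estimate will give E / 4^n <= 4 eps L^2 / 4^n, whereas this choice makes 4 eps L^2 less
   than E. *)
pose eps := (E / (8 * (1 + L ^ 2)))%R.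
have L2 := pow2_ge_0 L.
have e0 : (0 < eps)%R by apply: Rdiv_lt_0_compat; lra.
have [r [r0 Hr]] := Hl eps e0.
have [n nr] := half_pow_lt L r r0.
have [/= b1 [b2 [b3 [b4 b5]]]] := Pbad n.
have AB : (A n + B n = L * (/ 2) ^ n)%R by rewrite /A /B /L; ring.
have := rectI_local f _ _ _ _ (x, y) l eps
  (_ : fst (P n) <= fst (P n) + A n)%R (_ : snd (P n) <= snd (P n) + B n)%R _ _ (xy n) _.
have A0n := A0 n; have B0n := B0 n.
move=> /(_ ltac:(lra) ltac:(lra) ltac:(lra)).
have sub : cont_rect f (fst (P n)) (fst (P n) + A n) (snd (P n)) (snd (P n) + B n).
  by move=> z [? ?]; apply: Hc; split; lra.
move=> /(_ sub) H.
have {}H := H _.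
have loc z : in_rect (fst (P n)) (fst (P n) + A n) (snd (P n)) (snd (P n) + B n) z ->
   (Cmod (f z - f (x, y) - (z - (x, y)) * l) <= eps * Cmod (z - (x, y)))%R.
  move=> [z1 z2]; apply: Hr.
  apply: Rle_lt_trans (Cmod_le_abs _) _; apply: Rle_lt_trans nr; rewrite -AB.
  have [/= x1 x2] := xy n.
  by apply: Rplus_le_compat; apply: Rabs_le; simpl; lra.
have {}H := H loc.
rewrite (_ : fst (P n) + A n - fst (P n) + (snd (P n) + B n - snd (P n)) = L * (/ 2) ^ n)%R in H;
  last by rewrite -AB; ring.
have p4 : ((/ 2) ^ n * (/ 2) ^ n = (/ 4) ^ n)%R.
  by rewrite -Rpow_mult_distr; congr pow; field.
have q4 : (0 < (/ 4) ^ n)%R by apply: pow_lt; lra.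
have H2 : (E * (/ 4) ^ n <= 4 * eps * L ^ 2 * (/ 4) ^ n)%R.
  apply: Rle_trans b5 _; apply: Rle_trans H _; apply: Req_le; rewrite -p4; ring.
have {}H2 := Rmult_le_reg_r _ _ _ q4 H2.
have : (4 * eps * L ^ 2 < E)%R.
  have -> : (4 * eps * L ^ 2 = E * (L ^ 2 / (2 * (1 + L ^ 2))))%R by rewrite /eps; field; lra.
  rewrite -[X in (_ < X)%R]Rmult_1_r; apply: Rmult_lt_compat_l => //.
  apply: (Rmult_lt_reg_r (2 * (1 + L ^ 2))); first lra.
  by rewrite /Rdiv Rmult_assoc Rinv_l; lra.
lra.
Qed.

Lemma rectI_degenerate_h f a c d : rectI f a a c d = 0.
Proof. by rewrite /rectI /Hint !CInt_point; ring. Qed.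

Lemma rectI_degenerate_v f a b c : rectI f a b c c = 0.
Proof. by rewrite /rectI /Vint !CInt_point; ring. Qed.

(* Only an arbitrarily small square around [p] contributes. *)
Lemma Goursat_except (f : C -> C) (p : C) (a b c d : R) : (a <= b)%R -> (c <= d)%R ->
  cont_rect f a b c d ->
  (forall z, in_rect a b c d z -> z <> p -> ex_Cderive f z) -> rectI f a b c d = 0.
Proof.
move=> ab cd Hc Hf.
case: (excluded_middle_informative (in_rect a b c d p)) => pr; last first.
  by apply: Goursat => // z zr; apply: Hf => // zp; apply: pr; rewrite -zp.
apply: Cmod_eq_0; apply: Rle_antisym (Cmod_ge_0 _).
have [r [r0 Hr]] := Hc p pr 1%R Rlt_0_1.
set M := (Cmod (f p) + 1)%R.
have M0 : (0 < M)%R by rewrite /M; have := Cmod_ge_0 (f p); lra.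
(* The sides of the small rectangle around [p] add up to at most 4 e, and [rectI_le] contributes
   another factor 4; [e < r / 2] keeps it in the disc where |f| <= M. *)
suff small : forall e, (0 < e)%R -> (e < r / 2)%R -> (Cmod (rectI f a b c d) <= 16 * e * M)%R.
  apply: le_epsilon => eps e0.
  have q0 : (0 < eps / (16 * M))%R by apply: Rdiv_lt_0_compat; lra.
  apply: Rle_trans (small (Rmin (r / 4) (eps / (16 * M))) _ _) _.
  - by apply: Rmin_pos; lra.
  - by have := Rmin_l (r / 4) (eps / (16 * M)); lra.
  - have := Rmin_r (r / 4) (eps / (16 * M)) => h.
    apply: (Rle_trans _ (16 * (eps / (16 * M)) * M)); last by apply: Req_le; field; lra.
    by apply: Rmult_le_compat_r; lra.
move=> e e0 er.
have [[p1 p2] [p3 p4]] := pr.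
(* The square of half-side [e] around [p], clipped to the given rectangle. The final alternatives
   ensure that each of the four surrounding pieces is degenerate or avoids [p]. *)
have [a' [a1 [a2 [a3 a4]]]] : exists a', (a <= a')%R /\ (a' <= fst p)%R /\ (fst p - e <= a')%R /\
    (a' = a \/ a' < fst p)%R.
  case: (Rle_dec a (fst p - e)) => h; first by exists (fst p - e)%R; lra.
  by exists a; lra.
have [b' [b1 [b2 [b3 b4]]]] : exists b', (b' <= b)%R /\ (fst p <= b')%R /\ (b' <= fst p + e)%R /\
    (b' = b \/ fst p < b')%R.
  case: (Rle_dec (fst p + e) b) => h; first by exists (fst p + e)%R; lra.
  by exists b; lra.
have [c' [c1 [c2 [c3 c4]]]] : exists a', (c <= a')%R /\ (a' <= snd p)%R /\ (snd p - e <= a')%R /\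
    (a' = c \/ a' < snd p)%R.
  case: (Rle_dec c (snd p - e)) => h; first by exists (snd p - e)%R; lra.
  by exists c; lra.
have [d' [d1 [d2 [d3 d4]]]] : exists b', (b' <= d)%R /\ (snd p <= b')%R /\ (b' <= snd p + e)%R /\
    (b' = d \/ snd p < b')%R.
  case: (Rle_dec (snd p + e) d) => h; first by exists (snd p + e)%R; lra.
  by exists d; lra.
have sub u u' v v' : (a <= u)%R -> (u' <= b)%R -> (c <= v)%R -> (v' <= d)%R ->
    cont_rect f u u' v v'.
  by move=> ? ? ? ? z [? ?]; apply: Hc; split; lra.
rewrite (rectI_split_h f a a' b) //; last lra.
rewrite (rectI_split_h f a' b' b); [|lra|lra|by apply: sub; lra].
rewrite (rectI_split_v f a' b' c c' d); [|lra|lra|by apply: sub; lra].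
rewrite (rectI_split_v f a' b' c' d' d); [|lra|lra|by apply: sub; lra].
have -> : rectI f a a' c d = 0.
  case: a4 => [->|a4]; first exact: rectI_degenerate_h.
  by apply: Goursat => // z [? ?]; apply: Hf; [split; lra|move=> zp; subst; lra].
have -> : rectI f b' b c d = 0.
  case: b4 => [->|b4]; first exact: rectI_degenerate_h.
  by apply: Goursat => // z [? ?]; apply: Hf; [split; lra|move=> zp; subst; lra].
have -> : rectI f a' b' c c' = 0.
  case: c4 => [->|c4]; first exact: rectI_degenerate_v.
  apply: Goursat => //; first lra.
  by move=> z [? ?]; apply: Hf; [split; lra|move=> zp; subst; lra].
have -> : rectI f a' b' d' d = 0.
  case: d4 => [->|d4]; first exact: rectI_degenerate_v.
  apply: Goursat => //; first lra.
  by move=> z [? ?]; apply: Hf; [split; lra|move=> zp; subst; lra].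
rewrite (_ : 0 + (0 + (rectI f a' b' c' d' + 0) + 0) = rectI f a' b' c' d'); last ring.
apply: Rle_trans (rectI_le f _ _ _ _ M _ _ _ _) _; [lra|lra|by apply: sub; lra| |].
  move=> z [z1 z2]; rewrite (_ : f z = f p + (f z - f p)); last ring.
  apply: Rle_trans (Cmod_triangle _ _) _; apply: Rplus_le_compat_l; apply: Rlt_le.
  apply: Hr; apply: Rle_lt_trans (Cmod_le_abs _) _; simpl.
  have q1 : (Rabs (fst z + - fst p) <= e)%R by apply: Rabs_le; lra.
  have q2 : (Rabs (snd z + - snd p) <= e)%R by apply: Rabs_le; lra.
  lra.
rewrite -Rmult_assoc; apply: Rmult_le_compat_r; lra.
Qed.

(** * Primitives in the strip *)

Definition strip (u : C) : Prop := (- PI < snd u < PI)%R.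

Section StripPrimitive.
Context (g : C -> C) (g_cont : forall u, strip u -> Ccont g u)
  (g_diff : forall u, strip u -> u <> 0 -> ex_Cderive g u).

Let ph y s t : (- PI < y < PI)%R -> pcont_on (fun x => g (x, y)) s t.
Proof. by move=> yp x _; apply: pcont_h; apply: g_cont. Qed.

Let pv x s t : (- PI < s < PI)%R -> (- PI < t < PI)%R ->
  pcont_on (fun y => Ci * g (x, y)) s t.
Proof.
move=> sp tp y [y1 y2]; apply: pcont_v; apply: g_cont; split=> /=.
  by apply: Rlt_le_trans y1; apply: Rmin_glb_lt; lra.
by apply: Rle_lt_trans y2 _; apply: Rmax_lub_lt; lra.
Qed.

(** The two L-shaped paths from (s, 0) to (t, y) bound a rectangle; the sign of [y] decides which of
    its horizontal sides is the lower one. *)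
Let path_eq s t y : (- PI < y < PI)%R ->
  Hint g 0 s t + Vint g t 0 y = Hint g y s t + Vint g s 0 y.
Proof.
move=> yp; have P0 := PI_RGT_0.
wlog st : s t / (s <= t)%R.
  move=> H; case: (Rle_dec s t) => st; first exact: H.
  have {}H := H t s ltac:(lra).
  rewrite /Hint (CInt_swap _ t s) ?(CInt_swap (fun x => g (x, y)) t s) //; try (by apply: ph; lra).
  rewrite -/(Hint g 0 t s) -/(Hint g y t s).
  rewrite (_ : Vint g t 0 y = Hint g 0 t s + Vint g s 0 y - Hint g y t s); first ring.
  by rewrite H; ring.
have G c d : (- PI < c < PI)%R -> (- PI < d < PI)%R -> (c <= d)%R -> rectI g s t c d = 0.
  move=> cp dp cd; apply: (Goursat_except g 0) => //.
    by move=> z [_ ?]; apply: g_cont; rewrite /strip; lra.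
  by move=> z [_ ?]; apply: g_diff; rewrite /strip; lra.
case: (Rle_dec 0 y) => y0.
  have := G 0%R y ltac:(lra) ltac:(lra) y0; rewrite /rectI => e.
  rewrite -(Cplus_0_r (Hint g y s t + _)) -e; ring.
have := G y 0%R ltac:(lra) ltac:(lra) ltac:(lra); rewrite /rectI => e.
have sw x : Vint g x y 0 = - Vint g x 0 y by apply: CInt_swap; apply: pv; lra.
rewrite !sw in e.
rewrite -(Cplus_0_r (Hint g 0 s t + _)) -e; ring.
Qed.

(** The primitive integrates along the real axis and then vertically. By [path_eq] its increment is
    an integral over two short segments near [u], where [g] is close to its value at [u]. *)
Lemma strip_primitive : exists F : C -> C, F 0 = 0 /\
  forall u, strip u -> is_Cderive F u (g u).
Proof.
have P0 := PI_RGT_0.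
pose F (u : C) := Hint g 0 0 (fst u) + Vint g (fst u) 0 (snd u).
exists F; split; first by rewrite /F /Hint /Vint !CInt_point; ring.
move=> [x y] up; rewrite /strip /= in up.
apply/is_Cderive_eps => eps e0.
(* Each of the two short segments costs 2 rho (eps / 4), with rho the distance to the base point. *)
have [r [r0 Hr]] := g_cont (x, y) up (eps / 4)%R ltac:(lra).
exists (Rmin (r / 2) (Rmin (PI - y) (y + PI))); split.
  by do ! apply: Rmin_pos; lra.
move=> [x' y'] wd.
have wd1 := Rlt_le_trans _ _ _ wd (Rmin_l _ _).
have wd2 := Rlt_le_trans _ _ _ (Rlt_le_trans _ _ _ wd (Rmin_r _ _)) (Rmin_l _ _).
have wd3 := Rlt_le_trans _ _ _ (Rlt_le_trans _ _ _ wd (Rmin_r _ _)) (Rmin_r _ _).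
have m1 := fst_le_Cmod ((x', y') - (x, y)); have m2 := snd_le_Cmod ((x', y') - (x, y)).
rewrite /= -!/(Rminus _ _) in m1 m2.
have yp' : (- PI < y' < PI)%R.
  by move: (Rle_lt_trans _ _ _ m2 wd2) (Rle_lt_trans _ _ _ m2 wd3);
     rewrite /Rabs; case: Rcase_abs; lra.
set rho := Cmod ((x', y') - (x, y)) in wd1 m1 m2 *.
have rho0 : (0 <= rho)%R by apply: Cmod_ge_0.
have dF : F (x', y') - F (x, y) = Hint g y x x' + Vint g x' y y'.
  rewrite /F /=.
  have -> : Hint g 0 0 x' = Hint g 0 0 x + Hint g 0 x x'.
    by symmetry; apply: CInt_Chasles; apply: ph; lra.
  have -> : Vint g x' 0 y' = Vint g x' 0 y + Vint g x' y y'.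
    by symmetry; apply: CInt_Chasles; apply: pv; lra.
  have e := path_eq x x' y up.
  rewrite (_ : Hint g 0 x x' = Hint g y x x' + Vint g x 0 y - Vint g x' 0 y); first ring.
  by rewrite -e; ring.
pose k : C -> C := fun _ => g (x, y).
have ck z : Ccont k z.
  by apply: ex_Cderive_Ccont; exists (RtoC 0); apply: is_Cderive_const.
have dk z : is_Cderive (fun t => t * g (x, y)) z (k z).
  apply: is_Cderive_ext_val (is_Cderive_mult _ _ z _ _ (is_Cderive_id z)
    (is_Cderive_const (g (x, y)) z)) _; rewrite /k; ring.
have kh : Hint k y x x' = (x', y) * g (x, y) - (x, y) * g (x, y).
  by apply: (Hint_derive (fun t => t * g (x, y))).
have kv : Vint k x' y y' = (x', y') * g (x, y) - (x', y) * g (x, y).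
  by apply: (Vint_derive (fun t => t * g (x, y))).
have -> : F (x', y') - F (x, y) - ((x', y') - (x, y)) * g (x, y) =
   (Hint g y x x' - Hint k y x x') + (Vint g x' y y' - Vint k x' y y').
  by rewrite dF kh kv; ring.
have near x1 y1 : (Rmin x x' <= x1 <= Rmax x x')%R -> (Rmin y y' <= y1 <= Rmax y y')%R ->
   (Cmod (g (x1, y1) - g (x, y)) <= eps / 4)%R.
  move=> h1 h2; apply: Rlt_le; apply: Hr.
  have q1 : (Rabs (x1 - x) <= Rabs (x' - x))%R.
    by move: h1; rewrite /Rmin /Rmax /Rabs; case: Rle_dec; do 2 case: Rcase_abs; lra.
  have q2 : (Rabs (y1 - y) <= Rabs (y' - y))%R.
    by move: h2; rewrite /Rmin /Rmax /Rabs; case: Rle_dec; do 2 case: Rcase_abs; lra.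
  apply: Rle_lt_trans (Cmod_le_abs _) _; rewrite /= -!/(Rminus _ _); lra.
have b1 : (Cmod (Hint g y x x' - Hint k y x x') <= 2 * (rho * (eps / 4)))%R.
  rewrite -CInt_minus; [|by apply: ph|by move=> t _; apply: pcont_h].
  apply: Rle_trans (CInt_le_abs _ _ _ (eps / 4) _ _) _.
  - move=> t _; apply: (pcont_h (fun z => g z - k z)).
    by apply: Ccont_minus => //; apply: g_cont.
  - move=> t h; apply: near => //; split; [exact: Rmin_l|exact: Rmax_l].
  - by apply: Rmult_le_compat_l; [lra|apply: Rmult_le_compat_r; lra].
have b2 : (Cmod (Vint g x' y y' - Vint k x' y y') <= 2 * (rho * (eps / 4)))%R.
  rewrite -CInt_minus; [|by apply: pv|by move=> t _; apply: pcont_v].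
  rewrite (CInt_ext _ (fun t => Ci * (g (x', t) - k (x', t)))); last by move=> t _; ring.
  apply: Rle_trans (CInt_le_abs _ _ _ (eps / 4) _ _) _.
  - move=> t [t1 t2]; apply: (pcont_v (fun z => g z - k z)).
    apply: Ccont_minus => //; apply: g_cont; split=> /=.
      by apply: Rlt_le_trans t1; apply: Rmin_glb_lt; lra.
    by apply: Rle_lt_trans t2 _; apply: Rmax_lub_lt; lra.
  - move=> t h; rewrite Cmod_mult Cmod_Ci Rmult_1_l.
    by apply: near => //; split; [exact: Rmin_r|exact: Rmax_r].
  - by apply: Rmult_le_compat_l; [lra|apply: Rmult_le_compat_r; lra].
by apply: Rle_trans (Cmod_triangle _ _) _; lra.
Qed.
End StripPrimitive.

(** * The exponential and Liouville's theorem *)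

Definition Cexp (u : C) : C :=
  ((exp (fst u) * cos (snd u))%R, (exp (fst u) * sin (snd u))%R).

Lemma Cexp_plus (u v : C) : Cexp (u + v) = Cexp u * Cexp v.
Proof.
rewrite /Cexp /Cmult /Cplus /= exp_plus cos_plus sin_plus; congr pair; ring.
Qed.

Lemma Cexp_0 : Cexp 0 = 1.
Proof. by rewrite /Cexp /= exp_0 cos_0 sin_0 Rmult_0_r Rmult_1_r. Qed.

Lemma Cexp_RtoC (x : R) : Cexp x = exp x.
Proof. by rewrite /Cexp /= cos_0 sin_0 Rmult_1_r Rmult_0_r. Qed.

Lemma Cmod_Cexp (u : C) : Cmod (Cexp u) = exp (fst u).
Proof.
rewrite /Cmod /Cexp /=.
rewrite (_ : _ + _ = (exp (fst u))²)%R; first by rewrite sqrt_Rsqr //; apply/Rlt_le/exp_pos.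
have := sin2_cos2 (snd u); rewrite /Rsqr => e.
transitivity (exp (fst u) * exp (fst u) *
  (sin (snd u) * sin (snd u) + cos (snd u) * cos (snd u)))%R; first ring.
by rewrite e /Rsqr; ring.
Qed.

Lemma Cexp_neq_0 (u : C) : Cexp u <> 0.
Proof. by apply/Cmod_gt_0; rewrite Cmod_Cexp; apply: exp_pos. Qed.

Lemma Cexp_periodic (x : R) : Cexp (x, (2 * PI)%R) = Cexp (x, 0%R).
Proof. by rewrite /Cexp /= cos_2PI sin_2PI cos_0 sin_0. Qed.

Lemma derivable_pt_lim_0 (f : R -> R) (l : R) : derivable_pt_lim f 0 l ->
  forall eps, (0 < eps)%R -> exists d, (0 < d)%R /\ forall h, (Rabs h < d)%R ->
  (Rabs (f h - f 0 - h * l) <= eps * Rabs h)%R.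
Proof.
move=> H eps e0; have [[d d0] Hd] := H eps e0; exists d; split=> // h hd.
case: (Req_dec h 0) => [->|h0].
  by rewrite (_ : f 0 - f 0 - 0 * l = 0)%R; [rewrite Rabs_R0; lra|ring].
have := Hd h h0 hd; rewrite Rplus_0_l => k.
have -> : (f h - f 0 - h * l = ((f h - f 0) / h - l) * h)%R by field.
rewrite Rabs_mult; apply: Rmult_le_compat_r; [exact: Rabs_pos|lra].
Qed.

(** The addition formula reduces the claim to the origin, where the first-order expansions of the
    real functions exp, cos and sin are combined. *)
Lemma is_Cderive_Cexp (u : C) : is_Cderive Cexp u (Cexp u).
Proof.
have H0 : forall eps, (0 < eps)%R -> exists d, (0 < d)%R /\ forall h : C, (Cmod h < d)%R ->
    (Cmod (Cexp h - 1 - h) <= eps * Cmod h)%R.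
  (* The errors of the real and imaginary parts will be at most 4 e |h| and 5 e |h|, hence
     [eps / 12]; [e <= 1] keeps exp bounded by 3. *)
  move=> eps e0; set e := Rmin 1 (eps / 12).
  have ee : (0 < e)%R by apply: Rmin_pos; lra.
  have [d1 [d10 H1]] := derivable_pt_lim_0 _ _ derivable_pt_lim_exp_0 e ee.
  have [d2 [d20 H2]] := derivable_pt_lim_0 _ _ (derivable_pt_lim_cos 0) e ee.
  have [d3 [d30 H3]] := derivable_pt_lim_0 _ _ (derivable_pt_lim_sin 0) e ee.
  rewrite exp_0 in H1; rewrite cos_0 sin_0 in H2; rewrite sin_0 cos_0 in H3.
  exists (Rmin (Rmin d1 d2) (Rmin d3 e)); split.
    by apply: Rmin_pos; apply: Rmin_pos.
  move=> h hd.
  have hd1 := Rlt_le_trans _ _ _ (Rlt_le_trans _ _ _ hd (Rmin_l _ _)) (Rmin_l _ _).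
  have hd2 := Rlt_le_trans _ _ _ (Rlt_le_trans _ _ _ hd (Rmin_l _ _)) (Rmin_r _ _).
  have hd3 := Rlt_le_trans _ _ _ (Rlt_le_trans _ _ _ hd (Rmin_r _ _)) (Rmin_l _ _).
  have hd4 := Rlt_le_trans _ _ _ (Rlt_le_trans _ _ _ hd (Rmin_r _ _)) (Rmin_r _ _).
  have m1 := fst_le_Cmod h; have m2 := snd_le_Cmod h.
  case: h hd hd1 hd2 hd3 hd4 m1 m2 => x y /= hd hd1 hd2 hd3 hd4 m1 m2.
  set m := Cmod (x, y) in hd hd1 hd2 hd3 hd4 m1 m2 *.
  have k1 := H1 x ltac:(lra); have k2 := H2 y ltac:(lra); have k3 := H3 y ltac:(lra).
  have e1 : (e <= 1)%R by apply: Rmin_l.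
  have e12 : (e <= eps / 12)%R by apply: Rmin_r.
  have m0 : (0 <= m)%R by apply: Cmod_ge_0.
  have em : (e * Rabs x <= e * m)%R by apply: Rmult_le_compat_l; lra.
  have em' : (e * Rabs y <= e * m)%R by apply: Rmult_le_compat_l; lra.
  have E1 : (Rabs (exp x - 1) <= 2 * e)%R.
    have := Rabs_triang (exp x - 1 - x * 1) x.
    rewrite (_ : exp x - 1 - x * 1 + x = exp x - 1)%R; last ring.
    have : (e * m <= 1 * e)%R by rewrite Rmult_comm; apply: Rmult_le_compat_r; lra.
    lra.
  have E2 : (Rabs (exp x) <= 3)%R.
    have := Rabs_triang (exp x - 1) 1; rewrite Rabs_R1.
    rewrite (_ : exp x - 1 + 1 = exp x)%R; [lra|ring].
  have re : (Rabs (exp x * cos y - 1 - x) <= 4 * (e * m))%R.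
    have -> : (exp x * cos y - 1 - x = (exp x - 1 - x * 1) + exp x * (cos y - 1 - y * - 0))%R.
      ring.
    apply: Rle_trans (Rabs_triang _ _) _; rewrite Rabs_mult.
    have : (Rabs (exp x) * Rabs (cos y - 1 - y * - 0) <= 3 * (e * m))%R.
      by apply: Rmult_le_compat; try exact: Rabs_pos; lra.
    lra.
  have im : (Rabs (exp x * sin y - y) <= 5 * (e * m))%R.
    have -> : (exp x * sin y - y = exp x * (sin y - 0 - y * 1) + (exp x - 1) * y)%R.
      ring.
    apply: Rle_trans (Rabs_triang _ _) _; rewrite !Rabs_mult.
    have : (Rabs (exp x) * Rabs (sin y - 0 - y * 1) <= 3 * (e * m))%R.
      by apply: Rmult_le_compat; try exact: Rabs_pos; lra.
    have : (Rabs (exp x - 1) * Rabs y <= (2 * e) * m)%R.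
      by apply: Rmult_le_compat; try exact: Rabs_pos; lra.
    lra.
  apply: Rle_trans (Cmod_le_abs _) _.
  rewrite /Cminus /Cplus /Copp /Cexp /=.
  rewrite (_ : exp x * sin y + - 0 + - y = exp x * sin y - y)%R; last ring.
  rewrite -!/(Rminus _ _).
  have : (e * m <= eps / 12 * m)%R by apply: Rmult_le_compat_r.
  have : (0 <= eps * m)%R by apply: Rmult_le_pos; lra.
  lra.
apply/is_Cderive_eps => eps e0.
have c0 : (0 < Cmod (Cexp u))%R by apply/Cmod_gt_0/Cexp_neq_0.
have [d [d0 Hd]] := H0 (eps / Cmod (Cexp u))%R ltac:(apply: Rdiv_lt_0_compat; lra).
exists d; split=> // w wd.
have -> : Cexp w = Cexp u * Cexp (w - u).
  by rewrite -Cexp_plus; congr Cexp; ring.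
have -> : Cexp u * Cexp (w - u) - Cexp u - (w - u) * Cexp u =
  Cexp u * (Cexp (w - u) - 1 - (w - u)) by ring.
rewrite Cmod_mult; apply: Rle_trans (Rmult_le_compat_l _ _ _ (Rlt_le _ _ c0) (Hd _ wd)) _.
by apply: Req_le; field; lra.
Qed.

Lemma Cexp_eq_1 (u : C) : strip u -> Cexp u = 1 -> u = 0.
Proof.
case: u => x y; rewrite /strip /Cexp /= => yp [e1 e2].
have s0 : sin y = 0%R.
  by case: (Rmult_integral _ _ e2) => // h; have := exp_pos x; lra.
have y0 : y = 0%R.
  case: (Rtotal_order y 0) => [h|[//|h]].
    by have := sin_gt_0 (- y) ltac:(lra) ltac:(lra); rewrite sin_neg s0; lra.
  by have := sin_gt_0 y ltac:(lra) ltac:(lra); rewrite s0; lra.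
move: e1; rewrite y0 cos_0 Rmult_1_r -exp_0 => /exp_inv ->; by [].
Qed.

(* For z <> 0 the circle mean of (h(a + z) - h a) / z does not depend on the
   radius, by Goursat in the coordinate log z; it is h'(a) for small radii and
   tends to 0 for large ones. *)
Theorem Liouville_derivative (h : C -> C) :
  (forall z, ex_Cderive h z) ->
  (forall eps, (0 < eps)%R -> exists M, forall z l : C, (M < Cmod z)%R ->
     is_Cderive h z l -> (Cmod l <= eps)%R) ->
  forall a l : C, is_Cderive h a l -> l = 0.
Proof.
move=> hd hv a l al.
have P0 := PI_RGT_0.
apply: Cmod_eq_0; apply: Rle_antisym (Cmod_ge_0 _); apply: le_epsilon => eps4 e40.
rewrite Rplus_0_l.
(* The small circle will cost 2 T eps and the large one 4 T eps, out of T times |l|. *)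
set eps := (eps4 / 8)%R; have e0 : (0 < eps)%R by rewrite /eps; lra.
pose g z := (h (a + z) - h a) / z.
pose phi zeta := g (Cexp zeta).
have dphi z : ex_Cderive phi z.
  have [m Hm] := hd (a + Cexp z).
  eexists; apply: is_Cderive_mult.
    apply: is_Cderive_minus; last exact: is_Cderive_const.
    apply: (is_Cderive_comp h (fun z => a + Cexp z)); first exact: Hm.
    apply: is_Cderive_plus; [exact: is_Cderive_const|exact: is_Cderive_Cexp].
  apply: (is_Cderive_comp Cinv Cexp); last exact: is_Cderive_Cexp.
  exact/is_Cderive_inv/Cexp_neq_0.
have cphi z : Ccont phi z by apply: ex_Cderive_Ccont.
pose T := (2 * PI)%R.
(* The horizontal sides at heights 0 and 2 PI cancel by periodicity. *)
have V_eq s1 s2 : (s1 <= s2)%R -> Vint phi s1 0 T = Vint phi s2 0 T.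
  move=> s12; have := Goursat phi s1 s2 0 T s12 ltac:(rewrite /T; lra) (fun z _ => dphi z).
  rewrite /rectI.
  have -> : Hint phi T s1 s2 = Hint phi 0 s1 s2.
    by apply: CInt_ext => t _; rewrite /phi Cexp_periodic.
  move=> e; rewrite -(Cplus_0_r (Vint phi s1 0 T)) -e; ring.
have pv f x s t : (forall z, Ccont f z) -> pcont_on (fun y => Ci * f (x, y)) s t.
  by move=> cf y _; apply: pcont_v.
have V_le s M : (forall t, (0 <= t <= T)%R -> (Cmod (phi (s, t)) <= M)%R) ->
    (Cmod (Vint phi s 0 T) <= 2 * (T * M))%R.
  move=> H; apply: Rle_trans (CInt_le _ 0 T M _ _ _) _; [by rewrite /T; lra|exact: pv| |].
    by move=> t tT; rewrite Cmod_mult Cmod_Ci Rmult_1_l; apply: H.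
  by rewrite Rminus_0_r; lra.
move/is_Cderive_eps: (al) => /(_ eps e0) [d [d0 Hd]].
set s1 := ln (d / 2).
have es1 : exp s1 = (d / 2)%R by rewrite exp_ln //; lra.
have near_a : (Cmod (Vint phi s1 0 T - T * Ci * l) <= 2 * (T * eps))%R.
  have ck z : Ccont (fun _ => l) z.
    by apply: ex_Cderive_Ccont; exists (RtoC 0); apply: is_Cderive_const.
  have -> : T * Ci * l = Vint (fun _ => l) s1 0 T.
    rewrite (Vint_derive (fun t => t * l)) //.
      by rewrite (vline s1 T); ring.
    move=> y _; apply: is_Cderive_ext_val (is_Cderive_mult _ _ _ _ _ (is_Cderive_id _)
      (is_Cderive_const l _)) _; ring.
  rewrite -CInt_minus; [|exact: pv|exact: (pv (fun _ => l))].
  apply: Rle_trans (CInt_le _ 0 T eps _ _ _) _; [by rewrite /T; lra| | |]; last first.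
    by rewrite Rminus_0_r; lra.
    move=> t _; rewrite (_ : Ci * phi (s1, t) - Ci * l = Ci * (phi (s1, t) - l)); last ring.
    rewrite Cmod_mult Cmod_Ci Rmult_1_l /phi /g.
    set z := Cexp (s1, t).
    have zm : Cmod z = (d / 2)%R by rewrite Cmod_Cexp.
    have z0 : z <> 0 by apply: Cexp_neq_0.
    have -> : (h (a + z) - h a) / z - l = (h (a + z) - h a - (a + z - a) * l) / z by field.
    rewrite Cmod_div //.
    have := Hd (a + z); rewrite (_ : a + z - a = z); last ring.
    rewrite zm => /(_ ltac:(lra)) k.
    apply: (Rmult_le_reg_r (d / 2)); first lra.
    by rewrite /Rdiv Rmult_assoc Rinv_l; lra.
  move=> y _; apply: pcont_eps => e' e'0.
  have [r [r0 Hr]] := cphi (s1, y) e' e'0; exists r; split=> // s sy.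
  rewrite (_ : Ci * phi (s1, s) - Ci * l - (Ci * phi (s1, y) - Ci * l) =
    Ci * (phi (s1, s) - phi (s1, y))); last ring.
  rewrite Cmod_mult Cmod_Ci Rmult_1_l; apply: Hr.
  rewrite (_ : (s1, s) - (s1, y) = Ci * RtoC (s - y)).
    by rewrite Cmod_mult Cmod_Ci Rmult_1_l Cmod_R.
  by rewrite /Ci /RtoC /Cminus /Cplus /Copp /Cmult /=; congr pair; ring.
have [M HM] := hv eps e0.
have am := Cmod_ge_0 a.
(* For |w| >= r0 the point a + w has modulus greater than M, so that the derivative of [h] is at
   most eps there. *)
set r0 := (Rabs M + Cmod a + 1)%R.
have r00 : (0 < r0)%R by rewrite /r0; have := Rabs_pos M; lra.
set s0 := ln r0; have es0 : exp s0 = r0 by rewrite exp_ln.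
have [B HB] : exists B, forall t, (0 <= t <= T)%R -> (Cmod (h (a + Cexp (s0, t))%C - h a) <= B)%R.
  have [] := continuity_ab_maj (fun t => Cmod (h (a + Cexp (s0, t))%C - h a)) 0 T.
  - by rewrite /T; lra.
  - move=> t _; apply/continuity_pt_filterlim.
    suff : continuous (fun t => Cmod (h (a + Cexp (s0, t))%C - h a)) t by [].
    apply: continuous_eps => e' e'0.
    have [m Hm] := hd (a + Cexp (s0, t)).
    have cq : Ccont (fun z => h (a + Cexp z)) (s0, t).
      apply: ex_Cderive_Ccont; eexists.
      apply: (is_Cderive_comp h (fun z => a + Cexp z)); first exact: Hm.
      by apply: is_Cderive_plus; [exact: is_Cderive_const|exact: is_Cderive_Cexp].
    have [r [rr Hr]] := cq e' e'0; exists r; split=> // s sr.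
    apply: Rle_lt_trans
      (_ : Rabs (_ - _) <= Cmod (h (a + Cexp (s0, s))%C - h (a + Cexp (s0, t))%C))%R _.
      pose p := h (a + Cexp (s0, s)) - h a; pose q := h (a + Cexp (s0, t)) - h a.
      rewrite -/p -/q.
      have := Cmod_triangle q (p - q); have := Cmod_triangle p (q - p).
      rewrite (_ : q + (p - q) = p); last ring; rewrite (_ : p + (q - p) = q); last ring.
      rewrite -(Cmod_opp (q - p)) (_ : - (q - p) = p - q); last ring.
      rewrite (_ : h (a + Cexp (s0, s))%C - h (a + Cexp (s0, t))%C = p - q);
        last by rewrite /p /q; ring.
      by move=> k1 k2; apply: Rabs_le; lra.
    apply: Hr.
    rewrite (_ : (s0, s) - (s0, t) = Ci * RtoC (s - t)).
      by rewrite Cmod_mult Cmod_Ci Rmult_1_l Cmod_R.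
    by rewrite /Ci /RtoC /Cminus /Cplus /Copp /Cmult /=; congr pair; ring.
  by move=> Mx [HMx _]; exists (Cmod (h (a + Cexp (s0, Mx))%C - h a)).
have B0 : (0 <= B)%R.
  by apply: Rle_trans (HB 0%R _); [exact: Cmod_ge_0|rewrite /T; lra].
(* On the circle of radius r2 the increment of [h] is at most B + eps (r2 - r0); the summand
   [B / eps] makes this at most 2 eps r2, and [d / 2] keeps r2 above the small radius. *)
set r2 := (r0 + d / 2 + B / eps)%R.
have Be : (0 <= B / eps)%R.
  by apply: Rmult_le_pos => //; apply: Rlt_le; apply: Rinv_0_lt_compat.
have r20 : (0 < r2)%R by rewrite /r2; lra.
set s2 := ln r2; have es2 : exp s2 = r2 by rewrite exp_ln.
have s12 : (s1 <= s2)%R.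
  by apply: ln_le; [lra|rewrite /r2; lra].
have far : (Cmod (Vint phi s2 0 T) <= 2 * (T * (2 * eps)))%R.
  apply: V_le => t tT; rewrite /phi /g Cmod_div; last exact: Cexp_neq_0.
  rewrite Cmod_Cexp /= es2.
  apply: (Rmult_le_reg_r r2) => //; rewrite /Rdiv Rmult_assoc Rinv_l ?Rmult_1_r; last lra.
  have q : (Cmod (h (a + Cexp (s2, t))%C - h (a + Cexp (s0, t))%C) <= eps * (r2 - r0))%R.
    have eC s : Cexp (s, t) = RtoC (exp s) * Cexp (0%R, t).
      rewrite -Cexp_RtoC -Cexp_plus; congr Cexp; rewrite /RtoC /Cplus /=; congr pair; ring.
    have m1 : Cmod (Cexp (0%R, t)) = 1%R by rewrite Cmod_Cexp /= exp_0.
    have := mean_value_le h (a + Cexp (s0, t))%C (a + Cexp (s2, t)) eps (fun _ _ => hd _).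
    have -> : a + Cexp (s2, t) - (a + Cexp (s0, t)) = RtoC (r2 - r0) * Cexp (0%R, t).
      by rewrite !(eC s2, eC s0) es2 es0 RtoC_minus; ring.
    rewrite (Cmod_mult (RtoC (r2 - r0))) m1 Cmod_R Rabs_pos_eq ?Rmult_1_r; last by rewrite /r2; lra.
    apply=> x m x01; apply: HM.
    rewrite (_ : a + Cexp (s0, t) + x * ((r2 - r0)%R * Cexp (0%R, t)) =
      a + RtoC (r0 + x * (r2 - r0)) * Cexp (0%R, t)); last first.
      by rewrite (eC s0) es0 RtoC_plus RtoC_mult; ring.
    set w := RtoC _ * _.
    have wm : Cmod w = (r0 + x * (r2 - r0))%R.
      rewrite /w Cmod_mult m1 Cmod_R Rmult_1_r Rabs_pos_eq //.
      have : (0 <= x * (r2 - r0))%R by apply: Rmult_le_pos; rewrite /r2; lra.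
      lra.
    have := Cmod_triangle (a + w) (- a); rewrite (_ : a + w + - a = w); last ring.
    rewrite Cmod_opp wm.
    have : (0 <= x * (r2 - r0))%R by apply: Rmult_le_pos; rewrite /r2; lra.
    have := Rle_abs M; rewrite /r0; lra.
  have -> : h (a + Cexp (s2, t))%C - h a = (h (a + Cexp (s2, t))%C - h (a + Cexp (s0, t))%C) +
     (h (a + Cexp (s0, t))%C - h a) by ring.
  apply: Rle_trans (Cmod_triangle _ _) _.
  have b := HB t tT.
  have : (B = eps * (B / eps))%R by field; lra.
  have : (0 <= eps * r0)%R by apply: Rmult_le_pos; lra.
  have : (0 <= eps * (d / 2))%R by apply: Rmult_le_pos; lra.
  have : (eps * r2 = eps * r0 + eps * (d / 2) + eps * (B / eps))%R by rewrite /r2; ring.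
  lra.
have : (Cmod (T * Ci * l) <= T * (6 * eps))%R.
  have -> : T * Ci * l = Vint phi s2 0 T - (Vint phi s1 0 T - T * Ci * l).
    by rewrite (V_eq s1 s2 s12); ring.
  apply: Rle_trans (Cmod_triangle _ _) _; rewrite Cmod_opp; lra.
rewrite !Cmod_mult Cmod_Ci Cmod_R Rmult_1_r Rabs_pos_eq; last by rewrite /T; lra.
move=> k; have {}k := Rmult_le_reg_l T _ _ ltac:(rewrite /T; lra) k.
by rewrite /eps in k; lra.
Qed.

(** * The slit planes and the logarithm *)

Lemma D1_open (z : C) : D1 z -> exists r, (0 < r)%R /\
  forall w, (Cmod (w - z) < r)%R -> D1 w.
Proof.
case: z => x y; rewrite /D1 /= => H.
case: (Req_dec y 0) => y0.
  exists x; split; first by apply: Rnot_le_lt => h; apply: H.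
  move=> [x' y'] h [_ /= hx].
  have := fst_le_Cmod ((x', y') - (x, y)).
  move: (Cmod _) h => m h; rewrite /= -/(Rminus _ _) => k.
  by have := Rle_abs (- (x' - x)); rewrite Rabs_Ropp; lra.
exists (Rabs y); split; first exact: Rabs_pos_lt.
move=> [x' y'] h [hy _]; rewrite /Im /= in hy.
have := snd_le_Cmod ((x', y') - (x, y)).
move: (Cmod _) h => m h; rewrite /= -/(Rminus _ _) hy Rminus_0_l Rabs_Ropp; lra.
Qed.

Lemma D1_sub (z : C) : D1 (1 - z) <-> D0 z.
Proof.
case: z => x y; rewrite /D1 /D0 /Im /Re /=.
by split=> H [h1 h2]; apply: H; split; lra.
Qed.

Lemma D0_open (z : C) : D0 z -> exists r, (0 < r)%R /\
  forall w, (Cmod (w - z) < r)%R -> D0 w.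
Proof.
move=> /D1_sub /D1_open [r [r0 Hr]]; exists r; split=> // w wr.
apply/D1_sub; apply: Hr; rewrite (_ : 1 - w - (1 - z) = - (w - z)); last ring.
by rewrite Cmod_opp.
Qed.

Lemma D1_den (z : C) : D1 z -> (0 < Cmod z + Re z)%R.
Proof.
case: z => x y; rewrite /D1 /= => H.
have h : (Rabs x <= Cmod (x, y))%R by apply: (fst_le_Cmod (x, y)).
case: (Rle_dec x 0) => x0; last by have := Rle_abs x; lra.
have y0 : (y <> 0)%R by move=> y0; apply: H.
have : (Rabs x < Cmod (x, y))%R.
  rewrite -sqrt_Rsqr_abs /Cmod /=; apply: sqrt_lt_1.
  - exact: Rle_0_sqr.
  - by have := Rle_0_sqr x; have := Rle_0_sqr y; rewrite /Rsqr; lra.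
  - by have := Rsqr_pos_lt _ y0; rewrite /Rsqr; lra.
by rewrite Rabs_left1; lra.
Qed.

Lemma D1_neq_0 (z : C) : D1 z -> z <> 0.
Proof. by move=> H z0; apply: H; rewrite z0 /=; lra. Qed.

Lemma strip_Clog (z : C) : strip (Clog z).
Proof.
rewrite /strip /Clog /=; have := atan_bound (Im z / (Cmod z + Re z)); lra.
Qed.

(** Half-angle formulas: t = y / (r + x) is the tangent of half the argument, and 1 + t^2 = 2 r / (r
    + x). *)
Lemma Cexp_Clog (z : C) : D1 z -> Cexp (Clog z) = z.
Proof.
move=> zD; have d0 := D1_den z zD.
have m0 : (0 < Cmod z)%R by apply/Cmod_gt_0/D1_neq_0.
have := Cmod2_alt z; rewrite /Cexp /Clog /=.
case: z m0 d0 {zD} => x y /= m0 d0; set r := Cmod (x, y) in m0 d0 *.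
move=> e; rewrite exp_ln //.
set t := (y / (r + x))%R.
have t2 : (0 < 1 + t²)%R by have := Rle_0_sqr t; lra.
have ss : (sqrt (1 + t²) * sqrt (1 + t²) = 1 + t²)%R by apply: sqrt_sqrt; lra.
have q0 := sqrt_lt_R0 _ t2.
have c2 : (cos (atan t) * cos (atan t) = / (1 + t²))%R.
  rewrite cos_atan; move: q0 ss; set q := sqrt _ => q0 <-; field; lra.
have cs : (sin (atan t) * cos (atan t) = t / (1 + t²))%R.
  rewrite cos_atan sin_atan; move: q0 ss; set q := sqrt _ => q0 <-; field; lra.
have e1 : (1 + t² = 2 * r / (r + x))%R.
  rewrite /t /Rsqr; apply: (Rmult_eq_reg_r ((r + x) * (r + x))).
    have -> : ((1 + y / (r + x) * (y / (r + x))) * ((r + x) * (r + x)) =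
      (r + x) * (r + x) + y * y)%R.
      by field; lra.
    have -> : (2 * r / (r + x) * ((r + x) * (r + x)) = 2 * r * (r + x))%R by field; lra.
    by lra.
  by apply: Rgt_not_eq; apply: Rmult_lt_0_compat.
congr pair.
  rewrite cos_2a_cos Rmult_assoc c2 e1; field; lra.
rewrite sin_2a Rmult_assoc cs e1 /t; field; lra.
Qed.

Lemma Ccont_components (f : C -> C) (z : C) :
  continuous (fun w : C => fst (f w)) z -> continuous (fun w : C => snd (f w)) z ->
  Ccont f z.
Proof.
move=> /filterlim_locally h1 /filterlim_locally h2 eps e0.
have e2 : (0 < eps / 2)%R by lra.
have [d1 H1] := h1 (mkposreal _ e2); have [d2 H2] := h2 (mkposreal _ e2).
exists (Rmin d1 d2); split; first by apply: Rmin_pos; apply: cond_pos.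
move=> w wd.
have bl (d : posreal) : (Cmod (w - z) < d)%R -> ball z d w.
  move=> h; split; [apply: Rle_lt_trans h; exact: (fst_le_Cmod (w - z))|].
  by apply: Rle_lt_trans h; exact: (snd_le_Cmod (w - z)).
have := H1 w (bl _ (Rlt_le_trans _ _ _ wd (Rmin_l _ _))).
have := H2 w (bl _ (Rlt_le_trans _ _ _ wd (Rmin_r _ _))).
move=> k2 k1; apply: Rle_lt_trans (Cmod_le_abs _) _.
have {}k1 : (Rabs (fst (f w) - fst (f z)) < eps / 2)%R by exact: k1.
have {}k2 : (Rabs (snd (f w) - snd (f z)) < eps / 2)%R by exact: k2.
rewrite /= -!/(Rminus _ _); lra.
Qed.

Lemma Ccont_Clog (z : C) : D1 z -> Ccont Clog z.
Proof.
move=> zD; have d0 := D1_den z zD.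
have m0 : (0 < Cmod z)%R by apply/Cmod_gt_0/D1_neq_0.
have cfst : continuous (fun w : C => fst w) z by apply: continuous_fst.
have csnd : continuous (fun w : C => snd w) z by apply: continuous_snd.
have csq (F : C -> R) : continuous F z -> continuous (fun w => F w ^ 2)%R z.
  move=> cF; apply: (continuous_ext (fun w => mult (F w) (F w))).
    by move=> w; rewrite /mult /=; ring.
  exact: (continuous_mult (K := R_AbsRing)).
have cmod : continuous Cmod z.
  apply: (continuous_comp (fun w : C => plus (fst w ^ 2) (snd w ^ 2))%R sqrt).
    by apply: (continuous_plus (V := R_NormedModule)); apply: csq.
  exact: continuous_sqrt.
apply: Ccont_components.
  apply: (continuous_comp Cmod ln) => //.
  by apply/continuity_pt_filterlim/derivable_continuous_pt; exists (/ Cmod z)%R;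
    apply: derivable_pt_lim_ln.
apply: (continuous_comp (fun w => atan (Im w / (Cmod w + Re w))) (fun t => 2 * t)%R); last first.
  apply: (continuous_scal_r (K := R_AbsRing) (V := R_NormedModule) 2 (fun t => t)).
  exact: continuous_id.
apply: (continuous_comp (fun w => Im w / (Cmod w + Re w))%R atan); last first.
  by apply/continuity_pt_filterlim/derivable_continuous_pt/derivable_pt_atan.
apply: (continuous_mult (K := R_AbsRing)) => //.
apply: (continuous_comp (fun w => Cmod w + Re w)%R Rinv).
  exact: (continuous_plus (V := R_NormedModule)).
by apply: continuous_Rinv; lra.
Qed.

(** Derivative of an inverse function: the expansion of [Cexp] at [Clog z] is read backwards, and
    the continuity of [Clog] makes the increment [du] small. *)
Lemma is_Cderive_Clog (z : C) : D1 z -> is_Cderive Clog z (/ z).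
Proof.
move=> zD; have m0 : (0 < Cmod z)%R by apply/Cmod_gt_0/D1_neq_0.
have z0 := D1_neq_0 z zD.
apply/is_Cderive_eps => eps e0.
(* The first bound yields |z| |du| <= 2 |w - z|; the second then bounds the error e |du| by eps |z|
   |w - z|. *)
set e := Rmin (Cmod z / 2) (eps * (Cmod z * Cmod z) / 2).
have mm : (0 < Cmod z * Cmod z)%R by apply: Rmult_lt_0_compat.
have ep : (0 < e)%R.
  apply: Rmin_pos; first lra.
  by apply: Rdiv_lt_0_compat; [apply: Rmult_lt_0_compat|lra].
have := is_Cderive_Cexp (Clog z); rewrite Cexp_Clog // => /is_Cderive_eps /(_ e ep).
move=> [d [d0 Hd]].
have [r1 [r10 H1]] := D1_open z zD.
have [r2 [r20 H2]] := Ccont_Clog z zD d d0.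
exists (Rmin r1 r2); split; first exact: Rmin_pos.
move=> w wd.
have wD := H1 w (Rlt_le_trans _ _ _ wd (Rmin_l _ _)).
have := Hd _ (H2 w (Rlt_le_trans _ _ _ wd (Rmin_r _ _))).
rewrite !Cexp_Clog //; set du := Clog w - Clog z => h.
have du0 := Cmod_ge_0 du; have w0 := Cmod_ge_0 (w - z).
have e1 : (e <= Cmod z / 2)%R by apply: Rmin_l.
have e2 : (e <= eps * (Cmod z * Cmod z) / 2)%R by apply: Rmin_r.
have b1 : (Cmod z * Cmod du <= 2 * Cmod (w - z))%R.
  have := Cmod_triangle (w - z) (- (w - z - du * z)).
  rewrite (_ : w - z + - (w - z - du * z) = du * z); last ring.
  rewrite Cmod_opp Cmod_mult.
  have : (e * Cmod du <= Cmod z / 2 * Cmod du)%R by apply: Rmult_le_compat_r.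
  lra.
have -> : du - (w - z) * / z = - ((w - z - du * z) * / z) by field.
rewrite Cmod_opp Cmod_mult Cmod_inv //.
apply: (Rmult_le_reg_r (Cmod z)) => //; rewrite Rmult_assoc Rinv_l ?Rmult_1_r; last lra.
apply: Rle_trans h _.
apply: (Rmult_le_reg_r (Cmod z)) => //.
apply: (Rle_trans _ (e * (2 * Cmod (w - z)))).
  by rewrite Rmult_assoc; apply: Rmult_le_compat_l; lra.
apply: (Rle_trans _ (eps * (Cmod z * Cmod z) / 2 * (2 * Cmod (w - z)))).
  by apply: Rmult_le_compat_r; lra.
by apply: Req_le; field.
Qed.

Lemma Clog_RtoC (x : R) : (0 < x)%R -> Clog x = ln x.
Proof.
move=> x0; rewrite /Clog Cmod_R /= Rabs_pos_eq; last lra.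
by rewrite /Rdiv Rmult_0_l atan_0 Rmult_0_r.
Qed.

Lemma Clog_1 : Clog 1 = 0.
Proof. by rewrite Clog_RtoC ?ln_1 //; lra. Qed.

Lemma is_Cderive_Clog_sub (z : C) : D0 z ->
  is_Cderive (fun t => Clog (1 - t)) z (- / (1 - z)).
Proof.
move=> /D1_sub zD.
have h := is_Cderive_minus _ _ z _ _ (is_Cderive_const 1 z) (is_Cderive_id z).
apply: is_Cderive_ext_val (is_Cderive_comp Clog (fun t => 1 - t) z _ _ (is_Cderive_Clog _ zD) h) _.
ring.
Qed.

(** * The solution normalized at 0 *)

Definition is_series_derive (Y : C -> series) (u : C) (Y' : series) : Prop :=
  forall w, is_Cderive (fun t => Y t w) u (Y' w).

Lemma is_series_derive_mul Y Z u Y' Z' :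
  is_series_derive Y u Y' -> is_series_derive Z u Z' ->
  is_series_derive (fun t => Y t * Z t)%nc u (Y' * Z u + Y u * Z')%nc.
Proof.
move=> HY HZ w; elim: w Y Y' HY => [|i w IH] Y Y' HY.
  apply: is_derive_ext (is_Cderive_ext_val _ _ _ _ (is_Cderive_mult _ _ _ _ _ (HY []) (HZ [])) _).
    by move=> t; rewrite nc_mul_nil.
  by rewrite /nc_add !nc_mul_nil.
have h := is_Cderive_plus _ _ _ _ _
  (is_Cderive_mult _ _ _ _ _ (HY []) (HZ (i :: w)))
  (IH (fun t => shift i (Y t)) (shift i Y') (fun v => HY (i :: v))).
apply: is_derive_ext (is_Cderive_ext_val _ _ _ _ h _).
  by move=> t; rewrite nc_mul_cons.
by rewrite /nc_add !nc_mul_cons; ring.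
Qed.

Lemma is_series_derive_const (F : series) u : is_series_derive (fun _ => F) u nc_zero.
Proof. by move=> w; apply: is_Cderive_const. Qed.

Lemma is_series_derive_ext_val Y u Y' Y'' :
  is_series_derive Y u Y' -> (forall w, Y' w = Y'' w) -> is_series_derive Y u Y''.
Proof. by move=> H e w; rewrite -e. Qed.

Lemma is_series_derive_comp Y (g : C -> C) z Y' m :
  is_series_derive Y (g z) Y' -> is_Cderive g z m ->
  is_series_derive (fun t => Y (g t)) z (m *: Y')%nc.
Proof. by move=> HY Hg w; apply: (is_Cderive_comp (fun t => Y t w) g). Qed.

Lemma is_Cderive_lsum {A} (l : list A) (f : A -> C -> C) (f' : A -> C) u :
  (forall a, is_Cderive (f a) u (f' a)) ->
  is_Cderive (fun t => lsum l (fun a => f a t)) u (lsum l f').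
Proof.
move=> H; elim: l => [|a l IH]; first exact: is_Cderive_const.
exact: is_Cderive_plus (H a) IH.
Qed.

(** Since X_i is primitive, the coproduct of X_i F is (X_i (x) 1 + 1 (x) X_i) times that of F, and
    involves the latter only in lower total degree, where it is F (x) F by hypothesis. *)
Lemma shf_letter_mul_l i F s t : s <> [] -> t <> [] ->
  (forall s' t', (length s' + length t' < length s + length t)%nat ->
     shf F s' t' = F s' * F t') ->
  shf (mono [i] * F)%nc s t =
  (mono [i] * F)%nc s * F t + F s * (mono [i] * F)%nc t.
Proof.
case: s => [//|k s] _; case: t => [//|l t] _ H.
rewrite shf_cons !mono_letter_mul_cons.
have sh j : shift j (mono [i] * F)%nc = if letter_eq_dec j i then F else nc_zero.
  apply: series_ext => w; rewrite /shift mono_letter_mul_cons.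
  by case: letter_eq_dec.
have shf0 u v : shf nc_zero u v = 0 by apply: lsum_0.
rewrite !sh; case: (letter_eq_dec k i) => _; case: (letter_eq_dec l i) => _;
  rewrite ?shf0 ?H /=; try lia; ring.
Qed.

Lemma shf_letter_mul_r i F s t : s <> [] -> t <> [] ->
  (forall s' t', (length s' + length t' < length s + length t)%nat ->
     shf F s' t' = F s' * F t') ->
  shf (F * mono [i])%nc s t =
  (F * mono [i])%nc s * F t + F s * (F * mono [i])%nc t.
Proof.
move=> s0 t0; case: (exists_last s0) => s' [k ->] {s s0}.
case: (exists_last t0) => t' [l ->] {t t0} H.
rewrite shf_rcons !mul_mono_letter_rcons.
have sh j : rshift j (F * mono [i])%nc = if letter_eq_dec j i then F else nc_zero.
  apply: series_ext => w; rewrite /rshift mul_mono_letter_rcons.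
  by case: letter_eq_dec.
have shf0 u v : shf nc_zero u v = 0 by apply: lsum_0.
rewrite !sh; case: (letter_eq_dec k i) => _; case: (letter_eq_dec l i) => _;
  rewrite ?shf0 ?H ?length_app /=; try lia; ring.
Qed.

Definition star_shaped (D : C -> Prop) : Prop :=
  forall u (t : R), D u -> (0 <= t <= 1)%R -> D (t * u).

(** The derivative is controlled off 0 only, because the equation of [Lhat] is singular there; the
    open segment from 0 to [u] avoids 0. *)
Lemma constant_on_star (D : C -> Prop) (f : C -> C) : star_shaped D ->
  (forall u, D u -> ex_Cderive f u) ->
  (forall u, D u -> u <> 0 -> is_Cderive f u (RtoC 0)) ->
  forall u, D u -> f u = f 0.
Proof.
move=> DS fd f0 u Du.
case: (excluded_middle_informative (u = 0)) => [->//|u0].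
have e (t : R) : 0 + t * (u - 0) = t * u by ring.
apply: derivative_zero_const => t t01; rewrite e.
  by apply: fd; apply: DS.
apply: f0; first by apply: DS => //; lra.
by apply: Cmult_neq_0 => // /RtoC_inj; lra.
Qed.

(* The shuffle defect [shf Y s t - Y s Y t] satisfies, by induction on the
   lengths, a linear equation with zero right-hand side and initial value. *)
Lemma character_ODE (D : C -> Prop) (Y : C -> series) (a b c : C -> C) :
  star_shaped D -> Y 0 = nc_one ->
  (forall u w, D u -> ex_Cderive (fun t => Y t w) u) ->
  (forall u, D u -> u <> 0 -> is_series_derive Y u
     (a u *: (mono [x0] * Y u) + (b u *: (Y u * mono [x0]) + c u *: (mono [x1] * Y u)))%nc) ->
  forall u, D u -> character (Y u).
Proof.
move=> DS Y0 Yd HY.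
have Y1 u : D u -> Y u [] = 1.
  move=> Du; transitivity (Y 0 []); last by rewrite Y0.
  apply: (constant_on_star D (fun t => Y t [])) => //.
    by move=> v; apply: Yd.
  move=> v Dv v0; apply: is_Cderive_ext_val (HY v Dv v0 []) _.
  rewrite /nc_add /nc_scale !mono_letter_mul_nil mul_mono_letter_nil; ring.
move=> u Du; split; first exact: Y1.
move=> s t; move: u Du; have [n] : exists n, n = (length s + length t)%nat by eexists.
elim/lt_wf_ind: n s t => n IH s t en.
case: (list_eq_dec letter_eq_dec s []) => [-> u Du|s0].
  by rewrite shf_nil_l Y1 // Cmult_1_l.
case: (list_eq_dec letter_eq_dec t []) => [-> u Du|t0].
  by rewrite shf_nil_r Y1 // Cmult_1_r.
move=> u Du.
have dE v G : is_series_derive Y v G ->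
   is_Cderive (fun v => shf (Y v) s t - Y v s * Y v t) v
     (shf G s t - (G s * Y v t + Y v s * G t)).
  move=> HG; apply: is_Cderive_minus; last exact: is_Cderive_mult.
  exact: (is_Cderive_lsum (shuffle_word s t) (fun w v => Y v w)).
suff e : shf (Y u) s t - Y u s * Y u t = 0.
  by rewrite -(Cplus_0_r (Y u s * Y u t)) -e; ring.
have -> : shf (Y u) s t - Y u s * Y u t = shf (Y 0) s t - Y 0 s * Y 0 t.
  apply: (constant_on_star D (fun v => shf (Y v) s t - Y v s * Y v t)) => //.
    move=> v Dv; pose G w := proj1_sig (constructive_indefinite_description _ (Yd v w Dv)).
    eexists; apply: (dE v G) => w; rewrite /G.
    by case: constructive_indefinite_description.
  move=> v Dv v0; apply: is_Cderive_ext_val (dE v _ (HY v Dv v0)) _.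
  have low s' t' : (length s' + length t' < length s + length t)%nat ->
     shf (Y v) s' t' = Y v s' * Y v t' by move=> h; apply: (IH _ _ s' t' eq_refl) => //; lia.
  rewrite shf_plus shf_scale shf_plus !shf_scale !shf_letter_mul_l // shf_letter_mul_r //.
  rewrite /nc_add /nc_scale; ring.
rewrite Y0; case: s s0 {IH en dE} => [//|k s] _; case: t t0 => [//|l t] _.
rewrite /shf lsum_0; first by rewrite !nc_one_cons; ring.
by move=> w /shuffle_word_length /=; case: w.
Qed.

Lemma is_Cderive_pow (n : nat) (u : C) :
  is_Cderive (fun t => t ^ S n) u (INR (S n) * u ^ n).
Proof.
elim: n => [|n IH].
  apply: is_derive_ext (is_Cderive_ext_val _ _ _ _ (is_Cderive_id u) _).
    by move=> t /=; rewrite Cmult_1_r.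
  by rewrite /=; ring.
have h := is_Cderive_mult _ _ _ _ _ (is_Cderive_id u) IH.
apply: is_Cderive_ext_val h _.
rewrite (S_INR (S n)) RtoC_plus [u ^ S n]/=; ring.
Qed.

Lemma exp_letter_nil i t : exp_letter i t [] = 1.
Proof. by rewrite /exp_letter /=; field. Qed.

Lemma is_series_derive_exp i u :
  is_series_derive (exp_letter i) u (mono [i] * exp_letter i u)%nc.
Proof.
case=> [|j w].
  rewrite mono_letter_mul_nil.
  apply: is_derive_ext (is_Cderive_const 1 u) => t; by rewrite exp_letter_nil.
rewrite mono_letter_mul_cons.
case: (letter_eq_dec j i) => [->|ne]; last first.
  apply: is_derive_ext (is_Cderive_const 0 u) => t.
  by rewrite /exp_letter; case: word_eq_dec => // -[].
rewrite /exp_letter; case: (word_eq_dec w _) => e; last first.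
  apply: is_derive_ext (is_Cderive_const 0 u) => t.
  by case: word_eq_dec => // -[].
set n := length w.
have f0 : INR (fact n) <> 0%R := INR_fact_neq_0 n.
have s0 : INR (S n) <> 0%R by apply: not_0_INR.
have h := is_Cderive_mult _ _ _ _ _ (is_Cderive_pow n u) (is_Cderive_const (/ INR (fact (S n))) u).
apply: is_derive_ext (is_Cderive_ext_val _ _ _ _ h _).
  move=> t; case: word_eq_dec => [//|]; case.
  by rewrite {1}e.
rewrite fact_simpl mult_INR RtoC_mult; field.
by split=> /RtoC_inj.
Qed.

Lemma exp_letter_0 i : exp_letter i 0 = nc_one.
Proof.
apply: series_ext => -[|j w]; first exact: exp_letter_nil.
rewrite nc_one_cons /exp_letter; case: word_eq_dec => // _ /=.
by rewrite /Cdiv !Cmult_0_l.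
Qed.

Lemma exp_letter_comm i t :
  (mono [i] * exp_letter i t = exp_letter i t * mono [i])%nc.
Proof.
have rep (w : word) : w <> [] -> repeat i (length w) = i :: repeat i (length w - 1).
  by case: w => //= a w _; rewrite Nat.sub_0_r.
have E w : exp_letter i t w = if word_eq_dec w (repeat i (length w)) then
   t ^ length w / INR (fact (length w)) else 0 by [].
have key w j : (if letter_eq_dec j i then exp_letter i t w else 0) =
  if word_eq_dec (j :: w) (repeat i (S (length w))) then
     t ^ length w / INR (fact (length w)) else 0.
  rewrite E; case: (letter_eq_dec j i) => [->|ne]; last by case: word_eq_dec => // -[].
  case: (word_eq_dec w _) => e; case: word_eq_dec => // e'.
    by case: e'; rewrite {1}e.
  by case: e' => /e.
apply: series_ext => -[|j w].
  by rewrite mono_letter_mul_nil mul_mono_letter_nil.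
case: (@exists_last _ (j :: w)) => // v [k e].
have l : length w = length v.
  by move: (f_equal (@length _) e); rewrite length_app /=; lia.
rewrite mono_letter_mul_cons key e mul_mono_letter_rcons E l.
case: (letter_eq_dec k i) => [->|ne]; last first.
  case: word_eq_dec => // e'; case: ne.
  by move: e'; rewrite [repeat _ _]/= repeat_cons => e'; case: (app_inj_tail _ _ _ _ e').
case: word_eq_dec => e'; case: word_eq_dec => // e''.
  case: e''; move: e'; rewrite [repeat _ (S _)]/= repeat_cons => e'.
  by case: (app_inj_tail _ _ _ _ e').
by case: e'; rewrite [RHS]/= repeat_cons {1}e''.
Qed.

(** The product has derivative 0 in [t] and is 1 at [t = 0]. *)
Lemma exp_letter_opp i t : (exp_letter i t * exp_letter i (- t) = nc_one)%nc.
Proof.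
apply: series_ext => w.
transitivity ((exp_letter i 0 * exp_letter i (- 0))%nc w); last first.
  by rewrite (_ : - 0 = 0) ?exp_letter_0 ?nc_mul_1_l //; ring.
have H u : is_Cderive (fun t => (exp_letter i t * exp_letter i (- t))%nc w) u (RtoC 0).
  have h := is_series_derive_mul _ _ _ _ _ (is_series_derive_exp i u)
    (is_series_derive_comp _ Copp u _ _ (is_series_derive_exp i (- u))
       (is_Cderive_ext_val _ _ _ _ (is_derive_ext _ _ _ _ _
         (is_Cderive_minus _ _ u _ _ (is_Cderive_const 0 u) (is_Cderive_id u))) eq_refl)) w.
  apply: is_Cderive_ext_val (h _) _; first by move=> t' /=; ring.
  rewrite /nc_add exp_letter_comm nc_mul_scale_r nc_mul_assoc; ring.
have c := constant_on_star (fun _ => True) (fun t => (exp_letter i t * exp_letter i (- t))%nc w).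
apply: (c _ _ _ t) => //.
by move=> u _; exists (RtoC 0).
Qed.

Lemma exp_letter_opp_l i t : (exp_letter i (- t) * exp_letter i t = nc_one)%nc.
Proof.
by have := exp_letter_opp i (- t); rewrite (_ : - - t = t) //; ring.
Qed.

(** An instance of [character_ODE] on the whole plane, as the exponential solves Y' = X_i Y. *)
Lemma character_exp_letter i t : character (exp_letter i t).
Proof.
pose a := RtoC (if letter_eq_dec i x0 then 1 else 0).
pose c := RtoC (if letter_eq_dec i x0 then 0 else 1).
apply: (character_ODE (fun _ => True) (exp_letter i) (fun _ => a) (fun _ => 0) (fun _ => c)) => //.
- exact: exp_letter_0.
- by move=> u w _; eexists; apply: is_series_derive_exp.
- move=> u _ _; apply: is_series_derive_ext_val (is_series_derive_exp i u) _ => w.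
  by rewrite /nc_add /nc_scale /a /c; case: i {a c} => /=; ring.
Qed.

Lemma is_Cderive_ext_near (f g : C -> C) (z l : C) (r : R) : (0 < r)%R ->
  (forall w, (Cmod (w - z) < r)%R -> f w = g w) ->
  is_Cderive f z l -> is_Cderive g z l.
Proof.
move=> r0 H /is_Cderive_eps Hf; apply/is_Cderive_eps => eps e0.
have [d [d0 Hd]] := Hf eps e0; exists (Rmin r d); split; first exact: Rmin_pos.
move=> w wd; rewrite -!H.
- by apply: Hd; apply: Rlt_le_trans wd (Rmin_r _ _).
- by rewrite (_ : z - z = 0) ?Cmod_0 //; ring.
- exact: Rlt_le_trans wd (Rmin_l _ _).
Qed.

(* dz / z = kappa(u) du in the coordinate u = log(1 - z) *)
Definition kappa (u : C) : C := Cexp u / (Cexp u - 1).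

Lemma Cexp_sub_1_neq_0 u : strip u -> u <> 0 -> Cexp u - 1 <> 0.
Proof.
move=> us u0 e; apply: u0; apply: Cexp_eq_1 => //.
by rewrite -(Cplus_0_r 1) -e; ring.
Qed.

Lemma ex_Cderive_kappa u : strip u -> u <> 0 -> ex_Cderive kappa u.
Proof.
move=> us u0; eexists; apply: is_Cderive_mult; first exact: is_Cderive_Cexp.
apply: (is_Cderive_comp Cinv (fun u => Cexp u - 1)).
  by apply: is_Cderive_inv; apply: Cexp_sub_1_neq_0.
by apply: is_Cderive_minus; [exact: is_Cderive_Cexp|exact: is_Cderive_const].
Qed.

Lemma ex_Cderive_ext (f g : C -> C) u : (forall t, f t = g t) ->
  ex_Cderive f u -> ex_Cderive g u.
Proof. exact: ex_derive_ext. Qed.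

Lemma ex_Cderive_mult f g u : ex_Cderive f u -> ex_Cderive g u ->
  ex_Cderive (fun t => f t * g t) u.
Proof. by move=> [l fl] [m gm]; eexists; apply: is_Cderive_mult fl gm. Qed.

Lemma ex_Cderive_minus f g u : ex_Cderive f u -> ex_Cderive g u ->
  ex_Cderive (fun t => f t - g t) u.
Proof. by move=> [l fl] [m gm]; eexists; apply: is_Cderive_minus fl gm. Qed.

(** The difference is N / (e^u - 1) with N = e^u q - l (e^u - 1). Both N and its derivative vanish
    at 0, whereas |e^u - 1| >= |u| / 2 near 0. *)
Lemma kappa_limit (q : C -> C) (l : C) : q 0 = 0 -> is_Cderive q (RtoC 0) l ->
  forall eps, (0 < eps)%R -> exists d, (0 < d)%R /\
  forall u, strip u -> u <> 0 -> (Cmod u < d)%R -> (Cmod (kappa u * q u - l) < eps)%R.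
Proof.
move=> q0 ql eps e0.
pose N u := Cexp u * q u - l * (Cexp u - 1).
have dN : is_Cderive N (RtoC 0) (RtoC 0).
  have := is_Cderive_minus _ _ _ _ _ (is_Cderive_mult _ _ _ _ _ (is_Cderive_Cexp 0) ql)
    (is_Cderive_mult _ _ _ _ _ (is_Cderive_const l 0)
      (is_Cderive_minus _ _ _ _ _ (is_Cderive_Cexp 0) (is_Cderive_const 1 0))).
  move=> h; apply: is_Cderive_ext_val h _; rewrite q0 Cexp_0; ring.
have N0 : N 0 = 0 by rewrite /N q0 Cexp_0; ring.
move/is_Cderive_eps: dN => /(_ (eps / 4)%R ltac:(lra)) [d1 [d10 H1]].
move/is_Cderive_eps: (is_Cderive_Cexp 0) => /(_ (/ 2)%R ltac:(lra)) [d2 [d20 H2]].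
exists (Rmin d1 d2); split; first exact: Rmin_pos.
move=> u us u0 ud.
have s0 : u - 0 = u by ring.
have := H1 u; have := H2 u.
rewrite s0 N0 Cexp_0 Cmult_0_r Cmult_1_r.
move=> /(_ (Rlt_le_trans _ _ _ ud (Rmin_r _ _))) k2.
move=> /(_ (Rlt_le_trans _ _ _ ud (Rmin_l _ _))).
rewrite (_ : N u - 0 - 0 = N u); last ring; move=> k1.
have um : (0 < Cmod u)%R by apply/Cmod_gt_0.
have e1 := Cexp_sub_1_neq_0 u us u0.
have em : (0 < Cmod (Cexp u - 1)%C)%R by apply/Cmod_gt_0.
have k3 : (Cmod u / 2 <= Cmod (Cexp u - 1)%C)%R.
  have := Cmod_triangle (Cexp u - 1) (- (Cexp u - 1 - u)).
  rewrite (_ : Cexp u - 1 + - (Cexp u - 1 - u) = u); last ring.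
  rewrite Cmod_opp; lra.
have -> : kappa u * q u - l = N u / (Cexp u - 1) by rewrite /kappa /N; field.
rewrite Cmod_div //; apply: (Rmult_lt_reg_r (Cmod (Cexp u - 1)%C)) => //.
rewrite /Rdiv Rmult_assoc Rinv_l ?Rmult_1_r; last lra.
apply: Rle_lt_trans k1 _.
have : (eps * (Cmod u / 2) <= eps * Cmod (Cexp u - 1)%C)%R by apply: Rmult_le_compat_l; lra.
have : (0 < eps * Cmod u)%R by apply: Rmult_lt_0_compat.
lra.
Qed.

Lemma strip_open u : strip u -> exists r, (0 < r)%R /\
  forall w, (Cmod (w - u) < r)%R -> strip w.
Proof.
move=> [u1 u2]; exists (Rmin (PI - snd u) (snd u + PI)); split.
  by apply: Rmin_pos; lra.
move=> w wd; have := snd_le_Cmod (w - u).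
have := Rlt_le_trans _ _ _ wd (Rmin_l _ _); have := Rlt_le_trans _ _ _ wd (Rmin_r _ _).
move: (Cmod _) => m h1 h2; rewrite /= -/(Rminus _ _) => h3; rewrite /strip.
by move: h3; rewrite /Rabs; case: Rcase_abs; lra.
Qed.

Lemma strip_0 : strip 0.
Proof. by rewrite /strip /=; have := PI_RGT_0; lra. Qed.

Lemma strip_star : star_shaped strip.
Proof.
move=> u t; rewrite /strip /= => us t01.
rewrite Rmult_0_l Rplus_0_r.
have P0 := PI_RGT_0.
case: (Rle_dec 0 (snd u)) => h.
  have : (0 <= t * snd u)%R by apply: Rmult_le_pos; lra.
  have : (t * snd u <= 1 * snd u)%R by apply: Rmult_le_compat_r; lra.
  lra.
have : (0 <= t * - snd u)%R by apply: Rmult_le_pos; lra.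
have : (t * - snd u <= 1 * - snd u)%R by apply: Rmult_le_compat_r; lra.
lra.
Qed.

(** The zero of [q] cancels the simple pole of [kappa]. Completed by the limit q'(0), the integrand
    is continuous in the strip and differentiable off 0, as [strip_primitive] requires; its
    primitive is differentiable at 0 too. *)
Lemma kappa_primitive (q r : C -> C) :
  (forall u, strip u -> ex_Cderive q u) -> (forall u, strip u -> ex_Cderive r u) ->
  q 0 = 0 ->
  exists F : C -> C, F 0 = 0 /\ (forall u, strip u -> ex_Cderive F u) /\
  forall u, strip u -> u <> 0 -> is_Cderive F u (kappa u * q u - r u).
Proof.
move=> qd rd q0.
have [l ql] : exists l : C, is_Cderive q (RtoC 0) l := qd 0 strip_0.
pose g (u : C) : C := (if excluded_middle_informative (u = 0) then l else kappa u * q u) - r u.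
have gE (u : C) : u <> 0 -> g u = kappa u * q u - r u.
  by move=> u0; rewrite /g; case: excluded_middle_informative.
have gd (u : C) : strip u -> u <> 0 -> ex_Cderive g u.
  move=> us u0.
  have [m Hm] : ex_Cderive (fun u => kappa u * q u - r u) u.
    apply: ex_Cderive_minus; last exact: rd.
    by apply: ex_Cderive_mult; [exact: ex_Cderive_kappa|exact: qd].
  exists m; apply: (is_Cderive_ext_near _ _ _ _ (Cmod u)) Hm; first exact/Cmod_gt_0.
  move=> w wu; rewrite gE // => w0; move: wu; rewrite w0 (_ : 0 - u = - u); last ring.
  by rewrite Cmod_opp; lra.
have gc (u : C) : strip u -> Ccont g u.
  move=> us; case: (excluded_middle_informative (u = 0)) => [->|u0]; last first.
    by apply: ex_Cderive_Ccont; apply: gd.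
  pose phi (u : C) : C := if excluded_middle_informative (u = 0) then l else kappa u * q u.
  suff : Ccont phi 0.
    by move=> h; apply: Ccont_minus => //; apply: ex_Cderive_Ccont; apply: rd strip_0.
  move=> eps e0; have [d [d0 Hd]] := kappa_limit q l q0 ql eps e0.
  have [r0 [r00 Hr]] := strip_open 0 strip_0.
  exists (Rmin d r0); split; first exact: Rmin_pos.
  move=> w wd; rewrite (_ : phi 0 = l); last by rewrite /phi; case: excluded_middle_informative.
  rewrite /phi; case: excluded_middle_informative => [_|w0].
    by rewrite (_ : l - l = 0) ?Cmod_0 //; ring.
  apply: Hd => //; first by apply: Hr; apply: Rlt_le_trans wd (Rmin_r _ _).
  have := Rlt_le_trans _ _ _ wd (Rmin_l _ _).
  by rewrite (_ : w - 0 = w) //; ring.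
have [F [F0 HF]] := strip_primitive g gc gd.
exists F; split=> //; split=> [u us|u us u0]; first by exists (g u); apply: HF.
by rewrite -gE //; apply: HF.
Qed.

(* The KZ equation for the factor F of F z^{X_0}, in the coordinate u. *)
Definition Lhat_rhs (u : C) (F : series) : series :=
  (kappa u *: (mono [x0] * F) + ((- kappa u) *: (F * mono [x0]) + (-1) *: (mono [x1] * F)))%nc.

(** A coefficient of the commutator of X_0 with Y, which vanishes where Y = 1. *)
Definition q_coef (Y : C -> series) (w : word) (u : C) : C :=
  (mono [x0] * Y u)%nc w - (Y u * mono [x0])%nc w.

Lemma letter_mul_ext (F G : series) (i : letter) (w : word) :
  (forall v, (length v < length w)%nat -> F v = G v) ->
  (mono [i] * F)%nc w = (mono [i] * G)%nc w /\
  (F * mono [i])%nc w = (G * mono [i])%nc w.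
Proof.
move=> H; split.
  case: w H => [|j w] H; first by rewrite !mono_letter_mul_nil.
  by rewrite !mono_letter_mul_cons H.
case: w H => [|j w] H; first by rewrite !mul_mono_letter_nil.
case: (@exists_last _ (j :: w)) => // v [k e]; rewrite e !mul_mono_letter_rcons H // e.
by rewrite length_app /=; lia.
Qed.

Lemma ex_Cderive_letter_mul (Y : C -> series) (i : letter) (w : word) u :
  (forall v, (length v < length w)%nat -> ex_Cderive (fun t => Y t v) u) ->
  ex_Cderive (fun t => (mono [i] * Y t)%nc w) u /\
  ex_Cderive (fun t => (Y t * mono [i])%nc w) u.
Proof.
have z : ex_Cderive (fun _ => RtoC 0) u by exists (RtoC 0); apply: is_Cderive_const.
move=> H; split.
  case: w H => [|j w] H.
    by apply: ex_Cderive_ext z => t; rewrite mono_letter_mul_nil.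
  apply: (ex_Cderive_ext (fun t => if letter_eq_dec j i then Y t w else 0)).
    by move=> t; rewrite mono_letter_mul_cons.
  by case: letter_eq_dec => _ //; apply: H => /=.
case: w H => [|j w] H.
  by apply: ex_Cderive_ext z => t; rewrite mul_mono_letter_nil.
case: (@exists_last _ (j :: w)) => // v [k e].
apply: (ex_Cderive_ext (fun t => if letter_eq_dec k i then Y t v else 0)).
  by move=> t; rewrite e mul_mono_letter_rcons.
by case: letter_eq_dec => _ //; apply: H; rewrite e length_app /=; lia.
Qed.

(** The equation up to words of length [n], which is meaningful because the right-hand side at a
    word only involves shorter ones. Differentiability is recorded separately since it includes the
    pole u = 0 of [kappa]. *)
Definition Lhat_spec (n : nat) (Y : C -> series) : Prop :=
  Y 0 = nc_one /\
  (forall w u, (length w <= n)%nat -> strip u -> ex_Cderive (fun t => Y t w) u) /\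
  (forall w u, (length w <= n)%nat -> strip u -> u <> 0 ->
     is_Cderive (fun t => Y t w) u (Lhat_rhs u (Y u) w)).

Lemma Lhat_spec_step n Y : Lhat_spec n Y -> exists Z, Lhat_spec (S n) Z /\
  forall u w, (length w <= n)%nat -> Z u w = Y u w.
Proof.
move=> [Y0 [Yd Yeq]].
have prim w : exists F : C -> C, length w = S n -> F 0 = 0 /\
  (forall u, strip u -> ex_Cderive F u) /\
  forall u, strip u -> u <> 0 -> is_Cderive F u (Lhat_rhs u (Y u) w).
  case: (Nat.eq_dec (length w) (S n)) => lw; last by exists (fun _ => 0).
  have Yv (v : word) : (length v < length w)%nat -> (length v <= n)%nat by lia.
  have [F [F0 [Fd HF]]] := kappa_primitive (q_coef Y w) (fun u => (mono [x1] * Y u)%nc w)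
    (fun u us => ex_Cderive_minus _ _ u
      (proj1 (ex_Cderive_letter_mul Y x0 w u (fun v h => Yd v u (Yv v h) us)))
      (proj2 (ex_Cderive_letter_mul Y x0 w u (fun v h => Yd v u (Yv v h) us))))
    (fun u us => proj1 (ex_Cderive_letter_mul Y x1 w u (fun v h => Yd v u (Yv v h) us)))
    ltac:(by rewrite /q_coef Y0 nc_mul_1_l nc_mul_1_r; ring).
  exists F => _; split=> //; split=> // u us u0.
  apply: is_Cderive_ext_val (HF u us u0) _.
  rewrite /q_coef /Lhat_rhs /nc_add /nc_scale; ring.
pose G w := proj1_sig (constructive_indefinite_description _ (prim w)).
have GP w : length w = S n -> G w 0 = 0 /\
  (forall u, strip u -> ex_Cderive (G w) u) /\
  forall u, strip u -> u <> 0 -> is_Cderive (G w) u (Lhat_rhs u (Y u) w).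
  exact: proj2_sig (constructive_indefinite_description _ (prim w)).
pose Z u w := if Nat.eq_dec (length w) (S n) then G w u else Y u w.
have ZY u w : (length w <= n)%nat -> Z u w = Y u w.
  by rewrite /Z; case: Nat.eq_dec => // ->; lia.
have ZG u w : length w = S n -> Z u w = G w u.
  by rewrite /Z; case: Nat.eq_dec.
have MZ u w : (length w <= S n)%nat -> Lhat_rhs u (Z u) w = Lhat_rhs u (Y u) w.
  move=> lw; rewrite /Lhat_rhs /nc_add /nc_scale.
  have h (v : word) : (length v < length w)%nat -> Z u v = Y u v by move=> ?; apply: ZY; lia.
  by rewrite !(proj1 (letter_mul_ext _ _ _ _ h)) !(proj2 (letter_mul_ext _ _ _ _ h)).
exists Z; split=> //; split; last split.
- apply: series_ext => w; rewrite /Z; case: Nat.eq_dec => lw; last by rewrite Y0.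
  have [-> _] := GP w lw; by case: w lw.
- move=> w u lw us; case: (Nat.eq_dec (length w) (S n)) => e.
    have [_ [/(_ u us) h _]] := GP w e.
    by apply: ex_derive_ext h => t; rewrite ZG.
  by apply: ex_derive_ext (Yd w u _ us) => [t|]; rewrite ?ZY //; lia.
- move=> w u lw us u0; rewrite MZ //; case: (Nat.eq_dec (length w) (S n)) => e.
    have [_ [_ /(_ u us u0) h]] := GP w e.
    by apply: is_derive_ext h => t; rewrite ZG.
  by apply: is_derive_ext (Yeq w u _ us u0) => [t|]; rewrite ?ZY //; lia.
Qed.

(** Each step leaves the words already treated unchanged, so the diagonal of the sequence of
    approximations satisfies all the truncated specifications. *)
Lemma Lhat_exists : exists Lhat : C -> series, forall n, Lhat_spec n Lhat.
Proof.
have base : exists Y, Lhat_spec 0 Y.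
  exists (fun _ => nc_one); split=> //.
  have d w (u : C) : is_Cderive (fun _ => nc_one w) u (RtoC 0) by apply: is_Cderive_const.
  split=> w u lw us; first by exists (RtoC 0).
  move=> _; apply: is_Cderive_ext_val (d w u) _; case: w lw => [|i w] /= lw; last lia.
  rewrite /Lhat_rhs /nc_add /nc_scale !mono_letter_mul_nil mul_mono_letter_nil; ring.
pose step (n : nat) Y := epsilon (inhabits Y) (fun Z => Lhat_spec (S n) Z /\
  forall u w, (length w <= n)%nat -> Z u w = Y u w).
pose T0 := proj1_sig (constructive_indefinite_description _ base).
pose T := fix T n := match n with O => T0 | S m => step m (T m) end.
have TP n : Lhat_spec n (T n).
  elim: n => [|n IH]; first exact: proj2_sig (constructive_indefinite_description _ base).
  by have [] := epsilon_spec (inhabits (T n)) _ (Lhat_spec_step n (T n) IH).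
have TS n u w : (length w <= n)%nat -> T (S n) u w = T n u w.
  by have [_] := epsilon_spec (inhabits (T n)) _ (Lhat_spec_step n (T n) (TP n)); apply.
have TE n u w : (length w <= n)%nat -> T n u w = T (length w) u w.
  elim: n => [|n IH] lw; first by have -> : length w = O by lia.
  case: (Nat.eq_dec (length w) (S n)) => [->//|ne].
  by rewrite TS ?IH //; lia.
pose Lhat (u : C) : series := fun w => T (length w) u w.
exists Lhat => n.
have ME u w : (length w <= n)%nat -> Lhat u w = T n u w by move=> lw; rewrite /Lhat TE.
have [T00 [Td Teq]] := TP n.
split; last split.
- apply: series_ext => w; rewrite /Lhat.
  by have [-> _] := TP (length w).
- move=> w u lw us; apply: ex_derive_ext (Td w u lw us) => t; by rewrite ME.
- move=> w u lw us u0.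
  have -> : Lhat_rhs u (Lhat u) w = Lhat_rhs u (T n u) w.
    rewrite /Lhat_rhs /nc_add /nc_scale.
    have h (v : word) : (length v < length w)%nat -> Lhat u v = T n u v by move=> ?; apply: ME; lia.
    by rewrite !(proj1 (letter_mul_ext _ _ _ _ h)) !(proj2 (letter_mul_ext _ _ _ _ h)).
  by apply: is_derive_ext (Teq w u lw us u0) => t; rewrite ME.
Qed.

Definition Lhat : C -> series :=
  proj1_sig (constructive_indefinite_description _ Lhat_exists).

Lemma Lhat_specP n : Lhat_spec n Lhat.
Proof. exact: (proj2_sig (constructive_indefinite_description _ Lhat_exists)). Qed.

Lemma Lhat_0 : Lhat 0 = nc_one.
Proof. by case: (Lhat_specP 0). Qed.

Lemma ex_Cderive_Lhat w u : strip u -> ex_Cderive (fun t => Lhat t w) u.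
Proof. by case: (Lhat_specP (length w)) => _ [H _]; apply: H. Qed.

Lemma is_series_derive_Lhat u : strip u -> u <> 0 -> is_series_derive Lhat u (Lhat_rhs u (Lhat u)).
Proof. by move=> us u0 w; case: (Lhat_specP (length w)) => _ [_ H]; apply: H. Qed.

Lemma character_Lhat u : strip u -> character (Lhat u).
Proof.
apply: (character_ODE strip Lhat kappa (fun u => - kappa u) (fun _ => -1)).
- exact: strip_star.
- exact: Lhat_0.
- by move=> v w; apply: ex_Cderive_Lhat.
- exact: is_series_derive_Lhat.
Qed.

(** * Growth estimates in the strip *)

Definition growth (D : C -> Prop) (m : C -> R) (f : C -> C) : Prop :=
  exists (K : R) (k : nat), (0 <= K)%R /\
  forall u, D u -> (0 <= m u)%R /\ (Cmod (f u) <= K * (1 + Cmod u) ^ k * m u)%R.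

Lemma growth_pow_le (K : R) (k l : nat) (u : C) : (0 <= K)%R -> (k <= l)%nat ->
  (K * (1 + Cmod u) ^ k <= K * (1 + Cmod u) ^ l)%R.
Proof.
move=> K0 kl; apply: Rmult_le_compat_l => //; apply: Rle_pow => //.
by have := Cmod_ge_0 u; lra.
Qed.

Lemma growth_pow_pos (k : nat) (u : C) : (0 <= (1 + Cmod u) ^ k)%R.
Proof. by apply: pow_le; have := Cmod_ge_0 u; lra. Qed.

Section Growth.
Context (D : C -> Prop).

Lemma growth_plus m f g : growth D m f -> growth D m g ->
  growth D m (fun u => f u + g u).
Proof.
move=> [K [k [K0 Hf]]] [L [l [L0 Hg]]].
exists (K + L)%R, (k + l)%nat; split; first lra.
move=> u Du; have [m0 hf] := Hf u Du; have [_ hg] := Hg u Du; split=> //.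
apply: Rle_trans (Cmod_triangle _ _) _.
rewrite !Rmult_plus_distr_r; apply: Rplus_le_compat.
  by apply: Rle_trans hf _; apply: Rmult_le_compat_r => //; apply: growth_pow_le => //; lia.
by apply: Rle_trans hg _; apply: Rmult_le_compat_r => //; apply: growth_pow_le => //; lia.
Qed.

Lemma growth_mult m n f g : growth D m f -> growth D n g ->
  growth D (fun u => m u * n u)%R (fun u => f u * g u).
Proof.
move=> [K [k [K0 Hf]]] [L [l [L0 Hg]]].
exists (K * L)%R, (k + l)%nat; split; first exact: Rmult_le_pos.
move=> u Du; have [m0 hf] := Hf u Du; have [n0 hg] := Hg u Du; split.
  exact: Rmult_le_pos.
rewrite Cmod_mult pow_add.
have -> : (K * L * ((1 + Cmod u) ^ k * (1 + Cmod u) ^ l) * (m u * n u) =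
  (K * (1 + Cmod u) ^ k * m u) * (L * (1 + Cmod u) ^ l * n u))%R by ring.
by apply: Rmult_le_compat => //; apply: Cmod_ge_0.
Qed.

Lemma growth_const c : growth D (fun _ => 1%R) (fun _ => c).
Proof.
exists (Cmod c), O; split; first exact: Cmod_ge_0.
by move=> u _; split; [lra|rewrite /= !Rmult_1_r; lra].
Qed.

Lemma growth_zero m : (forall u, D u -> 0 <= m u)%R -> growth D m (fun _ => 0).
Proof.
move=> m0; exists 0%R, O; split; first lra.
by move=> u /m0 h; split=> //; rewrite Cmod_0; lra.
Qed.

Lemma growth_ext m n f g : (forall u, D u -> f u = g u) -> (forall u, D u -> m u = n u) ->
  growth D m f -> growth D n g.
Proof.
move=> fg mn [K [k [K0 H]]]; exists K, k; split=> // u Du.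
by rewrite -fg // -mn //; apply: H.
Qed.

Lemma growth_mult1 m f g : growth D (fun _ => 1%R) f -> growth D m g ->
  growth D m (fun u => f u * g u).
Proof.
move=> Hf Hg; apply: growth_ext (growth_mult _ _ _ _ Hf Hg) => // u _.
by rewrite Rmult_1_l.
Qed.

Lemma growth_id : growth D (fun _ => 1%R) (fun u => u).
Proof.
exists 1%R, 1%nat; split; first lra.
by move=> u _; split; [lra|have := Cmod_ge_0 u; rewrite /=; lra].
Qed.

Lemma growth_Cmod_1 f : growth D Cmod f -> growth D (fun _ => 1%R) f.
Proof.
move=> [K [k [K0 H]]]; exists K, (S k); split=> // u Du; split; first lra.
have [_ h] := H u Du; apply: Rle_trans h _; rewrite Rmult_1_r Rmult_assoc.
apply: Rmult_le_compat_l => //; rewrite [(_ ^ S k)%R]/= Rmult_comm.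
by apply: Rmult_le_compat_r; [exact: growth_pow_pos|lra].
Qed.

Definition series_growth (m : C -> R) (Y : C -> series) : Prop :=
  forall w, growth D m (fun u => Y u w).

Lemma series_growth_mul m n Y Z : series_growth m Y -> series_growth n Z ->
  series_growth (fun u => m u * n u)%R (fun u => Y u * Z u)%nc.
Proof.
move=> HY HZ w; elim: w Y HY => [|i w IH] Y HY.
  apply: growth_ext (growth_mult _ _ _ _ (HY []) (HZ [])) => // u _.
  by rewrite nc_mul_nil.
apply: growth_ext (growth_plus _ _ _ (growth_mult _ _ _ _ (HY []) (HZ (i :: w)))
  (IH (fun u => shift i (Y u)) (fun v => HY (i :: v)))) => // u _.
by rewrite nc_mul_cons.
Qed.

Lemma series_growth_mul1 m Y Z : series_growth (fun _ => 1%R) Y -> series_growth m Z ->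
  series_growth m (fun u => Y u * Z u)%nc.
Proof.
move=> HY HZ w; apply: growth_ext (series_growth_mul _ _ _ _ HY HZ w) => // u _.
by rewrite Rmult_1_l.
Qed.

Lemma series_growth_mulr1 m Y Z : series_growth m Y -> series_growth (fun _ => 1%R) Z ->
  series_growth m (fun u => Y u * Z u)%nc.
Proof.
move=> HY HZ w; apply: growth_ext (series_growth_mul _ _ _ _ HY HZ w) => // u _.
by rewrite Rmult_1_r.
Qed.

Lemma series_growth_const (F : series) : series_growth (fun _ => 1%R) (fun _ => F).
Proof. by move=> w; apply: growth_const. Qed.

Lemma series_growth_exp i f : growth D (fun _ => 1%R) f ->
  series_growth (fun _ => 1%R) (fun u => exp_letter i (f u)).
Proof.
move=> Hf w; have P n : growth D (fun _ => 1%R) (fun u => f u ^ n).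
  elim: n => [|n IH]; first exact: growth_const.
  exact: growth_mult1 Hf IH.
rewrite /exp_letter; case: word_eq_dec => _; last exact: growth_const.
exact: growth_mult1 (P (length w)) (growth_const (/ INR (fact (length w)))).
Qed.
End Growth.

(** For [a < 0] the factor 1 + |a| makes up for the boundedness of |e^a - 1|; there the inequality
    amounts to e^a (1 - a) <= 1. *)
Lemma exp_sub_1_ge (a : R) : (Rabs a <= (1 + Rabs a) * Rabs (exp a - 1))%R.
Proof.
case: (Rle_dec 0 a) => a0.
  have h := exp_ineq1_le a.
  rewrite !Rabs_pos_eq; try lra.
  have : (a * 1 <= (1 + a) * (exp a - 1))%R.
    rewrite Rmult_comm; apply: Rle_trans (_ : 1 * (exp a - 1) <= _)%R; first lra.
    by apply: Rmult_le_compat_r; lra.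
  lra.
have h := exp_ineq1_le (- a); have e0 := exp_pos a.
have e1 : (exp a * exp (- a) = 1)%R by rewrite -exp_plus Rplus_opp_r exp_0.
have : (exp a * (1 + - a) <= 1)%R by rewrite -e1; apply: Rmult_le_compat_l; lra.
move=> k; have k2 : (exp a <= 1)%R.
  have : (0 <= exp a * - a)%R by apply: Rmult_le_pos; lra.
  lra.
rewrite !Rabs_left1; lra.
Qed.

(** Taylor's bound sin t >= t - t^3 / 6, with t <= 2 because PI <= 4. *)
Lemma sin_ge_third (t : R) : (0 <= t <= PI / 2)%R -> (t / 3 <= sin t)%R.
Proof.
move=> [t0 t1]; have P4 := PI_4; have P0 := PI_RGT_0.
have [h _] := sin_bound t 0 t0 ltac:(lra).
apply: Rle_trans h.
rewrite /sin_approx /sin_term /=.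
have : (t * (t * t) <= t * 4)%R.
  apply: Rmult_le_compat_l => //; apply: (Rle_trans _ (2 * 2)); last lra.
  by apply: Rmult_le_compat; lra.
lra.
Qed.

(** 1 - cos b = 2 sin^2 (b / 2), and sin (b / 2) >= b / 6 for b >= 0. *)
Lemma one_sub_cos_ge (b : R) : (- PI < b < PI)%R -> (b * b <= 18 * (1 - cos b))%R.
Proof.
wlog b0 : b / (0 <= b)%R.
  move=> H bp; case: (Rle_dec 0 b) => h; first exact: H.
  by have := H (- b)%R ltac:(lra) ltac:(lra); rewrite cos_neg; lra.
move=> bp; have h := sin_ge_third (b / 2) ltac:(lra).
have -> : cos b = (1 - 2 * sin (b / 2) * sin (b / 2))%R.
  by rewrite -cos_2a_sin; congr cos; field.
have : (b / 6 * (b / 6) <= sin (b / 2) * sin (b / 2))%R by apply: Rmult_le_compat; lra.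
lra.
Qed.

(** |e^v - 1|^2 = (e^a - 1)^2 + 2 e^a (1 - cos b) for v = a + i b. If a >= -1, then e^a >= 1/3 and
    the two terms control a and b, with 1 + 27 <= 8^2; the strip keeps v away from the zeros at 2 pi
    i and - 2 pi i. If a < -1, then |e^v - 1| >= 1/2. *)
Lemma Cexp_sub_1_ge (v : C) : strip v ->
  (Cmod v <= 8 * (1 + Cmod v) * Cmod (Cexp v - 1)%C)%R.
Proof.
case: v => a b; rewrite /strip [snd _]/= => bp.
set m := Cmod (a, b); have m0 : (0 <= m)%R by apply: Cmod_ge_0.
set E := Cmod (Cexp (a, b) - 1); have E0 : (0 <= E)%R by apply: Cmod_ge_0.
have am : (Rabs a <= m)%R by apply: (fst_le_Cmod (a, b)).
have a0 := Rabs_pos a.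
have m2 : (m * m = a * a + b * b)%R.
  by have := Cmod2_alt (a, b); rewrite -/m /Re /Im /=; lra.
have e0 := exp_pos a.
have E2 : (E * E = (exp a - 1) * (exp a - 1) + 2 * exp a * (1 - cos b))%R.
  have := Cmod2_alt (Cexp (a, b) - 1); rewrite -/E /Re /Im /Cexp /=.
  have := sin2_cos2 b; rewrite /Rsqr => sc.
  have : (exp a * exp a * (sin b * sin b + cos b * cos b) = exp a * exp a)%R by rewrite sc; ring.
  lra.
have c0 := one_sub_cos_ge b bp.
have bb : (0 <= b * b)%R by apply: Rle_0_sqr.
have h1 := exp_sub_1_ge a.
have EA : (Rabs (exp a - 1) <= E)%R.
  apply: Rsqr_incr_0_var => //; rewrite /Rsqr E2.
  have -> : (Rabs (exp a - 1) * Rabs (exp a - 1) = (exp a - 1) * (exp a - 1))%R.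
    by rewrite -Rabs_mult Rabs_pos_eq //; apply: Rle_0_sqr.
  have : (0 <= 2 * exp a * (1 - cos b))%R by apply: Rmult_le_pos; lra.
  lra.
case: (Rle_dec (- 1) a) => a1.
  have e3 : (/ 3 <= exp a)%R.
    apply: (Rle_trans _ (exp (- 1))); last first.
      by case: (Rle_lt_or_eq_dec _ _ a1) => [h|<-]; [apply/Rlt_le/exp_increasing|lra].
    rewrite exp_Ropp; apply: Rinv_le_contravar; [exact: exp_pos|exact: exp_le_3].
  have b2 : (b * b <= 27 * (E * E))%R.
    have : (0 <= (exp a - 1) * (exp a - 1))%R by apply: Rle_0_sqr.
    have : (/ 3 * (1 - cos b) <= exp a * (1 - cos b))%R by apply: Rmult_le_compat_r; lra.
    lra.
  have aE : (Rabs a <= (1 + m) * E)%R.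
    apply: Rle_trans h1 _; apply: Rmult_le_compat; try lra; exact: Rabs_pos.
  have a2 : (a * a <= ((1 + m) * E) * ((1 + m) * E))%R.
    rewrite -(Rabs_pos_eq (a * a)); last exact: Rle_0_sqr.
    by rewrite Rabs_mult; apply: Rmult_le_compat.
  have EE : (E * E <= ((1 + m) * E) * ((1 + m) * E))%R.
    have : (1 * E <= (1 + m) * E)%R by apply: Rmult_le_compat_r; lra.
    by rewrite Rmult_1_l => h; apply: Rmult_le_compat.
  apply: Rsqr_incr_0_var; last by apply: Rmult_le_pos; lra.
  rewrite /Rsqr m2; have := Rle_0_sqr ((1 + m) * E); rewrite /Rsqr; lra.
have a1' : (Rabs a = - a)%R by apply: Rabs_left; lra.
have q : (/ 2 <= E)%R.
  apply: Rle_trans EA.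
  have : (exp a <= / 2)%R.
    have := exp_ineq1_le (- a).
    have e1 : (exp a * exp (- a) = 1)%R by rewrite -exp_plus Rplus_opp_r exp_0.
    move=> k; have : (exp a * 2 <= exp a * exp (- a))%R by apply: Rmult_le_compat_l; lra.
    lra.
  by move=> k; rewrite Rabs_left1; lra.
have : ((1 + m) * / 2 <= (1 + m) * E)%R by apply: Rmult_le_compat_l; lra.
lra.
Qed.

Definition strip0 (u : C) : Prop := strip u /\ u <> 0.

(** kappa(u) = - 1 / (e^{-u} - 1), so [Cexp_sub_1_ge] at [- u] bounds |kappa(u)| |u| by 8 (1 + |u|):
    the weight |u| absorbs the pole, at the cost of one more power. *)
Lemma growth_kappa f : growth strip0 Cmod f ->
  growth strip0 (fun _ => 1%R) (fun u => kappa u * f u).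
Proof.
have H u : strip0 u -> (Cmod (kappa u) * Cmod u <= 8 * (1 + Cmod u))%R.
  move=> [us u0].
  have vs : strip (- u) by move: us; rewrite /strip /=; lra.
  have e1 := Cexp_sub_1_neq_0 u us u0.
  have v0 : - u <> 0.
    move=> e; apply: u0; have h : u = - - u by ring.
    by rewrite h e; ring.
  have e2 := Cexp_sub_1_neq_0 (- u) vs v0.
  have k : kappa u = - / (Cexp (- u) - 1).
    have e3 : Cexp (- u) * Cexp u = 1 by rewrite -Cexp_plus -Cexp_0; congr Cexp; ring.
    have e4 : Cexp (- u) = / Cexp u.
      by rewrite -(Cmult_1_l (/ _)) -e3; field; apply: Cexp_neq_0.
    move: e2; rewrite /kappa e4 => e2; field; split; first exact: Cexp_neq_0.
    split; last exact: e1. move=> e5; apply: e1.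
    have h : Cexp u - 1 = - (1 - Cexp u) by ring.
    by rewrite h (_ : 1 - Cexp u = 0) //; ring.
  rewrite k Cmod_opp Cmod_inv //.
  have := Cexp_sub_1_ge (- u) vs; rewrite Cmod_opp => h.
  have p : (0 < Cmod (Cexp (- u) - 1)%C)%R by apply/Cmod_gt_0.
  apply: (Rmult_le_reg_l (Cmod (Cexp (- u) - 1)%C)) => //.
  by rewrite -Rmult_assoc Rinv_r; lra.
move=> [K [k [K0 Hf]]]; exists (8 * K)%R, (S k); split; first lra.
move=> u Du; split; first lra.
have [_ h] := Hf u Du; rewrite Cmod_mult Rmult_1_r.
apply: Rle_trans (Rmult_le_compat_l _ _ _ (Cmod_ge_0 _) h) _.
have -> : (Cmod (kappa u) * (K * (1 + Cmod u) ^ k * Cmod u) =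
  K * (1 + Cmod u) ^ k * (Cmod (kappa u) * Cmod u))%R by ring.
have -> : (8 * K * (1 + Cmod u) ^ S k = K * (1 + Cmod u) ^ k * (8 * (1 + Cmod u)))%R.
  by rewrite /=; ring.
apply: Rmult_le_compat_l; last exact: H.
by apply: Rmult_le_pos => //; apply: growth_pow_pos.
Qed.

(** The polynomial bound on the derivative increases with |u|, hence holds on the whole segment from
    0 to [u] with its value at the end; the length of the segment supplies the weight |u|. *)
Lemma growth_integrate (f f' : C -> C) : growth strip0 (fun _ => 1%R) f' ->
  (forall u, strip u -> ex_Cderive f u) ->
  (forall u, strip0 u -> is_Cderive f u (f' u)) ->
  growth strip Cmod (fun u => f u - f 0).
Proof.
move=> [K [k [K0 H]]] fd ff'; exists K, k; split=> // u us; split; first exact: Cmod_ge_0.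
case: (excluded_middle_informative (u = 0)) => [->|u0].
  by rewrite (_ : f 0 - f 0 = 0) ?Cmod_0; [lra|ring].
have e (t : R) : 0 + t * (u - 0) = t * u by ring.
have := mean_value_le f 0 u (K * (1 + Cmod u) ^ k).
rewrite (_ : u - 0 = u); last ring.
have e' (t : R) : 0 + t * u = t * u by ring.
apply=> [t t01|t l t01]; rewrite e'; first by apply: fd; apply: strip_star.
have tu : strip0 (t * u).
  split; first by apply: strip_star => //; lra.
  by apply: Cmult_neq_0 => // /RtoC_inj; lra.
move=> /(is_Cderive_uniq _ _ _ _ (ff' _ tu)) <-.
have [_ h] := H _ tu; apply: Rle_trans h _; rewrite Rmult_1_r.
apply: Rmult_le_compat_l => //; apply: pow_incr; split.
  by have := Cmod_ge_0 (t * u); lra.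
rewrite Cmod_mult Cmod_R Rabs_pos_eq; last lra.
have := Cmod_ge_0 u => m0.
have : (t * Cmod u <= 1 * Cmod u)%R by apply: Rmult_le_compat_r; lra.
lra.
Qed.

Lemma growth_sub (D D' : C -> Prop) m f : (forall u, D' u -> D u) ->
  growth D m f -> growth D' m f.
Proof. by move=> DD [K [k [K0 H]]]; exists K, k; split=> // u /DD; apply: H. Qed.

Lemma growth_letter (D : C -> Prop) (m : C -> R) (Y : C -> series) i w :
  (forall u, D u -> (0 <= m u)%R) ->
  (forall v, (length v < length w)%nat -> growth D m (fun u => Y u v)) ->
  growth D m (fun u => (mono [i] * Y u)%nc w) /\
  growth D m (fun u => (Y u * mono [i])%nc w).
Proof.
move=> m0 H; split.
  case: w H => [|j w] H.
    by apply: growth_ext (growth_zero D m m0) => // u _; rewrite mono_letter_mul_nil.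
  case: (letter_eq_dec j i) => ji.
    apply: growth_ext (H w (Nat.lt_succ_diag_r _)) => // u _.
    by rewrite mono_letter_mul_cons; case: letter_eq_dec.
  apply: growth_ext (growth_zero D m m0) => // u _; rewrite mono_letter_mul_cons.
  by case: letter_eq_dec.
case: w H => [|j w] H.
  by apply: growth_ext (growth_zero D m m0) => // u _; rewrite mul_mono_letter_nil.
case: (@exists_last _ (j :: w)) => // v [k e]; rewrite e in H *.
case: (letter_eq_dec k i) => ji.
  have lv : (length v < length (v ++ [k]))%nat by rewrite length_app /=; lia.
  apply: growth_ext (H v lv) => // u _.
  by rewrite mul_mono_letter_rcons; case: letter_eq_dec.
apply: growth_ext (growth_zero D m m0) => // u _; rewrite mul_mono_letter_rcons.
by case: letter_eq_dec.
Qed.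

(** With Lhat = 1 + N, the commutator of X_0 with Lhat is that with N. On shorter words N has weight
    |u|, so multiplication by kappa gives weight 1, and integration restores the weight |u| at
    [w]. *)
Lemma growth_Lhat_and_rhs w :
  growth strip Cmod (fun u => Lhat u w - nc_one w) /\
  growth strip0 (fun _ => 1%R) (fun u => Lhat_rhs u (Lhat u) w).
Proof.
have [n] : exists n, n = length w by eexists.
elim/lt_wf_ind: n w => n IH w en.
pose N u : series := fun v => Lhat u v - nc_one v.
have NE u : Lhat u = (nc_one + N u)%nc.
  by apply: series_ext => v; rewrite /nc_add /N; ring.
have IHN v : (length v < length w)%nat -> growth strip0 Cmod (fun u => N u v).
  move=> vw; apply: (growth_sub strip) => [u []//|].
  by case: (IH (length v) _ v eq_refl); first lia.
have B : growth strip0 (fun _ => 1%R) (fun u => Lhat_rhs u (Lhat u) w).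
  have [g1 g2] := growth_letter strip0 Cmod N x0 w (fun u _ => Cmod_ge_0 u) IHN.
  have [g3 _] := growth_letter strip0 Cmod N x1 w (fun u _ => Cmod_ge_0 u) IHN.
  have gq := growth_kappa _ (growth_plus _ _ _ _ g1
     (growth_mult1 _ _ _ _ (growth_const strip0 (-1)) g2)).
  have gr := growth_mult1 _ _ _ _ (growth_const strip0 (-1))
     (growth_plus _ _ _ _ (growth_const strip0 ((mono [x1] * nc_one)%nc w)) (growth_Cmod_1 _ _ g3)).
  apply: growth_ext (growth_plus _ _ _ _ gq gr) => // u _.
  rewrite NE /Lhat_rhs /nc_add /nc_scale -!/(nc_add _ _).
  rewrite !nc_mul_plus_r !nc_mul_plus_l !nc_mul_1_l !nc_mul_1_r; ring.
split=> //.
apply: growth_ext (growth_integrate (fun u => Lhat u w) _ B _ _) => //.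
- by move=> u _; rewrite Lhat_0.
- by move=> u us; apply: ex_Cderive_Lhat.
- by move=> u [us u0]; apply: is_series_derive_Lhat.
Qed.

Lemma series_growth_Lhat_sub : series_growth strip Cmod (fun u w => Lhat u w - nc_one w).
Proof. by move=> w; case: (growth_Lhat_and_rhs w). Qed.

Lemma series_growth_Lhat : series_growth strip (fun _ => 1%R) Lhat.
Proof.
move=> w; apply: growth_ext (growth_plus _ _ _ _ (growth_const strip (nc_one w))
  (growth_Cmod_1 _ _ (series_growth_Lhat_sub w))) => // u _; ring.
Qed.

Lemma series_growth_Lhat_rhs : series_growth strip0 (fun _ => 1%R) (fun u => Lhat_rhs u (Lhat u)).
Proof. by move=> w; case: (growth_Lhat_and_rhs w). Qed.

(* Ftilde^(0)(z) for u = log (1 - z) *)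
Definition Ftil (u : C) : series := (exp_letter x1 u * Lhat u)%nc.

Definition Ftil' (u : C) : series :=
  (mono [x1] * exp_letter x1 u * Lhat u + exp_letter x1 u * Lhat_rhs u (Lhat u))%nc.

Lemma is_series_derive_Ftil u : strip u -> u <> 0 -> is_series_derive Ftil u (Ftil' u).
Proof.
move=> us u0; apply: is_series_derive_mul; first exact: is_series_derive_exp.
exact: is_series_derive_Lhat.
Qed.

Lemma ex_series_derive_mul Y Z u w : (forall w, ex_Cderive (fun t => Y t w) u) ->
  (forall w, ex_Cderive (fun t => Z t w) u) ->
  ex_Cderive (fun t => (Y t * Z t)%nc w) u.
Proof.
move=> HY HZ.
pose G (X : C -> series) (H : forall w, ex_Cderive (fun t => X t w) u) (w : word) : C :=
  proj1_sig (constructive_indefinite_description _ (H w)).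
have GP X H : is_series_derive X u (G X H).
  by move=> v; rewrite /G; case: constructive_indefinite_description.
by eexists; apply: (is_series_derive_mul Y Z u (G Y HY) (G Z HZ)).
Qed.

Lemma ex_Cderive_Ftil w u : strip u -> ex_Cderive (fun t => Ftil t w) u.
Proof.
move=> us; apply: ex_series_derive_mul => v; last exact: ex_Cderive_Lhat.
by eexists; apply: is_series_derive_exp.
Qed.

Lemma series_growth_Ftil' : series_growth strip0 (fun _ => 1%R) Ftil'.
Proof.
have sM : series_growth strip0 (fun _ => 1%R) Lhat.
  by move=> w; apply: (growth_sub strip) (series_growth_Lhat w) => u [].
move=> w; apply: growth_plus.
  apply: series_growth_mul1 => // v; apply: series_growth_mul1; first exact: series_growth_const.
  exact/series_growth_exp/growth_id.
by apply: series_growth_mul1; [exact/series_growth_exp/growth_id|exact: series_growth_Lhat_rhs].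
Qed.

Lemma character_Ftil u : strip u -> character (Ftil u).
Proof.
by move=> us; apply: character_mul; [apply: character_exp_letter|apply: character_Lhat].
Qed.

Lemma Ftil_0 : Ftil 0 = nc_one.
Proof. by rewrite /Ftil Lhat_0 exp_letter_0 nc_mul_1_l. Qed.

(** At single letters the commutator vanishes, since the constant term of Lhat is 1; of the equation
    only the term - X_1 is left. *)
Lemma Lhat_letters u : strip u -> Lhat u [x0] = 0 /\ Lhat u [x1] = - u.
Proof.
move=> us; have M1 v : strip v -> Lhat v [] = 1 by move=> /character_Lhat [].
have nn : nc_one [] = 1 by [].
split.
  transitivity (Lhat 0 [x0]); last by rewrite Lhat_0.
  apply: (constant_on_star strip (fun u => Lhat u [x0])) => //; first exact: strip_star.
    by move=> v; apply: ex_Cderive_Lhat.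
  move=> v vs v0; apply: is_Cderive_ext_val (is_series_derive_Lhat v vs v0 [x0]) _.
  rewrite /Lhat_rhs /nc_add /nc_scale !mono_letter_mul_cons.
  by rewrite (mul_mono_letter_rcons x0 x0 (Lhat v) []) /=; ring.
suff : Lhat u [x1] + u = Lhat 0 [x1] + 0.
  rewrite Lhat_0 nc_one_cons => h.
  by rewrite (_ : Lhat u [x1] = Lhat u [x1] + u - u); [rewrite h|]; ring.
apply: (constant_on_star strip (fun u => Lhat u [x1] + u)) => //; first exact: strip_star.
  move=> v vs; have [l Hl] := ex_Cderive_Lhat [x1] v vs.
  by eexists; apply: is_Cderive_plus Hl (is_Cderive_id v).
move=> v vs v0.
apply: is_Cderive_ext_val (is_Cderive_plus _ _ _ _ _
  (is_series_derive_Lhat v vs v0 [x1]) (is_Cderive_id v)) _.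
rewrite /Lhat_rhs /nc_add /nc_scale !mono_letter_mul_cons.
by rewrite (mul_mono_letter_rcons x0 x1 (Lhat v) []) /= M1 //; ring.
Qed.

(** The factor exp (u X_1) adds u at X_1 and cancels the logarithm - u of [Lhat]. *)
Lemma Ftil_letters u : strip u -> Ftil u [x0] = 0 /\ Ftil u [x1] = 0.
Proof.
move=> us; have [m0 m1] := Lhat_letters u us; have [M1 _] := character_Lhat u us.
have e0 : exp_letter x1 u [x0] = 0 by rewrite /exp_letter; case: word_eq_dec.
have e1 : exp_letter x1 u [x1] = u.
  by rewrite /exp_letter; case: word_eq_dec => // _ /=; field.
rewrite /Ftil !nc_mul_cons !nc_mul_nil exp_letter_nil /shift e0 e1 m0 m1 M1; split; ring.
Qed.

(** * The symmetry z -> 1 - z *)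

Definition swap (i : letter) : letter := match i with x0 => x1 | x1 => x0 end.

(* The automorphism X_0 -> - X_1, X_1 -> - X_0, which together with z -> 1 - z
   preserves the KZ equation. *)
Definition dual (F : series) : series :=
  fun w => (-1) ^ length w * F (map swap w).

Lemma swapK w : map swap (map swap w) = w.
Proof. by rewrite map_map -[RHS]map_id; apply: map_ext => -[]. Qed.

Lemma dual_nil F : dual F [] = F [].
Proof. by rewrite /dual /=; ring. Qed.

Lemma shift_dual i F : shift i (dual F) = ((-1) *: dual (shift (swap i) F))%nc.
Proof. by apply: series_ext => w; rewrite /shift /dual /nc_scale /=; ring. Qed.

Lemma dual_mul F G : dual (F * G)%nc = (dual F * dual G)%nc.
Proof.
apply: series_ext => w; elim: w F => [|i w IH] F.
  by rewrite nc_mul_nil !dual_nil nc_mul_nil.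
rewrite nc_mul_cons shift_dual nc_mul_scale_l -IH dual_nil.
by rewrite /dual [map _ _]/= nc_mul_cons /=; ring.
Qed.

Lemma Cpow_m1_mul (n : nat) : (-1) ^ n * (-1) ^ n = 1 :> C.
Proof. by elim: n => [|n IH]; rewrite /=; [ring|rewrite -IH; ring]. Qed.

Lemma dual_dual F : dual (dual F) = F.
Proof.
apply: series_ext => w.
by rewrite /dual length_map swapK Cmult_assoc Cpow_m1_mul Cmult_1_l.
Qed.

Lemma dual_one : dual nc_one = nc_one.
Proof.
apply: series_ext => -[|i w]; first by rewrite dual_nil.
by rewrite /dual [map _ _]/= !nc_one_cons; ring.
Qed.

Lemma dual_exp i t : dual (exp_letter i t) = exp_letter (swap i) (- t).
Proof.
apply: series_ext => w; rewrite /dual /exp_letter length_map.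
have r n : map swap (repeat i n) = repeat (swap i) n by elim: n => //= n ->.
case: word_eq_dec => e; case: word_eq_dec => e'.
- have -> : (- t) ^ length w = (-1) ^ length w * t ^ length w.
    by rewrite -Cpow_mult_l; congr Cpow; ring.
  by rewrite /Cdiv; ring.
- by case: e'; rewrite -{1}(swapK w) e r.
- have r' n : map swap (repeat (swap i) n) = repeat i n.
    by elim: n => //= n ->; congr cons; case: (i).
  by case: e; rewrite {1}e' r'.
- ring.
Qed.

Lemma dual_mono i : dual (mono [i]) = ((-1) *: mono [swap i])%nc.
Proof.
apply: series_ext => w; rewrite /dual /nc_scale /mono.
case: word_eq_dec => e; case: word_eq_dec => e'.
- by rewrite e' /=; ring.
- by case: e'; rewrite -(swapK w) e.
- by case: e; rewrite e'; case: (i).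
- ring.
Qed.

Lemma shf_dual F s t :
  shf (dual F) s t = (-1) ^ (length s + length t) * shf F (map swap s) (map swap t).
Proof.
elim: s t F => [|i s IHs]; first by move=> t F; rewrite !shf_nil_l.
elim=> [|j t IHt] F; first by rewrite !shf_nil_r /dual Nat.add_0_r.
rewrite shf_cons !shift_dual !shf_scale IHs IHt.
rewrite [map swap (i :: s)]/= [map swap (j :: t)]/= shf_cons.
rewrite (_ : (length (i :: s) + length (j :: t) = S (S (length s + length t)))%nat); last first.
  by rewrite /=; lia.
rewrite (_ : (length s + length (j :: t) = S (length s + length t))%nat); last first.
  by rewrite /=; lia.
rewrite (_ : (length (i :: s) + length t = S (length s + length t))%nat); last by rewrite /=; lia.
by rewrite [_ ^ S (S _)]/= [_ ^ S _]/=; ring.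
Qed.

Lemma character_dual F : character F -> character (dual F).
Proof.
move=> [KZ1 Fs]; split; first by rewrite dual_nil.
by move=> s t; rewrite shf_dual Fs /dual Cpow_add_r; ring.
Qed.

Lemma is_series_derive_dual Y u Y' : is_series_derive Y u Y' ->
  is_series_derive (fun t => dual (Y t)) u (dual Y').
Proof.
move=> H w; apply: is_Cderive_ext_val
  (is_Cderive_mult _ _ u _ _ (is_Cderive_const ((-1) ^ length w) u) (H (map swap w))) _.
rewrite /dual; ring.
Qed.

Definition reflect (G : C -> series) (z : C) : series := dual (G (1 - z)).

Lemma one_sub_sub (z : C) : 1 - (1 - z) = z.
Proof. ring. Qed.

Lemma reflect_reflect G z : reflect (reflect G) z = G z.
Proof. by rewrite /reflect dual_dual one_sub_sub. Qed.

Lemma is_Cderive_one_sub (z : C) : is_Cderive (fun t => 1 - t) z (RtoC (-1)).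
Proof.
apply: is_Cderive_ext_val (is_Cderive_minus _ _ z _ _ (is_Cderive_const 1 z) (is_Cderive_id z)) _.
by rewrite -RtoC_minus; congr RtoC; ring.
Qed.

Lemma is_series_derive_reflect G z G' : is_series_derive G (1 - z) G' ->
  is_series_derive (reflect G) z ((-1) *: dual G')%nc.
Proof.
move=> /is_series_derive_dual H.
exact: (is_series_derive_comp _ (fun t => 1 - t) z _ _ H (is_Cderive_one_sub z)).
Qed.

Lemma D01_sub z : D01 (1 - z) <-> D01 z.
Proof.
rewrite /D01 D1_sub; split=> -[h1 h2]; split=> //.
  by rewrite -(one_sub_sub z); apply/D1_sub.
by apply/D1_sub; rewrite one_sub_sub.
Qed.

Definition KZop (z : C) : series :=
  ((/ z) *: mono [x0] + / (1 - z) *: mono [x1])%nc.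

Lemma KZop_mul z F w :
  (KZop z * F)%nc w = / z * (mono [x0] * F)%nc w + / (1 - z) * (mono [x1] * F)%nc w.
Proof. by rewrite nc_mul_plus_l !nc_mul_scale_l. Qed.

(** [dual] maps [KZop (1 - z)] to the negative of [KZop z], and d (1 - z) = - dz restores the
    sign. *)
Lemma KZ_solution_reflect G : KZ_solution G -> KZ_solution (reflect G).
Proof.
move=> H w z zD; have zD' : D01 (1 - z) by apply/D01_sub.
have := is_series_derive_reflect G z (KZop (1 - z) * G (1 - z))%nc (fun w => H w _ zD').
move=> /(_ w) h; apply: is_Cderive_ext_val h _.
rewrite -/(KZop z) dual_mul /nc_scale.
have -> : dual (KZop (1 - z)) = ((-1) *: KZop z)%nc.
  apply: series_ext => v.
  have sp a b (A B : series) : dual (a *: A + b *: B)%nc v = a * dual A v + b * dual B v.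
    by rewrite /dual /nc_add /nc_scale; ring.
  by rewrite sp !dual_mono one_sub_sub /KZop /nc_add /nc_scale /=; ring.
rewrite nc_mul_scale_l -/(reflect G z).
by rewrite Cmult_assoc (_ : -1 * -1 = 1); ring.
Qed.

Lemma locally_reflect (a : C) (P : C -> Prop) :
  locally a P -> locally (1 - a) (fun z : C => P (1 - z)).
Proof.
move=> [e He]; exists e => z [h1 h2]; apply: He; split.
  have {}h1 : (Rabs (fst z - (1 - fst a)) < e)%R by exact: h1.
  suff : (Rabs (1 - fst z - fst a) < e)%R by [].
  by rewrite -Rabs_Ropp; apply: Rle_lt_trans h1; apply: Req_le; congr Rabs; ring.
have {}h2 : (Rabs (snd z - (0 - snd a)) < e)%R by exact: h2.
suff : (Rabs (0 - snd z - snd a) < e)%R by [].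
by rewrite -Rabs_Ropp; apply: Rle_lt_trans h2; apply: Req_le; congr Rabs; ring.
Qed.

Lemma ex_Cderive_reflect G z w : (forall v, ex_Cderive (fun t => G t v) (1 - z)) ->
  ex_Cderive (fun t => reflect G t w) z.
Proof.
move=> H; have [l Hl] := H (map swap w).
eexists; apply: is_Cderive_mult; first exact: is_Cderive_const.
exact: (is_Cderive_comp (fun t => G t (map swap w)) (fun t => 1 - t) z _ _
  Hl (is_Cderive_one_sub z)).
Qed.

Lemma holomorphic_at_reflect a G : holomorphic_at a G -> holomorphic_at (1 - a) (reflect G).
Proof.
move=> H w; apply: filter_imp (locally_reflect a _ (H (map swap w))) => z [l Hl].
eexists; apply: is_Cderive_mult; first exact: is_Cderive_const.
exact: (is_Cderive_comp (fun t => G t (map swap w)) (fun t => 1 - t) z _ _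
  Hl (is_Cderive_one_sub z)).
Qed.

Lemma dual_z_pow_X0 z : dual (z_pow_X0 (1 - z)) = one_minus_z_pow_mX1 z.
Proof. by rewrite /z_pow_X0 dual_exp. Qed.

Lemma dual_one_minus_z_pow_mX1 z : dual (one_minus_z_pow_mX1 (1 - z)) = z_pow_X0 z.
Proof.
rewrite /one_minus_z_pow_mX1 dual_exp one_sub_sub /z_pow_X0 /=; congr exp_letter; ring.
Qed.

Lemma normalized_at_1_reflect L : normalized_at_0 L -> normalized_at_1 (reflect L).
Proof.
move=> [HL [Lh [h1 [h2 h3]]]]; split; first exact: KZ_solution_reflect.
exists (reflect Lh); split; last split.
- have -> : RtoC 1 = 1 - 0 by ring.
  exact: holomorphic_at_reflect.
- by rewrite /reflect (_ : 1 - 1 = 0) ?h2 ?dual_one //; ring.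
- by move=> z /D01_sub zD; rewrite /reflect h3 // dual_mul dual_z_pow_X0.
Qed.

Lemma normalized_at_0_reflect L : normalized_at_1 L -> normalized_at_0 (reflect L).
Proof.
move=> [HL [Lh [h1 [h2 h3]]]]; split; first exact: KZ_solution_reflect.
exists (reflect Lh); split; last split.
- have -> : RtoC 0 = 1 - 1 by ring.
  exact: holomorphic_at_reflect.
- by rewrite /reflect (_ : 1 - 0 = 1) ?h2 ?dual_one //; ring.
- by move=> z /D01_sub zD; rewrite /reflect h3 // dual_mul dual_one_minus_z_pow_mX1.
Qed.

(** * Uniqueness of solutions of the KZ equation *)

Lemma D01_half : D01 (RtoC (/ 2)).
Proof. by split=> -[_ /=]; lra. Qed.

Lemma D01_star z (t : R) : D01 z -> (0 <= t <= 1)%R ->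
  D01 (RtoC (/ 2) + t * (z - RtoC (/ 2))).
Proof.
case: z => x y; rewrite /D01 /D0 /D1 /Re /Im /= => -[h1 h2] t01.
have -> : (0 + (t * (y + - 0) + 0 * (x + - / 2)) = t * y)%R by ring.
have -> : (/ 2 + (t * (x + - / 2) - 0 * (y + - 0)) = / 2 + t * (x - / 2))%R by ring.
case: (Req_dec t 0) => [->|t0]; first by split=> -[_]; lra.
split=> -[/Rmult_integral [//|y0] hx].
  apply: h1; split=> //.
  apply: Rnot_lt_le => x1.
  have : (t * (x - / 2) < / 2)%R.
    case: (Rle_dec 0 (x - / 2)) => k.
      have : (t * (x - / 2) <= 1 * (x - / 2))%R by apply: Rmult_le_compat_r; lra.
      lra.
    have : (0 <= t * - (x - / 2))%R by apply: Rmult_le_pos; lra.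
    lra.
  lra.
apply: h2; split=> //; apply: Rnot_lt_le => x1.
have : (t * - (x - / 2) < / 2)%R.
  case: (Rle_dec 0 (- (x - / 2))) => k.
    have : (t * - (x - / 2) <= 1 * - (x - / 2))%R by apply: Rmult_le_compat_r; lra.
    lra.
  have : (0 <= t * (x - / 2))%R by apply: Rmult_le_pos; lra.
  lra.
lra.
Qed.

(** The right-hand side of the equation at [w] only involves shorter words, where the solutions
    agree; D01 is star-shaped about 1/2. *)
Lemma KZ_difference_constant G H w : KZ_solution G -> KZ_solution H ->
  (forall v z, (length v < length w)%nat -> D01 z -> G z v = H z v) ->
  forall z, D01 z -> G z w - H z w = G (RtoC (/ 2)) w - H (RtoC (/ 2)) w.
Proof.
move=> HG HH e z zD.
have d t : D01 t -> is_Cderive (fun t => G t w - H t w) t (RtoC 0).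
  move=> tD; apply: is_Cderive_ext_val (is_Cderive_minus _ _ t _ _ (HG w t tD) (HH w t tD)) _.
  rewrite -!/(KZop t) !KZop_mul.
  have h (v : word) : (length v < length w)%nat -> G t v = H t v by move=> h; apply: e.
  by rewrite !(proj1 (letter_mul_ext _ _ _ _ h)); ring.
apply: (derivative_zero_const (fun t => G t w - H t w)) => t t01.
  by exists (RtoC 0); apply: d; apply: D01_star.
by apply: d; apply: D01_star => //; lra.
Qed.

Lemma KZ_unique G H : KZ_solution G -> KZ_solution H ->
  G (RtoC (/ 2)) = H (RtoC (/ 2)) -> eq_on_D01 G H.
Proof.
move=> HG HH e z zD; apply: series_ext => w; move: z zD.
have [n] : exists n, n = length w by eexists.
elim/lt_wf_ind: n w => n IH w en z zD.
have := KZ_difference_constant G H w HG HH _ z zD.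
move=> /(_ _) h; have {}h := h (fun v y vw yD => IH (length v) ltac:(lia) v eq_refl y yD).
rewrite e in h.
have -> : G z w = G z w - H z w + H z w by ring.
by rewrite h; ring.
Qed.

Lemma z_pow_X0_inv z : (z_pow_X0 z * exp_letter x0 (- Clog z) = nc_one)%nc.
Proof. exact: exp_letter_opp. Qed.

Lemma D01_small (d : R) : (0 < d)%R -> exists x : R, D01 x /\ (0 < x < 1)%R /\ (Cmod x < d)%R.
Proof.
move=> d0; exists (Rmin (d / 2) (/ 2)).
have h1 := Rmin_l (d / 2) (/ 2); have h2 := Rmin_r (d / 2) (/ 2).
have h3 : (0 < Rmin (d / 2) (/ 2))%R by apply: Rmin_pos; lra.
split; first by split=> -[_ /=]; lra.
split; first lra.
by rewrite Cmod_R Rabs_pos_eq; lra.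
Qed.

(** If the solutions agree on shorter words, their difference at [w] is a constant. By
    [nc_minus_low] it is also the difference of the holomorphic factors, which tends to 0 along the
    points of D01 approaching 0. *)
Lemma normalized_at_0_unique G H : normalized_at_0 G -> normalized_at_0 H -> eq_on_D01 G H.
Proof.
move=> [HG [Gh [g1 [g2 g3]]]] [HH [Hh [h1 [h2 h3]]]] z zD.
apply: series_ext => w; move: z zD.
have [n] : exists n, n = length w by eexists.
elim/lt_wf_ind: n w => n IH w en.
have low (v : word) z : (length v < length w)%nat -> D01 z -> G z v = H z v.
  by move=> vw zD; apply: (IH (length v)) => //; lia.
have hat_eq z : D01 z -> Gh z w - Hh z w = G z w - H z w.
  move=> zD.
  have inv (A B : C -> series) : B z = (A z * z_pow_X0 z)%nc ->
      A z = (nc_one * B z * exp_letter x0 (- Clog z))%nc.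
    by move=> ->; rewrite nc_mul_1_l -nc_mul_assoc z_pow_X0_inv nc_mul_1_r.
  rewrite (inv Gh G (g3 z zD)) (inv Hh H (h3 z zD)) nc_minus_low ?exp_letter_nil //.
  by move=> v vw; apply: low.
set c := G (RtoC (/ 2)) w - H (RtoC (/ 2)) w.
have cE z : D01 z -> G z w - H z w = c.
  by move=> zD; apply: KZ_difference_constant.
have Gc : Ccont (fun z => Gh z w) 0.
  by apply: ex_Cderive_Ccont; apply: (locally_singleton _ _ (g1 w)).
have Hc : Ccont (fun z => Hh z w) 0.
  by apply: ex_Cderive_Ccont; apply: (locally_singleton _ _ (h1 w)).
have c0 : c = 0.
  apply: Cmod_eq_0; apply: Rle_antisym (Cmod_ge_0 _); apply: le_epsilon => eps e0.
  have [d [d0 Hd]] := Ccont_minus _ _ _ Gc Hc eps e0.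
  have [x [xD [x01 xd]]] := D01_small d d0.
  have := Hd x; rewrite (_ : x - 0 = x); last ring.
  move=> /(_ xd); rewrite g2 h2 hat_eq // cE // => k.
  rewrite (_ : c = c - (nc_one w - nc_one w)); last ring.
  lra.
move=> z zD; rewrite (_ : G z w = G z w - H z w + H z w); last ring.
by rewrite cE // c0; ring.
Qed.

(** * The two fundamental solutions *)

Definition KZ0 (z : C) : series := (Lhat (Clog (1 - z)) * z_pow_X0 z)%nc.
Definition KZ1 : C -> series := reflect KZ0.
Definition KZ0_reg (z : C) : series := Ftil (Clog (1 - z)).
Definition KZ1_reg : C -> series := reflect KZ0_reg.

Lemma Clog_sub_neq_0 z : D01 z -> Clog (1 - z) <> 0.
Proof.
move=> [/D1_sub zD /D1_neq_0 z0] e; apply: z0.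
have := Cexp_Clog _ zD; rewrite e Cexp_0 => h.
by rewrite -(one_sub_sub z) -h; ring.
Qed.

Lemma is_series_derive_z_pow_X0 z : D1 z ->
  is_series_derive z_pow_X0 z ((/ z) *: (mono [x0] * z_pow_X0 z))%nc.
Proof.
move=> zD; apply: (is_series_derive_comp (exp_letter x0) Clog).
  exact: is_series_derive_exp.
exact: is_Cderive_Clog.
Qed.

(** Since kappa du = dz / z, the term Lhat X_0 / z from the derivative of z^{X_0} cancels the right
    multiplication by X_0 in [Lhat_rhs]. *)
Lemma KZ_solution_KZ0 : KZ_solution KZ0.
Proof.
move=> w z zD; rewrite -/(KZop z).
have z0 : z <> 0 by apply: D1_neq_0; case: zD.
have z1 : 1 - z <> 0 by apply: D1_neq_0; apply/D1_sub; case: zD.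
set u := Clog (1 - z).
have eu : Cexp u = 1 - z by apply: Cexp_Clog; apply/D1_sub; case: zD.
have h := is_series_derive_mul _ _ z _ _
  (is_series_derive_comp Lhat (fun t => Clog (1 - t)) z _ _
     (is_series_derive_Lhat u (strip_Clog _) (Clog_sub_neq_0 z zD))
     (is_Cderive_Clog_sub z (proj1 zD)))
  (is_series_derive_z_pow_X0 z (proj2 zD)) w.
apply: is_Cderive_ext_val h _.
rewrite KZop_mul /KZ0 -/u /nc_add nc_mul_scale_r nc_mul_scale_l.
rewrite /Lhat_rhs 2!nc_mul_plus_l !nc_mul_scale_l !nc_mul_assoc.
have -> : kappa u = - ((1 - z) / z).
  rewrite /kappa eu; field; split=> //.
  by move=> e; apply: z0; rewrite -[RHS](_ : - (1 - z - 1) = 0); [ring|rewrite e; ring].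
by field.
Qed.

Lemma normalized_at_0_KZ0 : normalized_at_0 KZ0.
Proof.
split; first exact: KZ_solution_KZ0.
exists (fun z => Lhat (Clog (1 - z))); split; last split=> //.
  move=> w; have [r [r0 Hr]] := D0_open 0 ltac:(by rewrite /D0 /=; lra).
  have r2 : (0 < r / 2)%R by lra.
  exists (mkposreal _ r2) => z [h1 h2].
  have zD : D0 z.
    apply: Hr; apply: Rle_lt_trans (Cmod_le_abs _) _.
    have {}h1 : (Rabs (fst z - 0) < r / 2)%R by exact: h1.
    have {}h2 : (Rabs (snd z - 0) < r / 2)%R by exact: h2.
    rewrite /= -!/(Rminus _ _); lra.
  have [l Hl] := ex_Cderive_Lhat w (Clog (1 - z)) (strip_Clog _).
  by eexists; apply: (is_Cderive_comp (fun t => Lhat t w) (fun t => Clog (1 - t)) z _ _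
    Hl (is_Cderive_Clog_sub z zD)).
by rewrite (_ : 1 - 0 = 1) ?Clog_1 ?Lhat_0 //; ring.
Qed.

Lemma fundamental_KZ0 : fundamental_solution_at_0 KZ0.
Proof.
split; first exact: normalized_at_0_KZ0.
by move=> G HG; apply: normalized_at_0_unique HG normalized_at_0_KZ0.
Qed.

Lemma fundamental_KZ1 : fundamental_solution_at_1 KZ1.
Proof.
split; first exact: normalized_at_1_reflect normalized_at_0_KZ0.
move=> G /normalized_at_0_reflect HG z zD; rewrite -(reflect_reflect G z) /KZ1 /reflect.
have := normalized_at_0_unique _ _ HG normalized_at_0_KZ0 (1 - z).
by rewrite /reflect => -> //; apply/D01_sub.
Qed.

(** * Asymptotics at infinity *)

Lemma exp_pow_INR (x : R) (n : nat) : (exp x ^ n = exp (INR n * x))%R.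
Proof.
elim: n => [|n IH]; first by rewrite /= Rmult_0_l exp_0.
by rewrite S_INR Rmult_plus_distr_r Rmult_1_l exp_plus -IH /= Rmult_comm.
Qed.

(** The inequality t <= e^t at t = (c + x) / (2 n), raised to the power n, where n > 0 is the
    exponent. *)
Lemma pow_le_exp_half (c : R) (k : nat) : (0 <= c)%R -> exists B, (0 <= B)%R /\
  forall x, (0 <= x)%R -> ((c + x) ^ k <= B * exp (x / 2))%R.
Proof.
move=> c0; case: k => [|k].
  exists 1%R; split; first lra; move=> x x0 /=.
  by have := exp_ineq1_le (x / 2); lra.
set n := INR (S k); have n0 : (0 < n)%R by apply: lt_0_INR; lia.
exists ((2 * n) ^ S k * exp (c / 2))%R; split.
  by apply: Rmult_le_pos; [apply: pow_le; lra|apply/Rlt_le/exp_pos].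
move=> x x0.
have h : ((c + x) / (2 * n) <= exp ((c + x) / (2 * n)))%R.
  by have := exp_ineq1_le ((c + x) / (2 * n)); lra.
have -> : ((2 * n) ^ S k * exp (c / 2) * exp (x / 2) =
  (2 * n * exp ((c + x) / (2 * n))) ^ S k)%R.
  rewrite [RHS]Rpow_mult_distr Rmult_assoc -exp_plus; congr Rmult.
  rewrite exp_pow_INR -/n; congr exp; field; lra.
apply: pow_incr; split; first lra.
rewrite {1}(_ : c + x = 2 * n * ((c + x) / (2 * n)))%R; last by field; lra.
by apply: Rmult_le_compat_l; lra.
Qed.

Lemma pow_mul_le_exp (K c : R) (k : nat) (eps : R) : (0 <= K)%R -> (0 <= c)%R -> (0 < eps)%R ->
  exists x0, (0 <= x0)%R /\ forall x, (x0 <= x)%R -> (K * (c + x) ^ k <= eps * exp x)%R.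
Proof.
move=> K0 c0 e0; have [B [B0 HB]] := pow_le_exp_half c k c0.
have KB : (0 <= K * B / eps)%R.
  by apply: Rmult_le_pos; [exact: Rmult_le_pos|apply/Rlt_le/Rinv_0_lt_compat].
(* Half of the exponent dominates the power; from this point on, the other half exceeds K B / eps,
   by e^t >= 1 + t. *)
exists (2 * (K * B / eps))%R; split; first lra.
move=> x hx; have x0 : (0 <= x)%R by lra.
apply: Rle_trans (Rmult_le_compat_l _ _ _ K0 (HB x x0)) _.
have e2 : exp x = (exp (x / 2) * exp (x / 2))%R by rewrite -exp_plus; congr exp; field.
have p := exp_pos (x / 2); have q := exp_ineq1_le (x / 2).
rewrite e2 -!Rmult_assoc; apply: Rmult_le_compat_r; first lra.
have -> : (K * B = eps * (K * B / eps))%R by field; lra.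
by apply: Rmult_le_compat_l; lra.
Qed.

(* [C_derive] only takes the limit along the real direction, hence this form in
   terms of actual complex derivatives. *)
Definition flat_at_infty (D : C -> Prop) (F : C -> series) : Prop :=
  forall w eps, (0 < eps)%R -> exists B, forall z l : C, D z -> (B < Cmod z)%R ->
    is_Cderive (fun t => F t w) z l -> (Cmod l <= eps)%R.

Lemma flat_at_inftyE D F : holomorphic_on D F ->
  (derivative_vanishes_at_infty D F <-> flat_at_infty D F).
Proof.
move=> HF; split=> H w.
  move=> eps e0; have e2 : (0 < eps / 2)%R by lra.
  have [B HB] := H w _ (locally_ball (RtoC 0) (mkposreal _ e2)).
  exists B => z l zD zB /is_C_derive_unique zl.
  have := HB z zB zD; rewrite zl => -[h1 h2].
  have {}h1 : (Rabs (fst l - 0) < eps / 2)%R by exact: h1.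
  have {}h2 : (Rabs (snd l - 0) < eps / 2)%R by exact: h2.
  rewrite Rminus_0_r in h1; rewrite Rminus_0_r in h2.
  by apply: Rle_trans (Cmod_le_abs l) _; lra.
move=> P [eps HP].
have [B HB] := H w (eps / 2)%R ltac:(have := cond_pos eps; lra).
exists B => z zB zD.
have [l Hl] := HF w z zD; rewrite (is_C_derive_unique _ _ _ Hl).
have h := HB z l zD zB Hl; have p := cond_pos eps.
apply: HP; split; apply: (Rle_lt_trans _ (Cmod l)); try lra.
  suff : (Rabs (fst l - 0) <= Cmod l)%R by [].
  by rewrite Rminus_0_r; apply: fst_le_Cmod.
suff : (Rabs (snd l - 0) <= Cmod l)%R by [].
by rewrite Rminus_0_r; apply: snd_le_Cmod.
Qed.

Lemma ex_Cderive_KZ0_reg w z : D0 z -> ex_Cderive (fun t => KZ0_reg t w) z.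
Proof.
move=> zD; have [l Hl] := ex_Cderive_Ftil w (Clog (1 - z)) (strip_Clog _).
by eexists; apply: (is_Cderive_comp (fun t => Ftil t w) (fun t => Clog (1 - t)) z _ _
  Hl (is_Cderive_Clog_sub z zD)).
Qed.

Lemma Cmod_Clog (z : C) : (1 <= Cmod z)%R -> (Cmod (Clog z) <= ln (Cmod z) + 4)%R.
Proof.
move=> z1; apply: Rle_trans (Cmod_le_abs _) _.
have [s1 s2] := strip_Clog z; have P4 := PI_4.
have a : (Rabs (snd (Clog z)) <= 4)%R by apply: Rabs_le; lra.
have b : (0 <= ln (Cmod z))%R by rewrite -ln_1; apply: ln_le; lra.
by rewrite [fst _]/= (Rabs_pos_eq (ln _)) //; lra.
Qed.

Lemma flat_KZ0_reg : flat_at_infty D0 KZ0_reg.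
Proof.
move=> w eps e0; have [K [k [K0 HK]]] := series_growth_Ftil' w.
(* 5 is the 1 of 1 + |u| plus the 4 of [Cmod_Clog], which bounds the argument. *)
have [X [X0 HX]] := pow_mul_le_exp K 5 k eps K0 ltac:(lra) e0.
(* Ensures |1 - z| >= exp X, and u <> 0 because |z| > 2. *)
exists (exp X + 1)%R => z l zD zB Hl.
have eX := exp_pos X.
have m1 : (exp X <= Cmod (1 - z)%C)%R.
  have := Cmod_triangle (1 - z) (Copp 1); rewrite (_ : 1 - z + Copp 1 = - z); last ring.
  by rewrite !Cmod_opp Cmod_1; lra.
have eX1 : (1 <= exp X)%R by have := exp_ineq1_le X; lra.
set u := Clog (1 - z).
have um : (Cmod u <= ln (Cmod (1 - z)%C) + 4)%R by apply: Cmod_Clog; lra.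
have Xl : (X <= ln (Cmod (1 - z)%C))%R by rewrite -[X in (X <= _)%R]ln_exp; apply: ln_le.
have zn0 : 1 - z <> 0 by apply/Cmod_gt_0; lra.
have u0 : u <> 0.
  move=> e; have := Cmod_Cexp u; rewrite Cexp_Clog; last exact/D1_sub.
  rewrite e /= exp_0 => e1.
  have := Cmod_triangle (1 - z) (Copp 1); rewrite (_ : 1 - z + Copp 1 = - z); last ring.
  by rewrite !Cmod_opp Cmod_1; lra.
have dl := is_series_derive_comp Ftil (fun t => Clog (1 - t)) z _ _
  (is_series_derive_Ftil u (strip_Clog _) u0) (is_Cderive_Clog_sub z zD) w.
rewrite (is_Cderive_uniq _ _ _ _ Hl dl) /nc_scale Cmod_mult Cmod_opp Cmod_inv //.
have [_ h] := HK u (conj (strip_Clog _) u0); rewrite Rmult_1_r in h.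
apply: (Rmult_le_reg_l (Cmod (1 - z)%C)); first lra.
rewrite -Rmult_assoc Rinv_r ?Rmult_1_l; last lra.
apply: Rle_trans h _; rewrite (Rmult_comm _ eps) -[X in (_ <= _ * X)%R]exp_ln; last lra.
apply: Rle_trans (HX _ Xl).
apply: Rmult_le_compat_l => //; apply: pow_incr; have := Cmod_ge_0 u; lra.
Qed.

Lemma holomorphic_on_reflect F (D D' : C -> Prop) : (forall z, D' z -> D (1 - z)) ->
  holomorphic_on D F -> holomorphic_on D' (reflect F).
Proof. by move=> DD H w z /DD zD; apply: ex_Cderive_reflect => v; apply: H. Qed.

Lemma flat_reflect F (D D' : C -> Prop) : (forall z, D' z -> D (1 - z)) ->
  flat_at_infty D F -> holomorphic_on D F -> flat_at_infty D' (reflect F).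
Proof.
move=> DD HF Fh w eps e0; have [B HB] := HF (map swap w) eps e0.
exists (B + 1)%R => z l zD zB Hl.
have zD' := DD z zD.
have [m Hm] := Fh (map swap w) (1 - z) zD'.
have mB : (B < Cmod (1 - z)%C)%R.
  have := Cmod_triangle (1 - z) (Copp 1); rewrite (_ : 1 - z + Copp 1 = - z); last ring.
  by rewrite !Cmod_opp Cmod_1; lra.
have := HB _ _ zD' mB Hm.
have := is_Cderive_mult _ _ z _ _ (is_Cderive_const ((-1) ^ length w) z)
  (is_Cderive_comp (fun t => F t (map swap w)) (fun t => 1 - t) z _ _ Hm (is_Cderive_one_sub z)).
move=> h; rewrite (is_Cderive_uniq _ _ _ _ Hl h).
have m1 : Cmod (-1) = 1%R by rewrite Cmod_R Rabs_left; lra.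
have p1 : Cmod ((-1) ^ length w) = 1%R by rewrite Cmod_pow m1 pow1.
rewrite Cmult_0_l Cplus_0_l !Cmod_mult p1 m1; lra.
Qed.

Lemma holomorphic_KZ0_reg : holomorphic_on D0 KZ0_reg.
Proof. by move=> w z; apply: ex_Cderive_KZ0_reg. Qed.

Lemma D0_sub z : D1 z -> D0 (1 - z).
Proof. by move=> zD; apply/D1_sub; rewrite one_sub_sub. Qed.

Lemma KZ0_factor z : KZ0 z = (one_minus_z_pow_mX1 z * KZ0_reg z * z_pow_X0 z)%nc.
Proof.
rewrite /KZ0 /KZ0_reg /Ftil; congr nc_mul.
by rewrite nc_mul_assoc exp_letter_opp_l nc_mul_1_l.
Qed.

Lemma KZ1_factor z : KZ1 z = (z_pow_X0 z * KZ1_reg z * one_minus_z_pow_mX1 z)%nc.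
Proof.
by rewrite /KZ1 /reflect KZ0_factor 2!dual_mul dual_z_pow_X0 dual_one_minus_z_pow_mX1.
Qed.

Lemma character_KZ0 z : character (KZ0 z).
Proof.
apply: character_mul; last exact: character_exp_letter.
exact/character_Lhat/strip_Clog.
Qed.

Lemma character_KZ1 z : character (KZ1 z).
Proof. exact/character_dual/character_KZ0. Qed.

Lemma regular_KZ0 : regular_form KZ0_reg.
Proof.
exists (fun z => pairing (KZ0_reg z)) => z _.
have [t0 t1] := Ftil_letters (Clog (1 - z)) (strip_Clog _).
by apply: regular_seriesE => //; apply/character_Ftil/strip_Clog.
Qed.

Lemma regular_KZ1 : regular_form KZ1_reg.
Proof.
exists (fun z => pairing (KZ1_reg z)) => z _.
have [t0 t1] := Ftil_letters (Clog (1 - (1 - z))) (strip_Clog _).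
apply: regular_seriesE.
- exact/character_dual/character_Ftil/strip_Clog.
- have -> : KZ1_reg z [x0] = (-1) * 1 * Ftil (Clog (1 - (1 - z))) [x1] by [].
  by rewrite t1; ring.
- have -> : KZ1_reg z [x1] = (-1) * 1 * Ftil (Clog (1 - (1 - z))) [x0] by [].
  by rewrite t0; ring.
Qed.

Lemma KZ0_reg_0 : KZ0_reg 0 = nc_one.
Proof. by rewrite /KZ0_reg (_ : 1 - 0 = 1) ?Clog_1 ?Ftil_0 //; ring. Qed.

Lemma riemann_hilbert_KZ0_KZ1 :
  (forall z, D01 z -> (nc_inv (KZ1 z) * KZ0 z)%nc = Phi_KZ) ->
  riemann_hilbert_solution KZ0 KZ1.
Proof.
move=> HPhi; split; last split=> //.
  by move=> z _; split; apply/grouplikeE; [exact: character_KZ0|exact: character_KZ1].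
have h1 : holomorphic_on D1 KZ1_reg.
  by apply: holomorphic_on_reflect holomorphic_KZ0_reg; apply: D0_sub.
exists KZ0_reg, KZ1_reg; split; first exact: regular_KZ0.
split; first exact: regular_KZ1.
split; first by move=> z _; apply: KZ0_factor.
split; first by move=> z _; apply: KZ1_factor.
split; first exact: holomorphic_KZ0_reg.
split; first exact: h1.
split; first by apply/flat_at_inftyE; [exact: holomorphic_KZ0_reg|exact: flat_KZ0_reg].
split; last exact: KZ0_reg_0.
apply/flat_at_inftyE => //.
by apply: flat_reflect flat_KZ0_reg holomorphic_KZ0_reg; apply: D0_sub.
Qed.

(** * Uniqueness *)

(** Induction on length: once shorter words agree, [nc_minus_low] transfers the equality of the
    products at a word to the middle factors. *)
Lemma triangular_agreement (P Z : series) (A B : series) (n : nat) :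
  P [] = 1 -> Z [] = 1 ->
  (forall v, (length v < n)%nat -> (P * A * Z)%nc v = (P * B * Z)%nc v) ->
  forall v, (length v < n)%nat -> A v = B v.
Proof.
move=> P1 Z1 H v; have [m] : exists m, m = length v by eexists.
elim/lt_wf_ind: m v => m IH v em vn.
have := nc_minus_low P A B Z v P1 Z1 (fun u uv => IH (length u) ltac:(lia) u eq_refl ltac:(lia)).
rewrite H // => h.
have -> : A v = A v - B v + B v by ring.
by rewrite -h; ring.
Qed.

Lemma grouplike_nil F : grouplike F -> F [] = 1.
Proof. by case. Qed.

Lemma riemann_hilbert_unique G0 G1 H0 H1 :
  riemann_hilbert_solution G0 G1 -> riemann_hilbert_solution H0 H1 ->
  eq_on_D01 G0 H0 /\ eq_on_D01 G1 H1.
Proof.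
move=> [Gg [GP [Gt0 [Gt1 [_ [_ [G0f [G1f [G0h [G1h [G0v [G1v G00]]]]]]]]]]]].
move=> [Hg [HP [Ht0 [Ht1 [_ [_ [H0f [H1f [H0h [H1h [H0v [H1v H00]]]]]]]]]]]].
suff key : forall w z, D01 z -> G0 z w = H0 z w /\ G1 z w = H1 z w.
  by split=> z zD; apply: series_ext => w; case: (key w z zD).
move=> w; have [n] : exists n, n = length w by eexists.
elim/lt_wf_ind: n w => n IH w en.
have low (v : word) z : (length v < length w)%nat -> D01 z -> G0 z v = H0 z v /\ G1 z v = H1 z v.
  by move=> vw zD; apply: (IH (length v)) => //; lia.
have p1 z : one_minus_z_pow_mX1 z [] = 1 by apply: exp_letter_nil.
have z1 z : z_pow_X0 z [] = 1 by apply: exp_letter_nil.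
have e0 z : D01 z -> G0 z w - H0 z w = Gt0 z w - Ht0 z w.
  move=> zD; rewrite G0f // H0f // nc_minus_low //.
  apply: (triangular_agreement (one_minus_z_pow_mX1 z) (z_pow_X0 z)) => // v vw.
  by rewrite -G0f // -H0f //; case: (low v z vw zD).
have e1 z : D01 z -> G1 z w - H1 z w = Gt1 z w - Ht1 z w.
  move=> zD; rewrite G1f // H1f // nc_minus_low //.
  apply: (triangular_agreement (z_pow_X0 z) (one_minus_z_pow_mX1 z)) => // v vw.
  by rewrite -G1f // -H1f //; case: (low v z vw zD).
(* The unit factor brings the relation into the three-factor shape of [nc_minus_low], with [A1] in
   the middle. *)
have conn A0 A1 : grouplike A1 -> (nc_inv A1 * A0)%nc = Phi_KZ ->
    A0 = (nc_one * A1 * Phi_KZ)%nc.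
  move=> /grouplike_nil g <-.
  by rewrite nc_mul_1_l nc_mul_assoc nc_mul_inv_r // nc_mul_1_l.
(* The constant term of the associator is read off from condition (i) itself, at z = 1/2. *)
have Phi1 : Phi_KZ [] = 1.
  have [g0 g1] := Gg _ D01_half.
  have := conn (G0 (RtoC (/ 2))) (G1 (RtoC (/ 2))) g1 (GP _ D01_half).
  move=> /(f_equal (fun F => F [])); rewrite nc_mul_1_l nc_mul_nil.
  by rewrite (grouplike_nil _ g0) (grouplike_nil _ g1) Cmult_1_l.
have e01 z : D01 z -> G0 z w - H0 z w = G1 z w - H1 z w.
  move=> zD; have [gg0 gg1] := Gg z zD; have [hg0 hg1] := Hg z zD.
  rewrite (conn _ _ gg1 (GP z zD)) (conn _ _ hg1 (HP z zD)) nc_minus_low //.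
  by move=> v vw; case: (low v z vw zD).
(* A point outside [D0] lies in [D1], and on the overlap both expressions agree; near every point
   [h] is thus given by a single differentiable expression. *)
pose h z := if excluded_middle_informative (D0 z) then Gt0 z w - Ht0 z w
  else Gt1 z w - Ht1 z w.
have hD0 z : D0 z -> Gt0 z w - Ht0 z w = h z.
  by rewrite /h; case: excluded_middle_informative.
have hD1 z : D1 z -> Gt1 z w - Ht1 z w = h z.
  move=> zD; rewrite /h; case: excluded_middle_informative => // zD0.
  by rewrite -e0 ?e01 ?e1.
have cover z : D0 z \/ D1 z.
  case: z => x y; case: (excluded_middle_informative (D0 (x, y))) => H; [by left|right].
  move=> [h1 h2]; apply: H => -[h3 h4]; move: h2 h4; rewrite /Re /=; lra.
have dh0 z l m : D0 z -> is_Cderive (fun t => Gt0 t w) z l -> is_Cderive (fun t => Ht0 t w) z m ->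
    is_Cderive h z (l - m).
  move=> zD dl dm; have [r [r0 Hr]] := D0_open z zD.
  apply: (is_Cderive_ext_near _ _ _ _ r r0) (is_Cderive_minus _ _ _ _ _ dl dm) => t /Hr.
  exact: hD0.
have dh1 z l m : D1 z -> is_Cderive (fun t => Gt1 t w) z l -> is_Cderive (fun t => Ht1 t w) z m ->
    is_Cderive h z (l - m).
  move=> zD dl dm; have [r [r0 Hr]] := D1_open z zD.
  apply: (is_Cderive_ext_near _ _ _ _ r r0) (is_Cderive_minus _ _ _ _ _ dl dm) => t /Hr.
  exact: hD1.
have hd z : ex_Cderive h z.
  case: (cover z) => zD.
    have [l Hl] := G0h w z zD; have [m Hm] := H0h w z zD.
    by eexists; apply: dh0 zD Hl Hm.
  have [l Hl] := G1h w z zD; have [m Hm] := H1h w z zD.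
  by eexists; apply: dh1 zD Hl Hm.
have hv eps : (0 < eps)%R -> exists B, forall z l : C, (B < Cmod z)%R ->
   is_Cderive h z l -> (Cmod l <= eps)%R.
  move=> eps0; have e2 : (0 < eps / 2)%R by lra.
  have [B1 HB1] := proj1 (flat_at_inftyE _ _ G0h) G0v w _ e2.
  have [B2 HB2] := proj1 (flat_at_inftyE _ _ H0h) H0v w _ e2.
  have [B3 HB3] := proj1 (flat_at_inftyE _ _ G1h) G1v w _ e2.
  have [B4 HB4] := proj1 (flat_at_inftyE _ _ H1h) H1v w _ e2.
  exists (Rmax (Rmax B1 B2) (Rmax B3 B4)) => z l zB hl.
  have b1 := Rmax_l B1 B2; have b2 := Rmax_r B1 B2.
  have b3 := Rmax_l B3 B4; have b4 := Rmax_r B3 B4.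
  have b5 := Rmax_l (Rmax B1 B2) (Rmax B3 B4); have b6 := Rmax_r (Rmax B1 B2) (Rmax B3 B4).
  have sub (a b : C) : (Cmod a <= eps / 2)%R -> (Cmod b <= eps / 2)%R -> (Cmod (a - b) <= eps)%R.
    by move=> ha hb; apply: Rle_trans (Cmod_triangle _ _) _; rewrite Cmod_opp; lra.
  case: (cover z) => zD.
    have [a Ha] := G0h w z zD; have [b Hb] := H0h w z zD.
    rewrite (is_Cderive_uniq _ _ _ _ hl (dh0 _ _ _ zD Ha Hb)).
    by apply: sub; [apply: HB1 Ha|apply: HB2 Hb] => //; lra.
  have [a Ha] := G1h w z zD; have [b Hb] := H1h w z zD.
  rewrite (is_Cderive_uniq _ _ _ _ hl (dh1 _ _ _ zD Ha Hb)).
  by apply: sub; [apply: HB3 Ha|apply: HB4 Hb] => //; lra.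
have L := Liouville_derivative h hd hv.
have h0 z : h z = 0.
  transitivity (h 0).
    apply: derivative_zero_const => t _; first exact: hd.
    by have [l Hl] := hd (0 + t * (z - 0)); apply: is_Cderive_ext_val Hl (L _ _ Hl).
  have D00 : D0 0 by rewrite /D0 /=; lra.
  by rewrite -hD0 // G00 H00; ring.
move=> z zD.
have d0 : G0 z w - H0 z w = 0 by rewrite e0 // hD0 ?h0 //; case: zD.
have d1 : G1 z w - H1 z w = 0 by rewrite -e01.
by split; [rewrite -(Cplus_0_l (H0 z w)) -d0|rewrite -(Cplus_0_l (H1 z w)) -d1]; ring.
Qed.

(** * The associator *)

Ltac R_ring :=
  match goal with |- @eq _ ?a ?b => change (@eq R a b) end; ring.

(* Taylor coefficients at 0 of the multiple polylogarithm of a word that is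
   empty or ends in xi_1. *)
Fixpoint polylog_coef (w : word) : nat -> R :=
  match w with
  | [] => fun n => match n with O => 1%R | S _ => 0%R end
  | x0 :: w' => fun n => match n with O => 0%R | S _ => (polylog_coef w' n / INR n)%R end
  | x1 :: w' => fun n => match n with
      | O => 0%R
      | S m => (sum_n (polylog_coef w') m / INR n)%R
      end
  end.

Definition ends_x1 (w : word) : Prop := w = [] \/ exists v, w = v ++ [x1].

Lemma ends_x1_tail i w : ends_x1 (i :: w) -> ends_x1 w /\ (w = [] -> i = x1).
Proof.
move=> [//|[[|j v] /= [-> ->]]]; first by split=> //; left.
by split; [right; exists v|case: v].
Qed.

Lemma sum_n_le_INR (a : nat -> R) n : (forall k, 0 <= a k <= 1)%R ->
  (0 <= sum_n a n <= INR (S n))%R.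
Proof.
move=> H; elim: n => [|n IH]; first by rewrite sum_O /=; apply: H.
by rewrite sum_Sn S_INR /plus /=; have := H (S n); rewrite -/(INR (S n)) in IH *; lra.
Qed.

Lemma polylog_coef_bound w n : (0 <= polylog_coef w n <= 1)%R.
Proof.
elim: w n => [|[] w IH] [|n] /=; try lra.
  have n1 : (1 <= INR (S n))%R by apply: (le_INR 1); lia.
  rewrite -/(INR (S n)); have h := IH (S n); split.
    by apply: Rdiv_le_0_compat; lra.
  by apply: (Rmult_le_reg_r (INR (S n))); [lra|rewrite /Rdiv Rmult_assoc Rinv_l; lra].
have n1 : (1 <= INR (S n))%R by apply: (le_INR 1); lia.
rewrite -/(INR (S n)); have h := sum_n_le_INR _ n IH; split.
  by apply: Rdiv_le_0_compat; lra.
by apply: (Rmult_le_reg_r (INR (S n))); [lra|rewrite /Rdiv Rmult_assoc Rinv_l; lra].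
Qed.

Lemma pow_le_1 (x : R) n : (0 <= x <= 1)%R -> (x ^ n <= 1)%R.
Proof. by move=> h; have := pow_incr x 1 n h; rewrite pow1. Qed.

Lemma CV_radius_bounded_coef (a : nat -> R) (x : R) : (forall n, 0 <= a n <= 1)%R ->
  (Rabs x < 1)%R -> Rbar_lt (Rabs x) (CV_radius a).
Proof.
move=> H x1; have x0 := Rabs_pos x.
apply: (Rbar_lt_le_trans _ (Finite ((Rabs x + 1) / 2))); first by rewrite /=; lra.
have [h _] := CV_radius_bounded a; apply: h.
exists 1%R => n; rewrite Rabs_mult -RPow_abs.
rewrite (Rabs_pos_eq (a n)); last by have := H n; lra.
rewrite (Rabs_pos_eq ((Rabs x + 1) / 2)); last lra.
have p1 : (((Rabs x + 1) / 2) ^ n <= 1)%R.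
  by apply: pow_le_1; lra.
have p0 : (0 <= ((Rabs x + 1) / 2) ^ n)%R by apply: pow_le; lra.
rewrite -[X in (_ <= X)%R]Rmult_1_r; apply: Rmult_le_compat => //; have := H n; lra.
Qed.

Lemma PSeries_one x : (Rabs x < 1)%R -> PSeries (polylog_coef []) x = 1%R.
Proof.
move=> x1; rewrite PSeries_decr_1.
  rewrite (PSeries_ext _ (fun _ => 0%R)) // PSeries_const_0 /=; ring.
by apply/CV_radius_inside/CV_radius_bounded_coef => //; apply: polylog_coef_bound.
Qed.

Lemma polylog_coef_0 w : w <> [] -> polylog_coef w 0 = 0%R.
Proof. by case: w => [//|[] w]. Qed.

(** Division by n undoes x d/dx coefficientwise. For a nonempty word the constant coefficient is 0
    on both sides. *)
Lemma PSeries_derive_x0 w x : w <> [] -> (Rabs x < 1)%R ->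
  (x * PSeries (PS_derive (polylog_coef (x0 :: w))) x = PSeries (polylog_coef w) x)%R.
Proof.
move=> w0 x1; rewrite -PSeries_incr_1; apply: PSeries_ext => -[|n].
  by rewrite /= polylog_coef_0.
rewrite /PS_incr_1 /PS_derive [polylog_coef (x0 :: w) _]/= -/(INR (S n)).
by field; apply: not_0_INR.
Qed.

(** The coefficients of the derivative are partial sums, and multiplication by 1 - x takes their
    differences. *)
Lemma PSeries_derive_x1 w x : (Rabs x < 1)%R ->
  ((1 - x) * PSeries (PS_derive (polylog_coef (x1 :: w))) x = PSeries (polylog_coef w) x)%R.
Proof.
move=> xx1; set A := PS_derive _.
have AE n : A n = sum_n (polylog_coef w) n.
  rewrite /A /PS_derive [polylog_coef _ _]/= -/(INR (S n)).
  by field; apply: not_0_INR.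
have exA : ex_pseries A x.
  apply: CV_radius_inside; rewrite CV_radius_derive.
  by apply: CV_radius_bounded_coef => //; apply: polylog_coef_bound.
rewrite Rmult_minus_distr_r Rmult_1_l -PSeries_incr_1 -PSeries_minus //; last first.
  exact: ex_pseries_incr_1.
apply: PSeries_ext => -[|n]; rewrite /PS_minus /PS_plus /PS_opp /PS_incr_1 !AE.
  by rewrite sum_O /plus /opp /zero /=; ring.
by rewrite sum_Sn /plus /opp /=; ring.
Qed.

(** The real point z with log (1 - z) = - s; it runs through [0, 1) as s runs through the
    nonnegative reals. *)
Definition one_sub_exp (s : R) : R := (1 - exp (- s))%R.

Lemma one_sub_exp_bound s : (0 <= s)%R -> (0 <= one_sub_exp s < 1)%R.
Proof.
move=> s0; have := exp_pos (- s); rewrite /one_sub_exp.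
have : (exp (- s) <= 1)%R.
  rewrite -exp_0; case: (Rle_lt_or_eq_dec _ _ s0) => [h|<-]; last by rewrite Ropp_0; lra.
  by apply/Rlt_le/exp_increasing; lra.
lra.
Qed.

Lemma is_derive_one_sub_exp s : is_derive one_sub_exp s (exp (- s)).
Proof. by rewrite /one_sub_exp; auto_derive => //; ring. Qed.

Lemma is_derive_PSeries_one_sub_exp w s : (0 <= s)%R ->
  is_derive (fun s => PSeries (polylog_coef w) (one_sub_exp s)) s
    (exp (- s) * PSeries (PS_derive (polylog_coef w)) (one_sub_exp s))%R.
Proof.
move=> s0; have b := one_sub_exp_bound s s0.
apply: (is_derive_comp (PSeries (polylog_coef w)) one_sub_exp); last exact: is_derive_one_sub_exp.
apply: is_derive_PSeries; apply: CV_radius_bounded_coef; first exact: polylog_coef_bound.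
by rewrite Rabs_pos_eq; lra.
Qed.

Lemma strip_real (x : R) : strip x.
Proof. by rewrite /strip /=; have := PI_RGT_0; lra. Qed.

(** At a nonempty word ending in xi_1 the product Lhat X_0 has coefficient 0, so the equation of
    Lhat becomes that of the polylogarithms along u = - s; both sides vanish at s = 0. *)
Lemma Lhat_real w s : ends_x1 w -> (0 < s)%R ->
  Lhat (RtoC (- s)) w = RtoC (PSeries (polylog_coef w) (one_sub_exp s)).
Proof.
elim: w s => [|i w IH] s we s0.
  have := one_sub_exp_bound s ltac:(lra) => b.
  rewrite PSeries_one; last by rewrite Rabs_pos_eq; lra.
  by case: (character_Lhat (- s)%R (strip_real _)).
have [wt wi] := ends_x1_tail i w we.
set psi := fun s => PSeries (polylog_coef (i :: w)) (one_sub_exp s).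
pose dpsi t := (exp (- t) * PSeries (PS_derive (polylog_coef (i :: w))) (one_sub_exp t))%R.
have ue (t : R) : 0 + t * (-1) = RtoC (- t) :> C.
  by rewrite /RtoC /Cplus /Cmult /=; congr pair; ring.
have dM (t : R) : (0 < t)%R -> is_Cderive (fun u => Lhat u (i :: w)) (RtoC (- t)) (- RtoC (dpsi t)).
  move=> t0; have u0 : RtoC (- t) <> 0 by move=> /RtoC_inj; lra.
  have e1 : exp (- t) <> 1%R.
    by rewrite -exp_0 => /exp_inv; lra.
  have xb := one_sub_exp_bound t ltac:(lra).
  apply: is_Cderive_ext_val (is_series_derive_Lhat _ (strip_real (- t)) u0 (i :: w)) _.
  rewrite /Lhat_rhs /nc_add /nc_scale !mono_letter_mul_cons.
  have -> : (Lhat (RtoC (- t)) * mono [x0])%nc (i :: w) = 0.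
    case: we => [//|[v ->]]; by rewrite mul_mono_letter_rcons.
  have -> : kappa (RtoC (- t)) = RtoC (exp (- t) / (exp (- t) - 1)).
    rewrite /kappa Cexp_RtoC RtoC_div ?RtoC_minus //; lra.
  rewrite /dpsi; move: wi we {psi dpsi}; case: i => wi we /=.
    have w0 : w <> [] by move=> /wi.
    rewrite IH // -(PSeries_derive_x0 w); [|by []|by rewrite Rabs_pos_eq; lra].
    set P := PSeries _ _; transitivity (RtoC (exp (- t) / (exp (- t) - 1) * (one_sub_exp t * P))).
      by rewrite !RtoC_mult; ring.
    by rewrite -RtoC_opp; congr RtoC; rewrite /one_sub_exp; field; lra.
  rewrite IH // -(PSeries_derive_x1 w); last by rewrite Rabs_pos_eq; lra.
  set P := PSeries _ _; transitivity (- RtoC ((1 - one_sub_exp t) * P)); first ring.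
  by congr Copp; congr RtoC; rewrite /one_sub_exp; ring.
(* Reduces the complex equality to real ones: [c = 1] and [c = - Ci] recover both components. *)
have key c : Re (c * Lhat (RtoC (- s)) (i :: w)) = (Re c * psi s)%R.
  pose phi (t : R) := (Re (c * Lhat (0 + t * (-1))%C (i :: w))%C - Re c * psi t)%R.
  have dphi (t : R) : (0 < t)%R -> is_derive phi t 0%R.
    move=> t0; have := dM t t0; rewrite -ue => /(is_derive_Re_line _ c) h1.
    have h2 := is_derive_scal _ t (Re c) _ (is_derive_PSeries_one_sub_exp (i :: w) t ltac:(lra)).
    have h3 := is_derive_minus _ _ t _ _ h1 h2.
    have e : minus (Re (c * (-1 * - RtoC (dpsi t)))%C) (scal (Re c) (dpsi t)) = 0%R.
      by rewrite /minus /plus /opp /scal /= /mult /= /Re; ring.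
    by rewrite -e; exact: h3.
  (* The equation is available for t > 0 only; at t = 0 the mean value theorem asks for
     continuity. *)
  have cphi (t : R) : (0 <= t)%R -> continuity_pt phi t.
    move=> t0; apply/continuity_pt_filterlim.
    suff : continuous phi t by [].
    apply: ex_derive_continuous; apply: ex_derive_minus.
      have [l Hl] := ex_Cderive_Lhat (i :: w) (0 + t * (-1)) ltac:(rewrite ue; exact: strip_real).
      by eexists; apply: (is_derive_Re_line _ c _ _ _ _ Hl).
    by eexists; apply: is_derive_scal; apply: is_derive_PSeries_one_sub_exp.
  have [] := MVT_gen phi 0 s (fun _ => 0%R).
  - by rewrite Rmin_left ?Rmax_right; try lra; move=> t ts; apply: dphi; lra.
  - by rewrite Rmin_left ?Rmax_right; try lra; move=> t ts; apply: cphi; lra.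
  move=> d [_]; rewrite Rmult_0_l /phi ue.
  have -> : 0 + 0%R * -1 = 0 by ring.
  rewrite Lhat_0 nc_one_cons /psi /one_sub_exp Ropp_0 exp_0 Rminus_diag PSeries_0 polylog_coef_0 //.
  by rewrite Cmult_0_r /=; lra.
have k1 := key 1; have k2 := key (- Ci).
move: k1 k2; rewrite -/(psi s) Cmult_1_l; move: (psi s) => r.
case: (Lhat (RtoC (- s)) (i :: w)) => p q.
by rewrite /Re /Ci /RtoC /= => k1 k2; congr pair; lra.
Qed.

Lemma sum_n_shift (a : nat -> R) n : sum_n a n = (a O + sum_n_m a 1 n)%R.
Proof.
by rewrite /sum_n sum_Sn_m //; lia.
Qed.

(** The outermost summation index is the Taylor index n. The exponent [k] accounts for the letters
    xi_0 already read, and at a letter xi_1 the partial sum up to n - 1 is the sum over the smaller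
    indices. *)
Lemma mzv_partial_coef w : ends_x1 w ->
  (forall k N, w <> [] -> mzv_partial (word_index_from k w) N =
     sum_n_m (fun n => (/ INR n ^ k * polylog_coef w n)%R) 1 N) /\
  (forall N, mzv_partial (word_index w) N = sum_n (polylog_coef w) N).
Proof.
elim: w => [|i w IH] we.
  split=> // N; rewrite sum_n_shift /=.
  rewrite (sum_n_m_ext_loc _ (fun _ => zero)) ?sum_n_m_const_zero /zero /=; first ring.
  by move=> [|n] nN //; lia.
have [wt wi] := ends_x1_tail i w we; have [IH1 IH2] := IH wt.
have main k N : mzv_partial (word_index_from k (i :: w)) N =
     sum_n_m (fun n => / INR n ^ k * polylog_coef (i :: w) n)%R 1 N.
  case: i we wi => we wi.
    have w0 : w <> [] by move=> /wi.
    rewrite [word_index_from _ _]/= IH1 //; apply: sum_n_m_ext_loc => -[|n] nN; first lia.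
    rewrite [polylog_coef (x0 :: w) _]/= -/(INR (S n)).
    rewrite -[(INR (S n) ^ S k)%R]/(INR (S n) * INR (S n) ^ k)%R.
    have n0 : INR (S n) <> 0%R by apply: not_0_INR.
    by rewrite Rinv_mult; rewrite /Rdiv; R_ring.
  rewrite [mzv_partial _ _]/=; apply: sum_n_m_ext_loc => -[|n] nN; first lia.
  rewrite -/(word_index w) IH2 Nat.sub_succ Nat.sub_0_r.
  rewrite [polylog_coef (x1 :: w) _]/= -/(INR (S n)).
  have n0 : INR (S n) <> 0%R by apply: not_0_INR.
  by rewrite Rinv_mult; rewrite /Rdiv; R_ring.
split=> [k N _ //|N]; rewrite /word_index main sum_n_shift polylog_coef_0 // Rplus_0_l.
by apply: sum_n_m_ext => n /=; rewrite Rinv_1 Rmult_1_l.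
Qed.

(** Abel's theorem and its converse for nonnegative coefficients. The function is increasing, hence
    at most [L]; so are the partial sums at 1, since x^N -> 1 for fixed N, and they converge to some
    l <= L. Conversely the function is at most l, so that L <= l. *)
Lemma mzv_limit w (L : R) : ends_x1 w ->
  (forall eps, (0 < eps)%R -> exists s0, forall s, (s0 <= s)%R ->
     (Rabs (PSeries (polylog_coef w) (one_sub_exp s) - L) <= eps)%R) ->
  mzv (word_index w) = L.
Proof.
move=> we H; set a := polylog_coef w.
have a01 n : (0 <= a n <= 1)%R by apply: polylog_coef_bound.
pose psi s := PSeries a (one_sub_exp s).
have exs s : (0 <= s)%R -> ex_series (fun n => a n * one_sub_exp s ^ n)%R.
  move=> s0; apply/ex_pseries_R/CV_radius_inside/CV_radius_bounded_coef => //.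
  by have b := one_sub_exp_bound s s0; rewrite Rabs_pos_eq; lra.
have mono s t : (0 <= s <= t)%R -> (psi s <= psi t)%R.
  move=> st; apply: Series_le; last by apply: exs; lra.
  have bs := one_sub_exp_bound s ltac:(lra).
  have xst : (one_sub_exp s <= one_sub_exp t)%R.
    rewrite /one_sub_exp; suff : (exp (- t) <= exp (- s))%R by lra.
    by case: (Req_dec s t) => [->|ne]; [lra|apply/Rlt_le/exp_increasing; lra].
  move=> n; split; first by apply: Rmult_le_pos; [case: (a01 n)|apply: pow_le; lra].
  by apply: Rmult_le_compat_l; [case: (a01 n)|apply: pow_incr; lra].
have psiL s : (0 <= s)%R -> (psi s <= L)%R.
  move=> s0; apply: le_epsilon => eps e0; have [t0 Ht] := H eps e0.
  have := Ht (Rmax s t0) (Rmax_r _ _); have := mono s (Rmax s t0) (conj s0 (Rmax_l _ _)).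
  by rewrite /psi -/a /Rabs; case: Rcase_abs; lra.
have part s N : (0 <= s)%R -> (sum_n (fun n => a n * one_sub_exp s ^ n) N <= psi s)%R.
  move=> s0; have b := one_sub_exp_bound s s0.
  have p n : (0 <= a n * one_sub_exp s ^ n)%R.
    by apply: Rmult_le_pos; [case: (a01 n)|apply: pow_le; lra].
  have lim := Series_correct _ (exs s s0).
  apply: (is_lim_seq_incr_compare (sum_n (fun n => a n * one_sub_exp s ^ n)%R)) => //.
  by move=> n; rewrite sum_Sn /plus /=; have := p (S n); rewrite /=; lra.
have A0 N : (0 <= sum_n a N)%R by case: (sum_n_le_INR a N a01).
have AL N : (sum_n a N <= L)%R.
  apply: le_epsilon => eps e0.
  (* With exponent 0 this provides X such that the loss N e^{-X} times the partial sum is at most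
     eps. *)
  have [X [X0 HX]] := pow_mul_le_exp (sum_n a N * INR N) 0 0 eps
     ltac:(apply: Rmult_le_pos; [exact: A0|exact: pos_INR]) ltac:(lra) e0.
  have b := one_sub_exp_bound X X0.
  (* Bernoulli's inequality for (1 - e^{-X})^N. *)
  have bern : (1 - INR N * exp (- X) <= one_sub_exp X ^ N)%R.
    elim: (N) => [|n IH]; first by rewrite /= Rmult_0_l; lra.
    rewrite S_INR [(_ ^ S n)%R]/= {1}/one_sub_exp.
    have e1 := exp_pos (- X).
    have p1 : (one_sub_exp X ^ n <= 1)%R by apply: pow_le_1; lra.
    have : (exp (- X) * one_sub_exp X ^ n <= exp (- X) * 1)%R by apply: Rmult_le_compat_l; lra.
    lra.
  have h1 : (sum_n a N * one_sub_exp X ^ N <= psi X)%R.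
    apply: Rle_trans (part X N X0).
    rewrite -[X in (X <= _)%R]/(mult (sum_n a N) (one_sub_exp X ^ N)%R) -sum_n_mult_r.
    rewrite !sum_n_Reals; apply: sum_Rle => n nN; rewrite /mult /=.
    apply: Rmult_le_compat_l; first by case: (a01 n).
    have -> : N = (n + (N - n))%nat by lia.
    rewrite pow_add -[X in (_ <= X)%R]Rmult_1_r.
    apply: Rmult_le_compat_l; first by apply: pow_le; lra.
    by apply: pow_le_1; lra.
  have h2 := psiL X X0; have h3 := HX X ltac:(lra).
  have : (sum_n a N * (1 - INR N * exp (- X)) <= sum_n a N * one_sub_exp X ^ N)%R.
    exact: Rmult_le_compat_l.
  have : (sum_n a N * INR N * exp (- X) <= eps)%R.
    have eX := exp_pos X; apply: (Rmult_le_reg_r (exp X)) => //.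
    rewrite Rmult_assoc -exp_plus Rplus_opp_l exp_0; rewrite /= in h3; lra.
  lra.
have incr n : (sum_n a n <= sum_n a (S n))%R.
  by rewrite sum_Sn /plus /=; have := a01 (S n); lra.
have [l Hl] : ex_finite_lim_seq (sum_n a).
  exact: (ex_finite_lim_seq_incr _ L).
have lL : (l <= L)%R.
  have := is_lim_seq_le _ _ l L AL Hl (is_lim_seq_const L); by [].
have psil s : (0 <= s)%R -> (psi s <= l)%R.
  move=> s0; have b := one_sub_exp_bound s s0.
  have := is_lim_seq_le (sum_n (fun n => a n * one_sub_exp s ^ n)%R) (sum_n a) (psi s) l.
  apply=> //; last exact: Series_correct _ (exs s s0).
  move=> N; rewrite !sum_n_Reals; apply: sum_Rle => n nN.
  rewrite -[X in (_ <= X)%R]Rmult_1_r; apply: Rmult_le_compat_l; first by case: (a01 n).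
  by apply: pow_le_1; lra.
have Ll : (L <= l)%R.
  apply: le_epsilon => eps e0; have [t0 Ht] := H eps e0.
  have := Ht (Rmax 0 t0) (Rmax_r _ _); have := psil (Rmax 0 t0) (Rmax_l _ _).
  by rewrite /psi -/a /Rabs; case: Rcase_abs; lra.
have eL : l = L by lra.
rewrite /mzv (Lim_seq_ext _ (sum_n a)) ?(is_lim_seq_unique _ _ Hl) //.
by have [_] := mzv_partial_coef w we.
Qed.

(* z -> 1 along the real axis from the left, i.e. u = log(1 - z) -> - oo *)
Definition ray (u : C) : Prop := exists s : R, (1 <= s)%R /\ u = RtoC (- s).

Lemma ray_strip u : ray u -> strip u.
Proof. by move=> [s [_ ->]]; apply: strip_real. Qed.

(** This is |1 - z|, the rate of convergence to the associator up to powers of the logarithm. *)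
Definition decay (u : C) : R := Cmod (Cexp u).

Lemma decay_ray s : decay (RtoC (- s)) = exp (- s).
Proof. by rewrite /decay Cmod_Cexp. Qed.

Lemma exp_m1_half : (exp (- (1)) <= / 2)%R.
Proof.
have h := exp_ineq1_le 1; rewrite exp_Ropp; apply: Rinv_le_contravar; lra.
Qed.

Lemma decay_bound u : ray u -> (0 < decay u <= / 2)%R.
Proof.
move=> [s [s1 ->]]; rewrite decay_ray; split; first exact: exp_pos.
apply: Rle_trans exp_m1_half.
case: (Rle_lt_or_eq_dec _ _ s1) => [h|<-]; last lra.
by apply/Rlt_le/exp_increasing; lra.
Qed.

Lemma growth_decay_eventually (f : C -> C) : growth ray decay f ->
  forall eps, (0 < eps)%R -> exists s0, forall s, (s0 <= s)%R -> (1 <= s)%R ->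
    (Cmod (f (RtoC (- s))) <= eps)%R.
Proof.
move=> [K [k [K0 H]]] eps e0.
have [X [X0 HX]] := pow_mul_le_exp K 1 k eps K0 ltac:(lra) e0.
exists X => s sX s1; have [_ h] := H (RtoC (- s)) (ex_intro _ s (conj s1 eq_refl)).
apply: Rle_trans h _; rewrite decay_ray Cmod_R Rabs_Ropp Rabs_pos_eq; last lra.
have es := exp_pos s; apply: (Rmult_le_reg_r (exp s)) => //.
rewrite Rmult_assoc -exp_plus Rplus_opp_l exp_0 Rmult_1_r; exact: HX.
Qed.

(** Identities for the associator are proved by exhibiting the difference of both sides as a
    decaying function that is constant. *)
Lemma growth_decay_const c : growth ray decay (fun _ => c) -> c = 0.
Proof.
move=> H; apply: Cmod_eq_0; apply: Rle_antisym (Cmod_ge_0 _).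
apply: le_epsilon => eps e0; have [s0 Hs] := growth_decay_eventually _ H eps e0.
by have := Hs (Rmax s0 1) (Rmax_l _ _) (Rmax_r _ _); lra.
Qed.

Lemma growth_decay_1 f : growth ray decay f -> growth ray (fun _ => 1%R) f.
Proof.
move=> [K [k [K0 H]]]; exists K, k; split=> // u ur; split; first lra.
have [_ h] := H u ur; apply: Rle_trans h _; apply: Rmult_le_compat_l.
  by apply: Rmult_le_pos => //; apply: growth_pow_pos.
by have := decay_bound u ur; lra.
Qed.

(* log z in terms of u = log(1 - z) *)
Definition other_log (u : C) : C := Clog (1 - Cexp u).

(** For 0 < x <= 1/2 one has 1 / (1 - x) <= 1 + 2 x <= e^{2 x}, hence |log (1 - x)| <= 2 x. The ray
    starts at s = 1 because e^{-1} <= 1/2. *)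
Lemma other_log_bound u : ray u -> (Cmod (other_log u) <= 2 * decay u)%R /\
  D01 (1 - Cexp u) /\ Clog (1 - (1 - Cexp u)) = u.
Proof.
move=> ur; have d := decay_bound u ur; case: ur d => s [s1 ->]; rewrite decay_ray => d.
have ex := exp_pos (- s).
have -> : 1 - Cexp (RtoC (- s)) = RtoC (1 - exp (- s)) by rewrite Cexp_RtoC RtoC_minus.
split; last split.
- rewrite /other_log Cexp_RtoC -RtoC_minus Clog_RtoC ?Cmod_R; last lra.
  have l0 : (ln (1 - exp (- s)) <= 0)%R by rewrite -ln_1; apply: ln_le; lra.
  rewrite Rabs_left1 // -ln_Rinv; last lra.
  set x := exp (- s) in d ex *.
  have h := exp_ineq1_le (2 * x).
  apply: (Rle_trans _ (ln (exp (2 * x)))); last by rewrite ln_exp; lra.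
  apply: ln_le; first by apply: Rinv_0_lt_compat; lra.
  apply: Rle_trans h; apply: (Rmult_le_reg_r (1 - x)); first lra.
  rewrite Rinv_l; last lra.
  have : (0 <= x * (1 - 2 * x))%R by apply: Rmult_le_pos; lra.
  lra.
- by split=> -[_ /=]; lra.
- rewrite -RtoC_minus Clog_RtoC; last lra.
  by rewrite (_ : 1 - (1 - exp (- s)) = exp (- s))%R ?ln_exp //; ring.
Qed.

Lemma growth_other_log : growth ray decay other_log.
Proof.
exists 2%R, O; split; first lra.
move=> u ur; have := decay_bound u ur; have [h _] := other_log_bound u ur.
by rewrite /= => d; split; lra.
Qed.

Lemma growth_comp_other_log f : growth strip Cmod f ->
  growth ray decay (fun u => f (other_log u)).
Proof.
move=> [K [k [K0 H]]]; exists (K * 2 ^ k * 2)%R, O; split.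
  by apply: Rmult_le_pos; [apply: Rmult_le_pos => //; apply: pow_le|]; lra.
move=> u ur; have d := decay_bound u ur; have [h _] := other_log_bound u ur; split; first lra.
have [_ h2] := H (other_log u) (strip_Clog _); apply: Rle_trans h2 _.
have m0 := Cmod_ge_0 (other_log u).
rewrite [(_ ^ 0)%R]/= Rmult_1_r (Rmult_assoc (K * _) 2); apply: Rmult_le_compat => //.
  by apply: Rmult_le_pos => //; apply: growth_pow_pos.
by apply: Rmult_le_compat_l => //; apply: pow_incr; lra.
Qed.

(* (1-z)^{X_1} L^(0)(z), which tends to the associator as z -> 1 *)
Definition regularized (u : C) : series := (Ftil u * exp_letter x0 (other_log u))%nc.

(** * The constant connecting the two solutions *)

Section Connection.
Context (Phi : series) (HPhi : forall z, D01 z -> KZ0 z = (KZ1 z * Phi)%nc).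

Let B (u : C) : series := (regularized u + (-1) *: Phi)%nc.

(** Inserting L^(0) = L^(1) Phi gives B = e^{u X_1} N e^{-u X_1} Phi, where 1 + N is the holomorphic
    factor of L^(1). The coefficients of N are of the order of |log z|, hence of |1 - z|, and the
    conjugation only costs powers of |u|. *)
Lemma series_growth_regularized_sub : series_growth ray decay B.
Proof.
pose N u : series := (dual (Lhat (other_log u)) + (-1) *: nc_one)%nc.
have BE u : ray u -> B u = (exp_letter x1 u * N u * (exp_letter x1 (- u) * Phi))%nc.
  move=> ur; have [_ [zD uE]] := other_log_bound u ur.
  have KZ0E : regularized u = (exp_letter x1 u * KZ0 (1 - Cexp u))%nc.
    by rewrite /regularized /KZ0 uE /Ftil /z_pow_X0 nc_mul_assoc.
  have KZ1E : KZ1 (1 - Cexp u) = (dual (Lhat (other_log u)) * exp_letter x1 (- u))%nc.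
    by rewrite /KZ1 /reflect /KZ0 dual_mul dual_z_pow_X0 /one_minus_z_pow_mX1 uE one_sub_sub.
  apply: series_ext => w.
  rewrite /B /nc_add KZ0E HPhi // KZ1E /nc_scale.
  rewrite -(nc_mul_assoc _ (N u)) (_ : N u * _ =
     dual (Lhat (other_log u)) * (exp_letter x1 (- u) * Phi) +
     (-1) *: (exp_letter x1 (- u) * Phi))%nc; last first.
    by apply: series_ext => v; rewrite nc_mul_plus_l nc_mul_scale_l nc_mul_1_l.
  rewrite nc_mul_plus_r nc_mul_scale_r !nc_mul_assoc exp_letter_opp nc_mul_1_l; ring.
have HN : series_growth ray decay N.
  move=> w.
  have g := growth_comp_other_log _ (series_growth_Lhat_sub (map swap w)).
  apply: growth_ext (growth_mult1 _ _ _ _ (growth_const ray ((-1) ^ length w)) g) => // u _.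
  rewrite /N /nc_add /nc_scale -{2}dual_one /dual; ring.
have He : growth ray (fun _ => 1%R) (fun u => - u).
  apply: growth_ext (growth_mult1 _ _ _ _ (growth_const ray (-1)) (growth_id ray)) => // u _; ring.
move=> w; apply: growth_ext (series_growth_mulr1 ray decay
   (fun u => exp_letter x1 u * N u)%nc (fun u => exp_letter x1 (- u) * Phi)%nc _ _ w).
- by move=> u /BE ->.
- by [].
- apply: series_growth_mul1 HN; exact/series_growth_exp/growth_id.
- apply: series_growth_mul1; last exact: series_growth_const.
  exact: series_growth_exp.
Qed.

Lemma character_regularized u : ray u -> character (regularized u).
Proof.
move=> /ray_strip us; apply: character_mul; last exact: character_exp_letter.
exact: character_Ftil.
Qed.

Lemma Phi_limit w f : growth ray decay (fun u => regularized u w - f) -> Phi w = f.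
Proof.
move=> H; suff e : Phi w - f = 0 by rewrite -(Cplus_0_l f) -e; ring.
apply: growth_decay_const.
apply: growth_ext (growth_plus _ _ _ _ H (growth_mult1 _ _ _ _ (growth_const ray (-1))
  (series_growth_regularized_sub w))) => // u _.
rewrite /B /nc_add /nc_scale; ring.
Qed.

(** [regularized] is a character and equals B + Phi. Expanding its shuffle relation leaves the
    shuffle defect of Phi plus terms that all contain a factor B and decay. *)
Lemma character_Phi : character Phi.
Proof.
have z0 u : ray u -> (0 <= decay u)%R by move=> /decay_bound; lra.
split.
  apply: Phi_limit; apply: growth_ext (growth_zero ray decay z0) => // u ur.
  by case: (character_regularized u ur) => -> _; ring.
move=> s t.
have G := series_growth_regularized_sub.
have G1 w := growth_decay_1 _ (G w).
suff e : shf Phi s t - Phi s * Phi t = 0.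
  by rewrite -(Cplus_0_l (Phi s * Phi t)) -e; ring.
apply: growth_decay_const.
have gs : growth ray decay (fun u => shf (B u) s t).
  rewrite /shf; elim: (shuffle_word s t) => [|w l IH]; first exact: growth_zero.
  exact: growth_plus (G w) IH.
have g1 := growth_mult1 _ _ _ _ (growth_const ray (-1)) gs.
have g2 := growth_mult1 _ _ _ _ (growth_const ray (Phi s)) (G t).
have g3 := growth_mult1 _ _ _ _ (growth_const ray (Phi t)) (G s).
have g4 := growth_mult1 _ _ _ _ (G1 s) (G t).
apply: growth_ext (growth_plus _ _ _ _ (growth_plus _ _ _ _ g1 g2)
  (growth_plus _ _ _ _ g3 g4)) => // u ur.
have [_ /(_ s t)] := character_regularized u ur.
have -> : regularized u = (B u + Phi)%nc.
  by apply: series_ext => w; rewrite /B /nc_add /nc_scale; ring.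
rewrite shf_plus /nc_add => h.
rewrite (_ : shf Phi s t = shf (B u) s t + shf Phi s t - shf (B u) s t); last ring.
by rewrite h; ring.
Qed.

Lemma exp_letter_single i t : exp_letter i t [i] = t.
Proof. by rewrite /exp_letter; case: i; case: word_eq_dec => // _ /=; field. Qed.

(** [Ftil] has no linear terms, so the only linear term of [regularized] is log z at X_0, which
    decays as z -> 1. *)
Lemma Phi_letters : Phi [x0] = 0 /\ Phi [x1] = 0.
Proof.
have e01 t : exp_letter x0 t [x1] = 0 by rewrite /exp_letter; case: word_eq_dec.
have rE u i : ray u -> regularized u [i] = exp_letter x0 (other_log u) [i].
  move=> /ray_strip us; have [t0 t1] := Ftil_letters u us; have [te _] := character_Ftil u us.
  rewrite /regularized nc_mul_cons nc_mul_nil te /shift.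
  by case: i; rewrite ?t0 ?t1; ring.
split; apply: Phi_limit.
  apply: growth_ext growth_other_log => // u ur.
  by rewrite rE // exp_letter_single; ring.
have z0 u : ray u -> (0 <= decay u)%R by move=> /decay_bound; lra.
apply: growth_ext (growth_zero ray decay z0) => // u ur.
by rewrite rE // e01; ring.
Qed.

(** A word that starts with xi_0 and ends in xi_1 sees only the constant terms of the powers of X_1
    on the left and of X_0 on the right. *)
Lemma regularized_S10 u w : regularized u (x0 :: w ++ [x1]) = Lhat u (x0 :: w ++ [x1]).
Proof.
rewrite /regularized app_comm_cons nc_mul_rcons exp_letter_nil.
have e0 v t : exp_letter x0 t (v ++ [x1]) = 0.
  rewrite /exp_letter; case: word_eq_dec => // e.
  move: e; rewrite length_app Nat.add_comm [repeat _ _]/= repeat_cons => e.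
  by case: (app_inj_tail _ _ _ _ e).
rewrite (nc_mul_ext _ (Ftil u) _ nc_zero) //; last by move=> v _; apply: e0.
rewrite (nc_mul_low_r _ nc_zero) // /nc_zero.
rewrite /Ftil -app_comm_cons nc_mul_cons exp_letter_nil shift_zero_mul; first by ring.
by move=> v; rewrite /shift /exp_letter; case: word_eq_dec.
Qed.

Lemma Phi_S10 w : S10_word w -> Phi w = RtoC (mzv (word_index w)).
Proof.
move=> [->|[v ->]].
  have [-> _] := character_Phi.
  by rewrite /mzv /= Lim_seq_const.
set w' := x0 :: v ++ [x1].
have we : ends_x1 w' by right; exists (x0 :: v).
have real s : (1 <= s)%R ->
    regularized (RtoC (- s)) w' = RtoC (PSeries (polylog_coef w') (one_sub_exp s)).
  by move=> s1; rewrite regularized_S10 Lhat_real //; lra.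
have lim := growth_decay_eventually _ (series_growth_regularized_sub w').
have BE s : (1 <= s)%R ->
    B (RtoC (- s)) w' = RtoC (PSeries (polylog_coef w') (one_sub_exp s)) - Phi w'.
  by move=> s1; rewrite /B /nc_add /nc_scale real //; ring.
(* The approximating values are real, so the imaginary part of the limit is smaller than every
   positive number. *)
have imag : snd (Phi w') = 0%R.
  apply: cond_eq => eps e0; rewrite Rminus_0_r.
  have [s0 Hs] := lim (eps / 2)%R ltac:(lra).
  have s1 := Rmax_r s0 1; have := Hs _ (Rmax_l s0 1) s1; rewrite BE // => h.
  have := snd_le_Cmod (RtoC (PSeries (polylog_coef w') (one_sub_exp (Rmax s0 1))) - Phi w').
  rewrite /= Rplus_0_l Rabs_Ropp => k; move: h k; rewrite /=; lra.
have -> : Phi w' = RtoC (fst (Phi w')).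
  by move: imag; case: (Phi w') => p q /= ->.
congr RtoC; symmetry; apply: mzv_limit => // eps e0.
have [s0 Hs] := lim eps e0; exists (Rmax s0 1) => s hs.
have h1 := Rmax_l s0 1; have h2 := Rmax_r s0 1.
have := Hs s ltac:(lra) ltac:(lra); rewrite BE; last lra.
exact: Rle_trans (fst_le_Cmod (RtoC _ - Phi w')).
Qed.

Lemma Phi_eq_Phi_KZ : Phi = Phi_KZ.
Proof.
have [p0 p1] := Phi_letters.
by apply: Phi_KZE => //; [exact: character_Phi|exact: Phi_S10].
Qed.
End Connection.

Lemma KZ_solution_mul_const G (Phi : series) : KZ_solution G ->
  KZ_solution (fun z => G z * Phi)%nc.
Proof.
move=> H w z zD.
have := is_series_derive_mul G (fun _ => Phi) z _ _ (fun w => H w z zD)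
  (is_series_derive_const Phi z) w.
move=> h; apply: is_Cderive_ext_val h _.
rewrite /nc_add -/(KZop z) nc_mul_assoc (nc_mul_low_r _ nc_zero) // /nc_zero; ring.
Qed.

(** L^(1) Phi is again a solution. Choosing Phi so that it agrees with L^(0) at z = 1/2 makes the
    two equal on D01, and the limit z -> 1 identifies Phi. *)
Lemma connection z : D01 z -> (nc_inv (KZ1 z) * KZ0 z)%nc = Phi_KZ.
Proof.
pose h := RtoC (/ 2).
pose Phi := (nc_inv (KZ1 h) * KZ0 h)%nc.
have KZ1_nil t : KZ1 t [] = 1 by case: (character_KZ1 t).
have HPhi : eq_on_D01 KZ0 (fun z => KZ1 z * Phi)%nc.
  apply: KZ_unique; first exact: KZ_solution_KZ0.
    apply: KZ_solution_mul_const; exact: KZ_solution_reflect KZ_solution_KZ0.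
  by rewrite /Phi nc_mul_assoc nc_mul_inv_r // nc_mul_1_l.
move=> zD; rewrite -(Phi_eq_Phi_KZ Phi HPhi) HPhi //.
by rewrite nc_mul_assoc nc_mul_inv_l // nc_mul_1_l.
Qed.

Theorem theorem12 :
  exists F0 F1 : C -> series,
    (riemann_hilbert_solution F0 F1 /\
     forall G0 G1 : C -> series,
       riemann_hilbert_solution G0 G1 ->
       eq_on_D01 G0 F0 /\ eq_on_D01 G1 F1) /\
    fundamental_solution_at_0 F0 /\
    fundamental_solution_at_1 F1.
Proof.
have H := riemann_hilbert_KZ0_KZ1 connection.
exists KZ0, KZ1; split; last by split; [exact: fundamental_KZ0|exact: fundamental_KZ1].
by split=> // G0 G1 HG; apply: riemann_hilbert_unique HG H.
Qed.
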